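(* (Local Lagrange-d'Alembert-Poincaré equations by $n$ stages, general case.) Let $Q=X\times G$ be the trivial principal bundle with $G$ acting by $g(x,h)=(x,gh)$, where $G=N_0\rhd N_1\rhd\cdots\rhd N_{n+1}=\{e\}$ is a chain of closed subgroups, each normal in the preceding one. Let $L:TQ\to\mathbb R$ be a $G$-invariant Lagrangian and $\mathcal D\subset TQ$ a $G$-invariant distribution with $T_qQ=\mathcal D_q+\mathcal V_q$ for all $q\in Q$, where $\mathcal V$ is the vertical distribution. Let $\mathcal A$ be the nonholonomic connection for a $G$-invariant metric on $Q$. Put $\mathcal S_x=\{\nu\in\mathfrak g:(x,e,0,\nu)\in\mathcal D\}$. Let $q(t)=(x(t),g(t))$, $t\in[t_0,t_1]$, be a curve with $\dot q(t)\in\mathcal D_{q(t)}$ for all $t$, and set $$v(t)=\mathcal A(x)\dot x+g^{-1}\dot g=\bigoplus_{i=0}^n\eta^{(i,i+1)}(t)\in\mathcal S_{x(t)},\quad \mu_i=\frac{\partial l}{\partial\eta^{(i,i+1)}}(x,\dot x,v)\in\mathfrak n_{(i,i+1)}^*,\quad \mathcal A(x)\dot x=\bigoplus_{k=0}^n\mathcal A^{(k,k+1)}(x,\dot x),$$ $$B(x,e)((\dot x,0),(\delta x,0)):=d\mathcal A(x)(\dot x,\delta x)-[\mathcal A(x)\dot x,\mathcal A(x)\delta x]=\bigoplus_{k=0}^n\varphi^{(k,k+1)}.$$ Then $q(t)$ satisfies the Lagrange-d'Alembert principle for $(L,\mathcal D)$ if and only if for every $t$ the following two conditions hold. Vertical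 equations: for all $\nu=\bigoplus_{i=0}^n\nu^{(i,i+1)}\in\mathcal S_{x(t)}$, $$\sum_{j=0}^n\dot\mu_j(\nu^{(j,j+1)})=\sum_{i=0}^n\Big\langle\mu_i,\ [\eta^{(i,i+1)},\nu^{(i,i+1)}]-[\mathcal A^{(i,i+1)}(x,\dot x),\nu^{(i,i+1)}]$$ $$+\sum_{j=0}^{i-1}\Big(-a^{(i,i+1)}_{(N_j,N_{j+1})}(\eta^{(j,j+1)},\nu^{(j,j+1)})+b^{(i,i+1)}_{(N_j,N_{j+1})}\Big(\eta^{(j,j+1)},\sum_{k=j+1}^n\nu^{(k,k+1)}\Big)-b^{(i,i+1)}_{(N_j,N_{j+1})}\Big(\nu^{(j,j+1)},\sum_{l=j+1}^n\eta^{(l,l+1)}\Big)$$ $$+a^{(i,i+1)}_{(N_j,N_{j+1})}(\mathcal A^{(j,j+1)}(x,\dot x),\nu^{(j,j+1)})-b^{(i,i+1)}_{(N_j,N_{j+1})}\Big(\mathcal A^{(j,j+1)}(x,\dot x),\sum_{k=j+1}^n\nu^{(k,k+1)}\Big)+b^{(i,i+1)}_{(N_j,N_{j+1})}\Big(\nu^{(j,j+1)},\sum_{l=j+1}^n\mathcal A^{(l,l+1)}(x,\dot x)\Big)\Big)\Big\rangle.$$ Horizontal equations: for all $\delta x\in T_{x(t)}X$, $$\frac{\partial l}{\partial x}\delta x-\frac{d}{dt}\frac{\partial l}{\partial\dot x}\delta x=\sum_{i=0}^n\Big\langle\mu_i,\ \varphi^{(i,i+1)}-[\mathcal A^{(i,i+1)}(x,\delta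 x),\eta^{(i,i+1)}]-\sum_{j=0}^{i-1}\Big(-a^{(i,i+1)}_{(N_j,N_{j+1})}(\mathcal A^{(j,j+1)}(x,\delta x),\eta^{(j,j+1)})$$ $$+b^{(i,i+1)}_{(N_j,N_{j+1})}\Big(\mathcal A^{(j,j+1)}(x,\delta x),\sum_{k=j+1}^n\eta^{(k,k+1)}\Big)-b^{(i,i+1)}_{(N_j,N_{j+1})}\Big(\eta^{(j,j+1)},\sum_{l=j+1}^n\mathcal A^{(l,l+1)}(x,\delta x)\Big)\Big)\Big\rangle.$$
   Context: Lie algebra decomposition. $\mathfrak g$, $\mathfrak n_j$, $\mathfrak n_{(j-1,j)}$ are the Lie algebras of $G$, $N_j$ and $N_{(j-1,j)}=N_{j-1}/N_j$. Fix a left-invariant Riemannian metric on $G$. For $1\le j\le n+1$ let $\mathcal A_{N_j}:TN_{j-1}\to\mathfrak n_j$ be the principal connection on the left principal $N_j$-bundle $N_{j-1}\to N_{(j-1,j)}$ whose horizontal spaces are the orthogonal complements of the tangent spaces to the $N_j$-orbits; $\mathcal A_{N_j}(e):\mathfrak n_{j-1}\to\mathfrak n_j$ is the orthogonal projection. For $\eta\in\mathfrak n_{(j-1,j)}$, $\eta^{\mathcal A_{N_j}}\in\mathfrak n_{j-1}$ is its horizontal lift at $e$ (the unique lift of $\eta$ orthogonal to $\mathfrak n_j$). Embedding $\mathfrak n_{(j-1,j)}$ in $\mathfrak n_{j-1}$ by this lift gives $\mathfrak n_{j-1}=\mathfrak n_{(j-1,j)}\oplus\mathfrak n_j$, hence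 $\mathfrak g=\bigoplus_{i=0}^n\mathfrak n_{(i,i+1)}$, $\mathfrak g^*=\bigoplus_{i=0}^n\mathfrak n_{(i,i+1)}^*$ and $\mathfrak n_{j+1}=\bigoplus_{k=j+1}^n\mathfrak n_{(k,k+1)}$. Bilinear maps. $b_{(N_{j-1},N_j)}:\mathfrak n_{(j-1,j)}\times\mathfrak n_j\to\mathfrak n_j$, $b_{(N_{j-1},N_j)}(\eta,\overline\eta)=[\eta^{\mathcal A_{N_j}},\overline\eta]$, and $a_{(N_{j-1},N_j)}:\mathfrak n_{(j-1,j)}\times\mathfrak n_{(j-1,j)}\to\mathfrak n_j$, $a_{(N_{j-1},N_j)}(\eta,\overline\eta)=-\mathcal A_{N_j}(e)([\eta^{\mathcal A_{N_j}},\overline\eta^{\mathcal A_{N_j}}])$, with brackets in $\mathfrak n_{j-1}$. A superscript $(i,i+1)$ denotes the component in $\mathfrak n_{(i,i+1)}$. A bracket of two elements of $\mathfrak n_{(i,i+1)}$, such as $[\eta^{(i,i+1)},\nu^{(i,i+1)}]$, is the bracket of the Lie algebra $\mathfrak n_{(i,i+1)}$. Connection on $Q$. $\mathcal V_q$ is the tangent space to the $G$-orbit, $\mathcal S_q=\mathcal D_q\cap\mathcal V_q$. The nonholonomic connection for a given $G$-invariant metric on $Q$ is the principal connection $\mathcal A:TQ\to\mathfrak g$ whose horizontal space at $q$ is the orthogonal complement of $\mathcal S_q$ in $\mathcal D_q$. Write $\mathcal A(x)\dot x:=\mathcal A(x,e,\dot x,0)$, a $\mathfrak g$-valued one-form on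 $X$ with exterior derivative $d\mathcal A(x)$ (convention $d\mathcal A(U,W)=U(\mathcal A(W))-W(\mathcal A(U))-\mathcal A([U,W])$); then $\mathcal A(x,g,\dot x,\dot g)=\mathrm{Ad}_g(\mathcal A(x)\dot x+g^{-1}\dot g)$. Reduced Lagrangian. $l:TX\times\mathfrak g\to\mathbb R$ is defined by $l(x,\dot x,\mathcal A(x)\dot x+g^{-1}\dot g)=L(x,g,\dot x,\dot g)$. The partial derivatives of $l$ with respect to $x,\dot x$ are taken in local coordinates on $X$. Lagrange-d'Alembert principle. A curve $q(t)$ with $\dot q\in\mathcal D$ satisfies it if $\delta\int_{t_0}^{t_1}L(q,\dot q)\,dt=0$ for all variations $\delta q$ of $q$ with $\delta q(t_0)=\delta q(t_1)=0$ and $\delta q(t)\in\mathcal D_{q(t)}$ for all $t$. Lagrangian and curves are smooth. *)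

(* Defs.v *)
From HB Require Import structures.
From mathcomp Require Import all_boot all_order all_algebra.
From mathcomp Require Import all_classical all_reals all_analysis.

Set Implicit Arguments.
Unset Strict Implicit.
Unset Printing Implicit Defensive.

Import Order.TTheory GRing.Theory Num.Theory.
Import numFieldNormedType.Exports.

Local Open Scope classical_set_scope.
Local Open Scope ring_scope.

(* Possibly infinite groups (written multiplicatively in group_scope) whose
   carrier is a topological space. *)
#[short(type="topGroupType")]
HB.structure Definition TopGroup := {G of Group G & Topological G}.

Section Smooth.
Context {R : realType} {E F : normedModType R}.

(* On an open U, and for E finite-dimensional, this is the usual class C^k. *)
Fixpoint Ck_on (k : nat) (U : set E) (f : E -> F) : Prop :=
  match k with
  | 0 => forall x, U x -> {for x, continuous f}
  | k'.+1 => (forall x, U x -> differentiable f x) /\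
             (forall v, Ck_on k' U (fun x => 'd f x v))
  end.

Definition smooth_on (U : set E) (f : E -> F) : Prop :=
  forall k, Ck_on k U f.

End Smooth.

(* An atlas on T with model space E, indexed by the points of T:
   [chart p : T -> E] is a chart defined on [chart_dom p], with inverse
   [chart_inv p], and [p] lies in [chart_dom p]. Outside the domains the values
   are irrelevant. *)
Record atlas (R : realType) (E : normedModType R) (T : topologicalType) :=
  Atlas {
    chart_dom : T -> set T;
    chart : T -> T -> E;
    chart_inv : T -> E -> T
  }.

Section Manifold.
Context {R : realType} {E : normedModType R} {T : topologicalType}.
Variable a : atlas E T.

Definition chart_image (p : T) (U : set T) : set E :=
  chart a p @` (U `&` chart_dom a p).

Definition is_manifold : Prop :=
  [/\ hausdorff_space T, @second_countable T,
      forall p, [/\ chart_dom a p p, open (chart_dom a p),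
                    open (chart_image p setT),
                    forall x, chart_dom a p x ->
                      chart_inv a p (chart a p x) = x &
                    (forall x, chart_dom a p x ->
                      {for x, continuous (chart a p)}) /\
                    (forall u, chart_image p setT u ->
                      {for u, continuous (chart_inv a p)})] &
      forall p q, smooth_on (chart_image p (chart_dom a q))
                            (chart a q \o chart_inv a p)].

(* The tangent space at x is the model space E: a tangent vector at x is given
   by its components in the chart [chart a x] attached to x itself. The next two
   functions are the changes of components between that chart and the chart
   attached to another point p. *)

(* components in the chart at p of the tangent vector w at x *)
Definition to_chart (p x : T) (w : E) : E :=
  'd (chart a p \o chart_inv a x) (chart a x x) w.

(* tangent vector at [chart_inv a p u] with components w in the chart at p *)
Definition of_chart (p : T) (u : E) (w : E) : E :=
  'd (chart a (chart_inv a p u) \o chart_inv a p) u w.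

(* f is smooth on the tangent bundle, whose charts are induced by those of T. *)
Definition tangent_smooth {F : normedModType R} (f : T -> E -> F) : Prop :=
  forall p, smooth_on [set z : E * E | chart_image p setT z.1]
    (fun z : E * E => f (chart_inv a p z.1) (of_chart p z.1 z.2)).

Definition smooth_vector_field (U : set T) (Y : T -> E) : Prop :=
  forall p, smooth_on (chart_image p U)
    (fun u => to_chart p (chart_inv a p u) (Y (chart_inv a p u))).

Definition riemannian_metric (g : T -> E -> E -> R) : Prop :=
  [/\ forall x w c w1 w2, g x (c *: w1 + w2) w = c * g x w1 w + g x w2 w,
      forall x w1 w2, g x w1 w2 = g x w2 w1,
      forall x w, w != 0 -> 0 < g x w w &
      forall p w1 w2, smooth_on (chart_image p setT)
        (fun u => g (chart_inv a p u) (of_chart p u w1) (of_chart p u w2))].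

(* Smooth subbundle of the tangent bundle: locally D has a smooth frame. *)
Definition smooth_distribution (D : T -> set E) : Prop :=
  forall q0, exists (U : set T) (r : nat) (Y : 'I_r -> T -> E),
    [/\ open U, U q0, forall i, smooth_vector_field U (Y i) &
      forall q, U q ->
        (forall c : 'I_r -> R, \sum_i c i *: Y i q = 0 -> forall i, c i = 0) /\
        D q = [set w | exists c : 'I_r -> R, w = \sum_i c i *: Y i q]].

(* Exterior derivative of a vector-valued one-form [alpha]: the formula
   d alpha(V,W) = V(alpha(W)) - W(alpha(V)) - alpha([V,W]) for the vector fields
   V, W with constant components w1, w2 in the chart at x, which commute. *)
Definition ext_deriv {F : normedModType R} (alpha : T -> E -> F)
    (x : T) (w1 w2 : E) : F :=
  let form u w := alpha (chart_inv a x u) (of_chart x u w) in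
  'D_w1 (fun u => form u w2) (chart a x x) -
  'D_w2 (fun u => form u w1) (chart a x x).

End Manifold.

Definition model_atlas {R : realType} (E : normedModType R) : atlas E E :=
  Atlas (fun _ => setT) (fun _ u => u) (fun _ u => u).

Definition prod_atlas {R : realType} {E F : normedModType R}
    {S T : topologicalType} (a : atlas E S) (b : atlas F T) :
    atlas (E * F)%type (S * T)%type :=
  Atlas (fun p => chart_dom a p.1 `*` chart_dom b p.2)
        (fun p z => (chart a p.1 z.1, chart b p.2 z.2))
        (fun p u => (chart_inv a p.1 u.1, chart_inv b p.2 u.2)).

Section Maps.
Context {R : realType} {E F : normedModType R} {S T : topologicalType}.
Variables (a : atlas E S) (b : atlas F T).

Definition smooth_map_on (U : set S) (f : S -> T) : Prop :=
  (forall x, U x -> {for x, continuous f}) /\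
  forall p q, smooth_on (chart_image a p (U `&` f @^-1` chart_dom b q))
                        (chart b q \o f \o chart_inv a p).

Definition tangent_map (f : S -> T) (x : S) (w : E) : F :=
  'd (chart b (f x) \o f \o chart_inv a x) (chart a x x) w.

End Maps.

Section Curves.
Context {R : realType} {E : normedModType R} {T : topologicalType}.
Variable a : atlas E T.

Definition velocity (q : R -> T) (t : R) : E :=
  tangent_map (model_atlas R) a q t 1.

Definition smooth_curve (t0 t1 : R) (q : R -> T) : Prop :=
  exists U : set R, [/\ open U, `[t0, t1] `<=` U &
    smooth_map_on (model_atlas R) a U q].

(* A variation of q is dq(t) = d/ds H(t,s) at s = 0 for a smooth deformation
   H of q; the principle asks that the action be stationary along every
   deformation whose dq vanishes at t0, t1 and takes values in D. *)
Definition lagrange_dalembert (L : T -> E -> R) (D : T -> set E)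
    (t0 t1 : R) (q : R -> T) : Prop :=
  forall (W : set (R * R)) (H : R * R -> T),
    open W -> (forall t, t0 <= t <= t1 -> W (t, 0)) ->
    smooth_map_on (model_atlas (R * R)%type) a W H ->
    (forall t, t0 <= t <= t1 -> H (t, 0) = q t) ->
    let dq t := velocity (fun s => H (t, s)) 0 in
    dq t0 = 0 -> dq t1 = 0 ->
    (forall t, t0 <= t <= t1 -> D (q t) (dq t)) ->
    is_derive (0 : R) 1
      (fun s : R => \int[lebesgue_measure]_(t in `[t0, t1])
         L (H (t, s)) (velocity (fun r => H (r, s)) t)) 0.

End Curves.

Section LieGroup.
Context {R : realType} {d : nat} {G : topGroupType}.
Variable aG : atlas 'rV[R]_d G.
Local Open Scope group_scope.

Definition lie_group : Prop :=
  [/\ is_manifold aG,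
      smooth_map_on (prod_atlas aG aG) aG setT (fun z : G * G => z.1 * z.2) &
      smooth_map_on aG aG setT (fun g : G => g^-1)].

Definition left_invariant (gG : G -> 'rV[R]_d -> 'rV[R]_d -> R) : Prop :=
  forall h k w1 w2,
    gG (h * k) (tangent_map aG aG (fun z => h * z) k w1)
               (tangent_map aG aG (fun z => h * z) k w2) = gG k w1 w2.

(* g^{-1} w for w tangent to G at g *)
Definition left_triv (g : G) (w : 'rV[R]_d) : 'rV[R]_d :=
  tangent_map aG aG (fun z => g^-1 * z) g w.

Definition Ad (g : G) (xi : 'rV[R]_d) : 'rV[R]_d :=
  tangent_map aG aG (fun k : G => g * k * g^-1) 1 xi.

(* The Lie algebra of G is its tangent space at 1, with the bracket of
   left-invariant vector fields; [left_field xi] is the left-invariant field with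
   value xi at 1, in the chart at 1. *)
Definition left_field (xi u : 'rV[R]_d) : 'rV[R]_d :=
  let g := chart_inv aG 1 u in
  to_chart aG 1 g (tangent_map aG aG (fun z => g * z) 1 xi).

Definition lie_bracket (xi eta : 'rV[R]_d) : 'rV[R]_d :=
  let u := chart aG 1 1 in
  ('D_(left_field xi u) (left_field eta) u -
   'D_(left_field eta u) (left_field xi) u)%R.

Definition closed_subgroup (H : set G) : Prop :=
  [/\ closed H, H 1, (forall h k, H h -> H k -> H (h * k)) &
      (forall h, H h -> H h^-1)].

(* Lie algebra of a closed subgroup H, as a subspace of that of G: the tangent
   space of H at 1, i.e. the velocities at 1 of smooth curves lying in H *)
Definition lie_sub (H : set G) : set 'rV[R]_d :=
  [set xi | exists (U : set R) (c : R -> G),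
    [/\ open U, U 0%R, smooth_map_on (model_atlas R) aG U c,
        (forall t, U t -> H (c t)) & c 0%R = 1 /\ velocity aG c 0 = xi]].

End LieGroup.

Definition normal_chain {G : topGroupType} (n : nat) (N : nat -> set G) :=
  [/\ N 0 = setT, N n.+1 = [set 1%g],
      forall j, (j <= n.+1)%N -> closed_subgroup (N j) &
      forall j, (j <= n)%N -> N j.+1 `<=` N j /\
        forall h k : G, N j h -> N j.+1 k -> N j.+1 (h * k * h^-1)%g].

Section Stages.
Context {R : realType} {d : nat} {G : topGroupType}.
Variables (aG : atlas 'rV[R]_d G) (gG : G -> 'rV[R]_d -> 'rV[R]_d -> R).
Variables (n : nat) (N : nat -> set G).

Local Notation "[< xi , eta >]" := (lie_bracket aG xi eta).
Local Notation ip := (gG 1%g).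
Local Notation lie j := (lie_sub aG (N j)).

(* The Lie algebra of N_i / N_{i+1} is the quotient lie i / lie i.+1. It is used
   through its embedding in lie i by horizontal lift, whose image is [hor i]. *)
Definition hor (i : nat) : set 'rV[R]_d :=
  [set xi | lie i xi /\ forall zeta, lie i.+1 zeta -> ip xi zeta = 0].

Definition class_mod (i : nat) (xi : 'rV[R]_d) : set 'rV[R]_d :=
  [set zeta | lie i.+1 (zeta - xi)].

Definition hor_lift (i : nat) (C : set 'rV[R]_d) : 'rV[R]_d :=
  get (C `&` hor i).

(* bracket of the quotient Lie algebra: class of the bracket of representatives *)
Definition quot_bracket (i : nat) (xi eta : 'rV[R]_d) : 'rV[R]_d :=
  hor_lift i (class_mod i [< xi, eta >]).

(* value at the identity of the connection of N_{j-1} -> N_{j-1} / N_j *)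
Definition stage_connection (j : nat) (xi : 'rV[R]_d) : 'rV[R]_d :=
  get [set zeta | lie j zeta /\
                  forall kappa, lie j kappa -> ip (xi - zeta) kappa = 0].

(* [stage_a j] and [stage_b j] are a_{(N_j, N_{j+1})} and b_{(N_j, N_{j+1})}. *)
Definition stage_a (j : nat) (xi eta : 'rV[R]_d) : 'rV[R]_d :=
  - stage_connection j.+1 [< xi, eta >].

Definition stage_b (j : nat) (xi eta : 'rV[R]_d) : 'rV[R]_d :=
  [< xi, eta >].

(* The Lie algebra of G is the direct sum of the hor i, 0 <= i <= n. *)
Definition stage_comp (xi : 'rV[R]_d) : 'I_n.+1 -> 'rV[R]_d :=
  get [set c : 'I_n.+1 -> 'rV[R]_d |
        (forall i : 'I_n.+1, hor i (c i)) /\ xi = \sum_(i < n.+1) c i].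

End Stages.

Arguments stage_comp {R d G} aG gG n N xi.

Section Bundle.
Context {R : realType} {m d : nat} {X : topologicalType} {G : topGroupType}.
Variables (aX : atlas 'rV[R]_m X) (aG : atlas 'rV[R]_d G).

Local Notation Q := (X * G)%type.
Local Notation TQ := ('rV[R]_m * 'rV[R]_d)%type.
Local Notation aQ := (prod_atlas aX aG).

Definition act (h : G) (q : Q) : Q := (q.1, (h * q.2)%g).

Definition act_tangent (h : G) (q : Q) (w : TQ) : TQ :=
  tangent_map aQ aQ (act h) q w.

Definition invariant_function (L : Q -> TQ -> R) : Prop :=
  forall h q w, L (act h q) (act_tangent h q w) = L q w.

Definition invariant_distribution (D : Q -> set TQ) : Prop :=
  forall h q w, D (act h q) (act_tangent h q w) <-> D q w.

Definition invariant_metric (k : Q -> TQ -> TQ -> R) : Prop :=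
  forall h q w1 w2,
    k (act h q) (act_tangent h q w1) (act_tangent h q w2) = k q w1 w2.

Definition generator (xi : 'rV[R]_d) (q : Q) : TQ :=
  tangent_map aG aQ (fun h => act h q) 1%g xi.

Definition vertical (q : Q) : set TQ := range (generator^~ q).

Definition principal_connection (A : Q -> TQ -> 'rV[R]_d) : Prop :=
  [/\ tangent_smooth aQ A,
      forall q c w1 w2, A q (c *: w1 + w2) = c *: A q w1 + A q w2,
      forall xi q, A q (generator xi q) = xi &
      forall h q w, A (act h q) (act_tangent h q w) = Ad aG h (A q w)].

Definition nonholonomic_connection (D : Q -> set TQ) (k : Q -> TQ -> TQ -> R)
    (A : Q -> TQ -> 'rV[R]_d) : Prop :=
  principal_connection A /\
  forall q w, A q w = 0 <->
    D q w /\ forall s, D q s -> vertical q s -> k q w s = 0.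

End Bundle.

(* Main.v *)
Require Import Defs.
From HB Require Import structures.
From mathcomp Require Import all_boot all_order all_algebra.
From mathcomp Require Import all_classical all_reals all_analysis.
From mathcomp Require Import ring lra.

Set Implicit Arguments.
Unset Strict Implicit.
Unset Printing Implicit Defensive.

Import Order.TTheory GRing.Theory Num.Theory.
Import numFieldNormedType.Exports.

Local Open Scope classical_set_scope.
Local Open Scope ring_scope.

(** Let Q (t, s) be a deformation of the curve q, and let v and w be the vertical parts
    A(x) dx + g^-1 dg of its derivatives in t and in s. The exterior derivative of the
    one-form A(x) and the Maurer-Cartan equation for g compute the commutator
    dv/ds - dw/dt ([vert_commutator]). Since L is l (x, dx, v), the derivative of L in s
    is a total derivative in t plus the sum of a linear form in the variation of x, the
    left side minus the right side of the horizontal equation, and of a linear form in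
    w, the vertical equation ([first_variation], [curve_variation]).

    The distribution D contains the kernel of A. Hence a variation of q takes values in
    D exactly when w takes values in S_x, whatever the variation of x ([dist_vert]). If
    the reduced equations hold, the integrand vanishes and the action is stationary
    ([reduced_principle]). Conversely, a nonzero value of one of the two forms at an
    interior time is contradicted by a deformation cut off with a bump function
    ([variational_le0]), and continuity gives the equations at the two ends
    ([variational_eq0]). Deformations live in Q and not in a vector space, so they are
    written in a chart around the point of interest.

    What remains is linear algebra ([comp_bracket]). The two equations involve only the
    brackets of v, A dx, A delta with one another and with nu, paired with the
    derivative of l in v. In the orthogonal decomposition of the Lie algebra into the
    spaces [hor i], the bracket of a component of level j with a component of level
    k > j lies in the ideal [lie j.+1] of [lie j] and gives the maps b; two components
    of the same level j give the bracket of the quotient and, above this level, the map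
    - a. The normality of each subgroup of the chain in the preceding one enters here,
    through the derivative of the adjoint action ([lie_sub_ideal]).

    Derivatives are taken in a smoothness calculus at a point ([sm], [dir]) which is
    then transported to manifolds ([msm], [tv]). *)

(** * Maps of class C^k *)

(** A basis with continuous coordinates. [Ck_on] differentiates in one fixed
    direction at a time, so that iterating the chain rule requires expanding the
    direction ['d f x v], which depends on x, in such a basis. *)
Definition fin_dim {R : realType} (E : normedModType R) : Prop :=
  exists (r : nat) (e : 'I_r -> E) (c : 'I_r -> {linear E -> R}),
    (forall i, continuous (c i)) /\ forall v, v = \sum_i c i v *: e i.

Section CkTheory.
Context {R : realType}.
Implicit Types E F H : normedModType R.

Lemma Ck_on_sub E F k (U V : set E) (f : E -> F) :
  V `<=` U -> Ck_on k U f -> Ck_on k V f.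
Proof.
move=> VU; elim: k f => [|k IH] f /=; first by move=> h x /VU /h.
by move=> [h1 h2]; split => [x /VU /h1 //|v]; exact/IH/h2.
Qed.

Lemma near_eq_differentiable E F (f g : E -> F) x :
  (\near x, f x = g x) -> differentiable f x ->
  differentiable g x /\ 'd g x = 'd f x :> (E -> F).
Proof.
move=> fg df.
have gx : g x = f x by have := nbhs_singleton fg.
have key : g \o shift x = cst (g x) + 'd f x +o_ 0 id.
  apply/eqaddoP => e e0; have := diff_locally df.
  move/eqaddoP => /(_ e e0) h.
  have fg0 : \forall y \near 0, f (y + x) = g (y + x).
    by have := fg; rewrite (near_shift 0 x) /= subr0; apply: filterS => y; 
       rewrite /= addrC // ?addrC.
  near=> y.
  have : `|(f \o shift x - (cst (f x) + 'd f x)) y| <= e * `|id y| by near: y.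
  have E1 : f (y + x) = g (y + x) by near: y.
  by rewrite /= !fctE /= E1 gx.
have dc : continuous ('d f x) by exact: diff_continuous.
have E1 : 'd g x = 'd f x :> (E -> F) by apply: diff_unique.
split => //; apply/diff_locallyP; split; rewrite E1 //.
Unshelve. all: by end_near. Qed.

Lemma Ck_on_ext E F k (U : set E) (f g : E -> F) :
  open U -> (forall x, U x -> f x = g x) -> Ck_on k U f -> Ck_on k U g.
Proof.
move=> oU; elim: k f g => [|k IH] f g fg /=.
  move=> h x Ux; have cf : f @ x --> f x by exact: h.
  suff : g @ x --> f x by rewrite (fg _ Ux).
  apply: cvg_trans cf; apply: near_eq_cvg.
  by near=> y; apply: fg; near: y; exact: open_nbhs_nbhs.
have nfg x : U x -> \near x, f x = g x.
  by move=> Ux; near=> y; apply: fg; near: y; exact: open_nbhs_nbhs.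
move=> [h1 h2]; split => [x Ux|v].
  by have [] := near_eq_differentiable (nfg _ Ux) (h1 _ Ux).
apply: IH (h2 v) => x Ux.
by have [_ ->] := near_eq_differentiable (nfg _ Ux) (h1 _ Ux).
Unshelve. all: by end_near. Qed.

Lemma Ck_onS E F k (U : set E) (f : E -> F) : Ck_on k.+1 U f -> Ck_on k U f.
Proof.
elim: k f => [|k IH] f; first by move=> [h _] x /h; exact: differentiable_continuous.
by move=> [h1 h2]; split => // v; exact: IH (h2 v).
Qed.

Lemma Ck_on_cst E F k (U : set E) (a : F) : Ck_on k U (fun=> a).
Proof.
elim: k a => [|k IH] a /=; first by move=> x _; exact: cvg_cst.
split=> [x _|v]; first exact: differentiable_cst.
rewrite (_ : (fun x => _) = (fun=> 0)) //.
by apply/funext => x; rewrite (diff_cst a x).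
Qed.

Lemma Ck_on_lin E F H k (U : set E) (f : E -> F) (l : {linear F -> H}) :
  open U -> continuous l -> Ck_on k U f -> Ck_on k U (fun x => l (f x)).
Proof.
move=> oU lc; elim: k f => [|k IH] f /=.
  by move=> h x Ux; apply: continuous_comp; [exact: h|exact: lc].
have dl y : differentiable l y by exact: linear_differentiable.
move=> [h1 h2]; split => [x Ux|v]; first by apply: differentiable_comp; [exact: h1|].
apply: Ck_on_ext oU _ (IH _ (h2 v)) => x Ux.
by rewrite (diff_comp (h1 _ Ux) (dl _)) /= diff_lin.
Qed.

Lemma Ck_on_pair E F H k (U : set E) (f : E -> F) (g : E -> H) :
  open U -> Ck_on k U f -> Ck_on k U g -> Ck_on k U (fun x => (f x, g x)).
Proof.
move=> oU; elim: k f g => [|k IH] f g /=.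
  by move=> hf hg x Ux; apply: cvg_pair; [exact: hf|exact: hg].
move=> [f1 f2] [g1 g2]; split => [x Ux|v].
  by apply: differentiable_pair; [exact: f1|exact: g1].
apply: Ck_on_ext oU _ (IH _ _ (f2 v) (g2 v)) => x Ux.
by rewrite diff_pair //; [exact: f1|exact: g1].
Qed.

Lemma Ck_onD E F k (U : set E) (f g : E -> F) :
  open U -> Ck_on k U f -> Ck_on k U g -> Ck_on k U (fun x => f x + g x).
Proof.
move=> oU; elim: k f g => [|k IH] f g /=.
  by move=> hf hg x Ux; apply: cvgD; [exact: hf|exact: hg].
move=> [f1 f2] [g1 g2]; split => [x Ux|v].
  by apply: differentiableD; [exact: f1|exact: g1].
apply: Ck_on_ext oU _ (IH _ _ (f2 v) (g2 v)) => x Ux.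
by rewrite diffD //; [exact: f1|exact: g1].
Qed.

Lemma scale_is_bilinear F :
  bilinear_for (GRing.Scale.Law.clone _ _ *:%R _) (GRing.Scale.Law.clone _ _ *:%R _)
  (@GRing.scale R F).
Proof.
split=> [u'|u] a x y /=.
- by rewrite scalerDl scalerA.
- by rewrite scalerDr !scalerA mulrC.
Qed.

Lemma diff_scale E F (f : E -> R) (g : E -> F) x :
  differentiable f x -> differentiable g x ->
  differentiable (fun x => f x *: g x) x /\
  forall v, 'd (fun x => f x *: g x) x v = 'd f x v *: g x + f x *: 'd g x v.
Proof.
move=> df dg.
pose BM := bilinear_isBilinear.Build R R F F _ _ (@GRing.scale R F) (@scale_is_bilinear F).
pose B : {bilinear R -> F -> F} := HB.pack (@GRing.scale R F) BM.
pose s (p : R * F) := B p.1 p.2.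
have sc : continuous s by exact: scale_continuous.
have ds (p : R * F) : differentiable s p by have h := @differentiable_bilin _ _ _ _ B p sc; refine h.
have dp := differentiable_pair df dg.
rewrite -[fun x => f x *: g x]/(s \o (fun x => (f x, g x))).
split; first exact: differentiable_comp.
move=> v; rewrite (diff_comp dp (ds _)) /= diff_bilin // diff_pair //=.
by rewrite addrC.
Qed.

Lemma Ck_onZ E F k (U : set E) (f : E -> R) (g : E -> F) :
  open U -> Ck_on k U f -> Ck_on k U g -> Ck_on k U (fun x => f x *: g x).
Proof.
move=> oU; elim: k f g => [|k IH] f g.
  by move=> hf hg x Ux; apply: cvgZ; [exact: hf|exact: hg].
move=> Hf Hg; have [f1 f2] := Hf; have [g1 g2] := Hg.
split => [x Ux|v].
  by have [] := diff_scale (f1 _ Ux) (g1 _ Ux).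
have := Ck_onD oU (IH _ _ (f2 v) (Ck_onS Hg)) (IH _ _ (Ck_onS Hf) (g2 v)).
apply: Ck_on_ext oU _ => x Ux.
by have [_ ->] := diff_scale (f1 _ Ux) (g1 _ Ux).
Qed.

Lemma Ck_on_sum E F k (U : set E) (I : Type) (s : seq I) (P : pred I)
    (f : I -> E -> F) :
  open U -> (forall i, P i -> Ck_on k U (f i)) ->
  Ck_on k U (fun x => \sum_(i <- s | P i) f i x).
Proof.
move=> oU h; elim: s => [|i s IH].
  apply: Ck_on_ext oU _ (Ck_on_cst k U 0) => x _; by rewrite big_nil.
have [Pi|nPi] := boolP (P i); last first.
  by apply: Ck_on_ext oU _ IH => x _; rewrite big_cons (negPf nPi).
by apply: Ck_on_ext oU _ (Ck_onD oU (h _ Pi) IH) => x _; rewrite big_cons Pi.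
Qed.

(** The derivative of the composite in the direction v is the sum over a basis of F
    of the coordinates of ['d f x v] times the partial derivatives of g along f, and
    all these functions are one degree less smooth. *)
Lemma Ck_on_comp E F H k (U : set E) (V : set F) (f : E -> F) (g : F -> H) :
  fin_dim F -> open U -> (forall x, U x -> V (f x)) ->
  Ck_on k U f -> Ck_on k V g -> Ck_on k U (fun x => g (f x)).
Proof.
move=> [r [e [c [cc ce]]]] oU UV; elim: k g => [|k IH] g.
  by move=> hf hg x Ux; apply: continuous_comp; [exact: hf|exact/hg/UV].
move=> Hf; have [f1 f2] := Hf => -[g1 g2]; split => [x Ux|v].
  by apply: differentiable_comp; [exact: f1|exact/g1/UV].
have : Ck_on k U (fun x => \sum_i c i ('d f x v) *: 'd g (f x) (e i)).
  apply: Ck_on_sum => // i _.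
  refine (Ck_onZ oU (Ck_on_lin oU (cc i) (f2 v)) _).
  by apply: (IH (fun y => 'd g y (e i))) (g2 _); exact: Ck_onS.
apply: Ck_on_ext oU _ => x Ux.
rewrite (diff_comp (f1 _ Ux) (g1 _ (UV _ Ux))) /= [in RHS](ce ('d f x v)).
by rewrite linear_sum; apply: eq_bigr => i _; rewrite linearZ.
Qed.

End CkTheory.

(** * Smoothness and derivatives at a point *)

(** Smoothness on a neighbourhood of x. *)
Definition sm {R : realType} {E F : normedModType R} (f : E -> F) (x : E) : Prop :=
  exists2 V : set E, open_nbhs x V & smooth_on V f.

Lemma nbhs_open {T : topologicalType} (x : T) (A : set T) :
  nbhs x A -> exists U, [/\ open U, U x & U `<=` A].
Proof. by rewrite nbhsE => -[U [oU Ux] UA]; exists U. Qed.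

Section SmTheory.
Context {R : realType}.
Implicit Types E F H : normedModType R.

Lemma sm_on E F (U : set E) (f : E -> F) x :
  open U -> U x -> smooth_on U f -> sm f x.
Proof. by move=> oU Ux h; exists U. Qed.

Lemma Ck_on_pointwise E F k (U : set E) (f : E -> F) :
  (forall x, U x -> Ck_on k [set x] f) -> Ck_on k U f.
Proof.
elim: k f => [|k IH] f /= h; first by move=> x Ux; exact: (h x Ux x).
split => [x Ux|v]; first by have [h1 _] := h x Ux; exact: (h1 x erefl).
by apply: IH => x Ux; have [_ h2] := h x Ux; exact: h2.
Qed.

Lemma sm_smooth_on E F (U : set E) (f : E -> F) :
  (forall x, U x -> sm f x) -> smooth_on U f.
Proof.
move=> h k; apply: Ck_on_pointwise => x Ux; have [V [_ Vx] /(_ k)] := h x Ux.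
by apply: Ck_on_sub => _ ->.
Qed.

Lemma sm_near E F (f : E -> F) x : sm f x -> \forall y \near x, sm f y.
Proof.
move=> [V oV h]; apply: filterS (open_nbhs_nbhs oV) => y Vy.
by exists V => //; split => //; case: oV.
Qed.

Lemma sm_ext E F (f g : E -> F) x : (\near x, f x = g x) -> sm f x -> sm g x.
Proof.
move=> h [V oV hV].
have [W [oW Wx WP]] := nbhs_open (filterI h (open_nbhs_nbhs oV)).
exists W => // k; have fW : Ck_on k W f by apply: Ck_on_sub (hV k) => y /WP [].
by apply: Ck_on_ext oW _ fW => y /WP [].
Qed.

Lemma sm_differentiable E F (f : E -> F) x : sm f x -> differentiable f x.
Proof. by move=> [V [_ Vx] /(_ 1%N) [h _]]; exact: h. Qed.

Lemma sm_continuous E F (f : E -> F) x : sm f x -> {for x, continuous f}.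
Proof. by move=> [V [_ Vx] /(_ 0%N) h]; exact: h. Qed.

Lemma sm_cvg E F (f : E -> F) x : sm f x -> f y @[y --> x] --> f x.
Proof. exact: sm_continuous. Qed.

Lemma sm_cst E F (a : F) (x : E) : sm (fun=> a) x.
Proof.
by exists setT; [split => //; exact: openT|move=> k; exact: Ck_on_cst].
Qed.

Lemma sm_id E (x : E) : sm (fun x => x) x.
Proof.
exists setT; first by split => //; exact: openT.
move=> [|k]; first by move=> y _; exact: cvg_id.
split=> [y _|v]; first by have [] := is_diff_id y.
rewrite (_ : (fun y => _) = (fun=> v)); first exact: Ck_on_cst.
by apply/funext => y; have [_ ->] := is_diff_id y.
Qed.

Lemma sm_lin E F H (f : E -> F) (l : {linear F -> H}) x :
  continuous l -> sm f x -> sm (fun x => l (f x)) x.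
Proof.
by move=> lc [V [oV Vx] h]; exists V => // k; exact: Ck_on_lin.
Qed.

Lemma sm_pair E F H (f : E -> F) (g : E -> H) x :
  sm f x -> sm g x -> sm (fun x => (f x, g x)) x.
Proof.
move=> [V [oV Vx] h] [W [oW Wx] h']; exists (V `&` W).
  by split; [exact: openI|split].
move=> k; apply: Ck_on_pair; first exact: openI.
  by apply: Ck_on_sub (h k) => y [].
by apply: Ck_on_sub (h' k) => y [].
Qed.

Lemma smD E F (f g : E -> F) x : sm f x -> sm g x -> sm (fun x => f x + g x) x.
Proof.
move=> [V [oV Vx] h] [W [oW Wx] h']; exists (V `&` W).
  by split; [exact: openI|split].
move=> k; apply: Ck_onD; first exact: openI.
  by apply: Ck_on_sub (h k) => y [].
by apply: Ck_on_sub (h' k) => y [].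
Qed.

Lemma smZ E F (f : E -> R) (g : E -> F) x :
  sm f x -> sm g x -> sm (fun x => f x *: g x) x.
Proof.
move=> [V [oV Vx] h] [W [oW Wx] h']; exists (V `&` W).
  by split; [exact: openI|split].
move=> k; apply: Ck_onZ; first exact: openI.
  by apply: Ck_on_sub (h k) => y [].
by apply: Ck_on_sub (h' k) => y [].
Qed.

Lemma smM E (f g : E -> R) x : sm f x -> sm g x -> sm (fun x => f x * g x) x.
Proof. exact: smZ. Qed.

Lemma smN E F (f : E -> F) x : sm f x -> sm (fun x => - f x) x.
Proof.
move=> h; have := smZ (sm_cst (-1 : R) x) h.
by under eq_fun do rewrite scaleN1r.
Qed.

Lemma smB E F (f g : E -> F) x : sm f x -> sm g x -> sm (fun x => f x - g x) x.
Proof. by move=> h /smN; exact: smD. Qed.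

Lemma sm_sum E F (I : Type) (s : seq I) (P : pred I) (f : I -> E -> F) x :
  (forall i, P i -> sm (f i) x) -> sm (fun x => \sum_(i <- s | P i) f i x) x.
Proof.
move=> h; elim: s => [|i s IH].
  by under eq_fun do rewrite big_nil; exact: sm_cst.
have [Pi|nPi] := boolP (P i).
  by under eq_fun do rewrite big_cons Pi; apply: smD => //; exact: h.
by under eq_fun do rewrite big_cons (negPf nPi).
Qed.

Lemma fst_linear E F : linear (fst : E * F -> E).
Proof. by []. Qed.

Lemma snd_linear E F : linear (snd : E * F -> F).
Proof. by []. Qed.

Definition fstl E F : {linear (E * F)%type -> E} :=
  HB.pack (fst : E * F -> E) (GRing.isLinear.Build _ _ _ _ _ (@fst_linear E F)).
Definition sndl E F : {linear (E * F)%type -> F} :=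
  HB.pack (snd : E * F -> F) (GRing.isLinear.Build _ _ _ _ _ (@snd_linear E F)).

Lemma fstl_continuous E F : continuous (@fstl E F).
Proof. by move=> z; exact: cvg_fst. Qed.

Lemma sndl_continuous E F : continuous (@sndl E F).
Proof. by move=> z; exact: cvg_snd. Qed.

Lemma sm_fst E F H (f : E -> F * H) x : sm f x -> sm (fun x => (f x).1) x.
Proof. by move=> h; refine (sm_lin (@fstl_continuous F H) h). Qed.

Lemma sm_snd E F H (f : E -> F * H) x : sm f x -> sm (fun x => (f x).2) x.
Proof. by move=> h; refine (sm_lin (@sndl_continuous F H) h). Qed.

Lemma d_fst E F H (f : E -> F * H) x v : differentiable f x ->
  'd (fun x => (f x).1) x v = ('d f x v).1.
Proof.
move=> df; have dl : differentiable (@fstl F H) (f x).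
  by apply: linear_differentiable; exact: fstl_continuous.
rewrite -[fun x => (f x).1]/(fstl F H \o f) (diff_comp df dl) /= diff_lin //.
exact: fstl_continuous.
Qed.

Lemma d_snd E F H (f : E -> F * H) x v : differentiable f x ->
  'd (fun x => (f x).2) x v = ('d f x v).2.
Proof.
move=> df; have dl : differentiable (@sndl F H) (f x).
  by apply: linear_differentiable; exact: sndl_continuous.
rewrite -[fun x => (f x).2]/(sndl F H \o f) (diff_comp df dl) /= diff_lin //.
exact: sndl_continuous.
Qed.

Lemma d_pair E F H (f : E -> F) (g : E -> H) x v :
  differentiable f x -> differentiable g x ->
  'd (fun x => (f x, g x)) x v = ('d f x v, 'd g x v).
Proof. by move=> df dg; rewrite diff_pair. Qed.

Lemma d_comp E F H (f : E -> F) (g : F -> H) x v :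
  differentiable f x -> differentiable g (f x) ->
  'd (fun x => g (f x)) x v = 'd g (f x) ('d f x v).
Proof. by move=> df dg; rewrite -[fun x => _]/(g \o f) diff_comp. Qed.

Lemma d_ext E F (f g : E -> F) x : (\near x, f x = g x) -> sm f x ->
  'd g x = 'd f x :> (E -> F).
Proof.
by move=> fg sf; have [] := near_eq_differentiable fg (sm_differentiable sf).
Qed.

Lemma d_extv E F (f g : E -> F) x v : (\near x, f x = g x) -> sm f x ->
  'd g x v = 'd f x v.
Proof. by move=> fg sf; rewrite (d_ext fg sf). Qed.

Lemma d_id E (x v : E) : 'd (fun x => x) x v = v.
Proof. by rewrite -[fun x => x]/(@id E) diff_val. Qed.

Lemma d_cst E F (a : F) (x v : E) : 'd (fun=> a) x v = 0.
Proof. by rewrite -[fun x => _]/(cst a) diff_val. Qed.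

Lemma dD E F (f g : E -> F) x v : differentiable f x -> differentiable g x ->
  'd (fun x => f x + g x) x v = 'd f x v + 'd g x v.
Proof. by move=> df dg; rewrite -[fun x => _]/(f + g) diffD. Qed.

Lemma dZ E F (f : E -> R) (g : E -> F) x v :
  differentiable f x -> differentiable g x ->
  'd (fun x => f x *: g x) x v = 'd f x v *: g x + f x *: 'd g x v.
Proof. by move=> df dg; have [_ ->] := diff_scale df dg. Qed.

Lemma d_sum E F (I : Type) (s : seq I) (P : pred I) (f : I -> E -> F) x v :
  (forall i, P i -> sm (f i) x) ->
  'd (fun x => \sum_(i <- s | P i) f i x) x v = \sum_(i <- s | P i) 'd (f i) x v.
Proof.
move=> h; elim: s => [|i s IH].
  by under eq_fun do rewrite big_nil; rewrite d_cst big_nil.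
rewrite big_cons; have [Pi|nPi] := boolP (P i); last first.
  by under eq_fun do rewrite big_cons (negPf nPi).
under eq_fun do rewrite big_cons Pi.
rewrite dD ?IH //; apply: sm_differentiable; [exact: h|exact: sm_sum].
Qed.

Lemma sm_comp E F H (f : E -> F) (g : F -> H) x : fin_dim F ->
  sm f x -> sm g (f x) -> sm (fun x => g (f x)) x.
Proof.
move=> fF sf [W [oW Wx] h']; have cf := sm_continuous sf.
have nW : \forall y \near x, W (f y) by exact: (cf _ (open_nbhs_nbhs (conj oW Wx))).
have [V [oV Vx] h] := sf.
have [U [oU Ux UP]] := nbhs_open (filterI nW (open_nbhs_nbhs (conj oV Vx))).
exists U => // k; apply: Ck_on_comp fF oU _ _ (h' k); first by move=> y /UP [].
by apply: Ck_on_sub (h k) => y /UP [].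
Qed.

Lemma sm_d E F (f : E -> F) x v : sm f x -> sm (fun y => 'd f y v) x.
Proof. by move=> [V oV h]; exists V => // k; have [_] := h k.+1; apply. Qed.

Lemma sm_dd E F H (f : F -> H) (u w : E -> F) x : fin_dim F ->
  sm f (u x) -> sm u x -> sm w x -> sm (fun y => 'd f (u y) (w y)) x.
Proof.
move=> fF sf su sw; have [r [e [c [cc ce]]]] := fF.
have -> : (fun y => 'd f (u y) (w y)) =
  (fun y => \sum_i c i (w y) *: 'd f (u y) (e i)).
  by apply/funext => y; rewrite {1}(ce (w y)) linear_sum; under eq_bigr do rewrite linearZ.
apply: sm_sum => i _; refine (smZ (sm_lin (cc i) sw) _).
exact: (sm_comp fF su (sm_d (e i) sf)).
Qed.

Lemma d_dd E F H (f : F -> H) (u w : E -> F) x h : fin_dim F ->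
  sm f (u x) -> sm u x -> sm w x ->
  'd (fun y => 'd f (u y) (w y)) x h =
  'd (fun z => 'd f z (w x)) (u x) ('d u x h) + 'd f (u x) ('d w x h).
Proof.
move=> fF sf su sw; have [r [e [c [cc ce]]]] := fF.
have -> : (fun y => 'd f (u y) (w y)) =
  (fun y => \sum_i c i (w y) *: 'd f (u y) (e i)).
  by apply/funext => y; rewrite {1}(ce (w y)) linear_sum; under eq_bigr do rewrite linearZ.
have -> : (fun z => 'd f z (w x)) =
  (fun z => \sum_i c i (w x) *: 'd f z (e i)).
  by apply/funext => y; rewrite {1}(ce (w x)) linear_sum; under eq_bigr do rewrite linearZ.
have sc i : sm (fun y => c i (w y)) x by refine (sm_lin (cc i) sw).
have se i : sm (fun y => 'd f y (e i)) (u x) by exact: sm_d.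
have sue i : sm (fun y => 'd f (u y) (e i)) x by exact: (sm_comp fF su (se i)).
rewrite !d_sum; last 2 first.
- by move=> i _; apply: smZ (se i); exact: sm_cst.
- by move=> i _; apply: smZ.
rewrite (ce ('d w x h)) linear_sum -big_split /=; apply: eq_bigr => i _.
rewrite dZ; [|exact: sm_differentiable..].
rewrite dZ; [|exact: sm_differentiable (sm_cst _ _)|exact: sm_differentiable].
rewrite d_cst scale0r add0r addrC linearZ /=.
rewrite (d_comp (f := u) (g := fun z => 'd f z (e i))); [|exact: sm_differentiable..].
congr (_ + _ *: _); rewrite (d_comp (f := w) (g := c i)) ?diff_lin //.
  exact: sm_differentiable.
exact: linear_differentiable.
Qed.

Lemma partial_d E F H (f : E * F -> H) x y v w : differentiable f (x, y) ->
  'd f (x, y) (v, w) = 'd (fun z => f (z, y)) x v + 'd (fun z => f (x, z)) y w.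
Proof.
move=> df.
have d1 : differentiable (fun z : E => (z, y)) x.
  by apply: differentiable_pair; [exact: sm_differentiable (sm_id x)|exact: differentiable_cst].
have d2 : differentiable (fun z : F => (x, z)) y.
  by apply: differentiable_pair; [exact: differentiable_cst|exact: sm_differentiable (sm_id y)].
rewrite (d_comp (f := fun z : E => (z, y)) _ d1 df).
rewrite (d_comp (f := fun z : F => (x, z)) _ d2 df).
rewrite d_pair; [|exact: sm_differentiable (sm_id x)|exact: differentiable_cst].
rewrite d_pair; [|exact: differentiable_cst|exact: sm_differentiable (sm_id y)].
rewrite !d_id !d_cst -linearD; congr ('d _ _ _).
by rewrite /GRing.add /= /add_pair /= addr0 add0r.
Qed.

Lemma D_d E F (f : E -> F) x v : sm f x -> 'D_v f x = 'd f x v.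
Proof. by move=> sf; rewrite deriveE //; exact: sm_differentiable. Qed.

Lemma fin_dim_R : fin_dim R.
Proof.
exists 1%N, (fun=> 1), (fun=> idfun); split.
  by move=> i x; exact: cvg_id.
by move=> v; rewrite big_ord1 /= /GRing.scale /= mulr1.
Qed.

Lemma coord_linear n (i : 'I_n) : linear (fun v : 'rV[R]_n => v 0 i : R^o).
Proof. by move=> a u v; rewrite !mxE. Qed.

Definition coordl n (i : 'I_n) : {linear 'rV[R]_n -> R} :=
  HB.pack (fun v : 'rV[R]_n => v 0 i) (GRing.isLinear.Build _ _ _ _ _ (@coord_linear n i)).

Lemma coordl_continuous n (i : 'I_n) : continuous (@coordl n i).
Proof. exact: coord_continuous. Qed.

Lemma sm_coord E n (f : E -> 'rV[R]_n) i x : sm f x -> sm (fun x => f x 0 i) x.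
Proof. by move=> h; refine (sm_lin (@coordl_continuous n i) h). Qed.

Lemma d_coord E n (f : E -> 'rV[R]_n) i x v : sm f x ->
  'd (fun x => f x 0 i) x v = 'd f x v 0 i.
Proof.
move=> sf; have dl : differentiable (@coordl n i) (f x).
  by apply: linear_differentiable; exact: coordl_continuous.
have cl := @coordl_continuous n i.
have E1 : 'd (@coordl n i) (f x) = @coordl n i :> (_ -> _) := diff_lin (f x) cl.
have E2 := d_comp v (sm_differentiable sf) dl.
by rewrite E1 in E2; exact: E2.
Qed.

Lemma fin_dim_rV n : fin_dim 'rV[R]_n.
Proof.
exists n, (fun i => delta_mx 0 i), (@coordl n); split.
  by move=> i; exact: coordl_continuous.
by move=> v; rewrite [LHS]row_sum_delta.
Qed.

Lemma fin_dim_prod E F : fin_dim E -> fin_dim F -> fin_dim (E * F)%type.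
Proof.
move=> [r [e [c [cc ce]]]] [r' [e' [c' [cc' ce']]]].
pose b (i : 'I_(r + r')) : E * F := match fintype.split i with inl j => (e j, 0) | inr j => (0, e' j) end.
pose k (i : 'I_(r + r')) : {linear (E * F)%type -> R} := match fintype.split i with inl j => c j \o fstl E F | inr j => c' j \o sndl E F end.
exists (r + r')%N, b, k; split.
  move=> i; rewrite /k; case: fintype.split => j x /=.
    by apply: (@continuous_comp _ _ _ (@fst E F) (c j)); [exact: cvg_fst|exact: cc].
  by apply: (@continuous_comp _ _ _ (@snd E F) (c' j)); [exact: cvg_snd|exact: cc'].
move=> [v w]; rewrite big_split_ord /=.
under eq_bigr do rewrite /b /k (unsplitK (inl _)).
under [X in _ + X]eq_bigr do rewrite /b /k (unsplitK (inr _)).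
have h1 : forall s, \sum_(i <- s) c i v *: ((e i, 0) : E * F) = (\sum_(i <- s) c i v *: e i, 0).
  elim=> [|i s IH]; first by rewrite !big_nil.
  by rewrite !big_cons IH /GRing.scale /= /scale_pair /GRing.add /= /add_pair /= scaler0 addr0.
have h2 : forall s, \sum_(i <- s) c' i w *: ((0, e' i) : E * F) = (0, \sum_(i <- s) c' i w *: e' i).
  elim=> [|i s IH]; first by rewrite !big_nil.
  by rewrite !big_cons IH /GRing.scale /= /scale_pair /GRing.add /= /add_pair /= scaler0 addr0.
rewrite /= h1 h2 -ce -ce' /GRing.add /= /add_pair /=.
by rewrite addr0 add0r.
Qed.

End SmTheory.

(** The derivative ['d f x v], sealed so that unification never unfolds the choice operator behind ['d]. *)
HB.lock Definition dir {R : realType} {E F : normedModType R} (f : E -> F)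
  (x v : E) : F := 'd f x v.

Section DirTheory.
Context {R : realType}.
Implicit Types E F H : normedModType R.

Lemma dirE E F (f : E -> F) x v : 'd f x v = dir f x v.
Proof. by rewrite dir.unlock. Qed.

Lemma dirP E F (f : E -> F) x c u v : dir f x (c *: u + v) = c *: dir f x u + dir f x v.
Proof. by rewrite dir.unlock linearP. Qed.

Lemma dir0 E F (f : E -> F) x : dir f x 0 = 0.
Proof. by rewrite dir.unlock linear0. Qed.

Lemma dirDv E F (f : E -> F) x u v : dir f x (u + v) = dir f x u + dir f x v.
Proof. by rewrite dir.unlock linearD. Qed.

Lemma dirBv E F (f : E -> F) x u v : dir f x (u - v) = dir f x u - dir f x v.
Proof. by rewrite dir.unlock linearB. Qed.

Lemma dirZv E F (f : E -> F) x c u : dir f x (c *: u) = c *: dir f x u.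
Proof. by rewrite dir.unlock linearZ. Qed.

Lemma dir_sumv E F (f : E -> F) x (I : Type) (s : seq I) (P : pred I) (u : I -> E) :
  dir f x (\sum_(i <- s | P i) u i) = \sum_(i <- s | P i) dir f x (u i).
Proof. by rewrite dir.unlock linear_sum. Qed.

Lemma dir_fst E F H (f : E -> F * H) x v : sm f x ->
  dir (fun x => (f x).1) x v = (dir f x v).1.
Proof. by move=> sf; rewrite dir.unlock d_fst //; exact: sm_differentiable. Qed.

Lemma dir_snd E F H (f : E -> F * H) x v : sm f x ->
  dir (fun x => (f x).2) x v = (dir f x v).2.
Proof. by move=> sf; rewrite dir.unlock d_snd //; exact: sm_differentiable. Qed.

Lemma dir_pair E F H (f : E -> F) (g : E -> H) x v : sm f x -> sm g x ->
  dir (fun x => (f x, g x)) x v = (dir f x v, dir g x v).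
Proof. by move=> sf sg; rewrite dir.unlock d_pair //; exact: sm_differentiable. Qed.

Lemma dir_cst E F (a : F) (x v : E) : dir (fun=> a) x v = 0.
Proof. by rewrite dir.unlock d_cst. Qed.

Lemma dir_id E (x v : E) : dir (fun x => x) x v = v.
Proof. by rewrite dir.unlock d_id. Qed.

Lemma dir_pair_cstr E F H (f : E -> F) (c : H) x v : sm f x ->
  dir (fun y => (f y, c)) x v = (dir f x v, 0).
Proof. by move=> sf; rewrite dir_pair ?dir_cst //; exact: sm_cst. Qed.

Lemma dir_pair_cstl E F H (f : E -> F) (c : H) x v : sm f x ->
  dir (fun y => (c, f y)) x v = (0, dir f x v).
Proof. by move=> sf; rewrite dir_pair ?dir_cst //; exact: sm_cst. Qed.

Lemma dir_comp E F H (f : E -> F) (g : F -> H) x v : sm f x -> sm g (f x) ->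
  dir (fun x => g (f x)) x v = dir g (f x) (dir f x v).
Proof. by move=> sf sg; rewrite dir.unlock d_comp //; exact: sm_differentiable. Qed.

Lemma dir_ext E F (f g : E -> F) x v : (\near x, f x = g x) -> sm f x ->
  dir g x v = dir f x v.
Proof. by move=> fg sf; rewrite dir.unlock; exact: d_extv. Qed.

Lemma dirD E F (f g : E -> F) x v : sm f x -> sm g x ->
  dir (fun x => f x + g x) x v = dir f x v + dir g x v.
Proof. by move=> sf sg; rewrite dir.unlock dD //; exact: sm_differentiable. Qed.

Lemma dirZ E F (f : E -> R) (g : E -> F) x v : sm f x -> sm g x ->
  dir (fun x => f x *: g x) x v = dir f x v *: g x + f x *: dir g x v.
Proof. by move=> sf sg; rewrite dir.unlock dZ //; exact: sm_differentiable. Qed.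

Lemma dirM E (f g : E -> R) x v : sm f x -> sm g x ->
  dir (fun x => f x * g x) x v = dir f x v * g x + f x * dir g x v.
Proof. exact: dirZ. Qed.

Lemma dir_sum E F (I : Type) (s : seq I) (P : pred I) (f : I -> E -> F) x v :
  (forall i, P i -> sm (f i) x) ->
  dir (fun x => \sum_(i <- s | P i) f i x) x v = \sum_(i <- s | P i) dir (f i) x v.
Proof. by move=> h; rewrite dir.unlock d_sum. Qed.

Lemma sm_dir E F (f : E -> F) x v : sm f x -> sm (fun y => dir f y v) x.
Proof. by rewrite dir.unlock; exact: sm_d. Qed.

Lemma sm_dirdir E F H (f : F -> H) (u w : E -> F) x : fin_dim F ->
  sm f (u x) -> sm u x -> sm w x -> sm (fun y => dir f (u y) (w y)) x.
Proof. by rewrite dir.unlock; exact: sm_dd. Qed.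

(** The base point contributes a second derivative of f; the direction contributes a
    first derivative, since the differential is linear in it. *)
Lemma dir_dir E F H (f : F -> H) (u w : E -> F) x h : fin_dim F ->
  sm f (u x) -> sm u x -> sm w x ->
  dir (fun y => dir f (u y) (w y)) x h =
  dir (fun z => dir f z (w x)) (u x) (dir u x h) + dir f (u x) (dir w x h).
Proof. by rewrite dir.unlock; exact: d_dd. Qed.

Lemma dir_partial E F H (f : E * F -> H) x y v w : sm f (x, y) ->
  dir f (x, y) (v, w) = dir (fun z => f (z, y)) x v + dir (fun z => f (x, z)) y w.
Proof. by move=> sf; rewrite dir.unlock partial_d //; exact: sm_differentiable. Qed.

Lemma dir_partial_l E F H (f : E * F -> H) x y v : sm f (x, y) ->
  dir f (x, y) (v, 0) = dir (fun z => f (z, y)) x v.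
Proof. by move=> sf; rewrite dir_partial // dir0 addr0. Qed.

Lemma dir_partial_r E F H (f : E * F -> H) x y w : sm f (x, y) ->
  dir f (x, y) (0, w) = dir (fun z => f (x, z)) y w.
Proof. by move=> sf; rewrite dir_partial // dir0 add0r. Qed.

Lemma dir_coord E n (f : E -> 'rV[R]_n) i x v : sm f x ->
  dir (fun x => f x 0 i) x v = dir f x v 0 i.
Proof. by move=> sf; rewrite dir.unlock d_coord. Qed.

Lemma D_dir E F (f : E -> F) x v : sm f x -> 'D_v f x = dir f x v.
Proof. by move=> sf; rewrite dir.unlock D_d. Qed.

Lemma derive1_dir F (f : R -> F) t : sm f t -> derive1 f t = dir f t 1.
Proof. by move=> sf; rewrite derive1E D_dir. Qed.

Lemma sm_line E (u w : E) (r : R) : sm (fun r : R => u + r *: w) r.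
Proof. by apply: smD; [exact: sm_cst|apply: smZ; [exact: sm_id|exact: sm_cst]]. Qed.

Lemma dir_line E (u w : E) (r h : R) : dir (fun r : R => u + r *: w) r h = h *: w.
Proof.
rewrite dirD; [|exact: sm_cst|apply: smZ; [exact: sm_id|exact: sm_cst]].
rewrite dirZ; [|exact: sm_id|exact: sm_cst].
by rewrite !dir_cst dir_id scaler0 add0r addr0.
Qed.

End DirTheory.

#[export] Hint Extern 0 (fin_dim _) => exact: fin_dim_R : core.
#[export] Hint Extern 0 (fin_dim _) => exact: fin_dim_rV : core.
#[export] Hint Extern 1 (fin_dim _) => apply: fin_dim_prod : core.

(** * Symmetry of second derivatives *)

Section Schwarz.
Context {R : realType}.
Implicit Types E F : normedModType R.

Lemma is_derive_line E F (g : E -> F) (z v : E) (a : R) : sm g (z + a *: v) ->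
  is_derive a 1 (fun r => g (z + r *: v)) ('d g (z + a *: v) v).
Proof.
move=> sg; have sl : sm (fun r : R => z + r *: v) a.
  by apply: smD; [exact: sm_cst|apply: smZ; [exact: sm_id|exact: sm_cst]].
have dg := sm_differentiable sg; have dl := sm_differentiable sl.
have dc : differentiable (fun r : R => g (z + r *: v)) a by exact: (differentiable_comp dl dg).
apply: DeriveDef; first exact: diff_derivable.
rewrite deriveE // (d_comp (f := fun r : R => z + r *: v) _ dl dg); congr ('d _ _ _).
rewrite dD; [|exact: differentiable_cst|]; last first.
  by apply: sm_differentiable; apply: smZ; [exact: sm_id|exact: sm_cst].
rewrite dZ; [|exact: sm_differentiable (sm_id _)|exact: differentiable_cst].
by rewrite !d_cst d_id scaler0 add0r addr0 scale1r.
Qed.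

(** The mean value theorem in the direction v for the difference of g along two
    parallel segments, then in the direction w for its derivative. *)
Lemma second_difference E (g : E -> R) (z v w : E) (s : R) : 0 < s ->
  (forall a b, 0 <= a <= s -> 0 <= b <= s -> sm g (z + a *: v + b *: w)) ->
  exists a b, [/\ 0 <= a <= s, 0 <= b <= s &
    g (z + s *: v + s *: w) - g (z + s *: v) - g (z + s *: w) + g z =
    s * (s * 'd (fun y => 'd g y v) (z + a *: v + b *: w) w)].
Proof.
move=> s0 sg.
have s00 : 0 <= s <= s by apply/andP; split; [exact: ltW|exact: lexx].
have s01 : (0 : R) <= 0 <= s by apply/andP; split; [exact: lexx|exact: ltW].
pose f a := g (z + s *: w + a *: v) - g (z + a *: v).
pose df a := 'd g (z + s *: w + a *: v) v - 'd g (z + a *: v) v.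
have fd a : 0 <= a <= s -> is_derive a 1 f (df a).
  move=> ha; apply: is_deriveB; apply: is_derive_line.
    by rewrite addrAC; exact: sg.
  by have := sg a 0 ha s01; rewrite scale0r addr0.
have [a] : exists2 a, a \in `[0, s] & f s - f 0 = df a * (s - 0).
  apply: MVT_segment; first exact: ltW.
    by move=> x; rewrite in_itv /= => /andP[x0 xs]; apply: fd; rewrite !ltW.
  apply: derivable_within_continuous => x; rewrite in_itv /= => hx.
  by have [] := fd x hx.
rewrite in_itv /= => ha; rewrite subr0 => E1.
pose h b := 'd g (z + a *: v + b *: w) v.
pose dh b := 'd (fun y => 'd g y v) (z + a *: v + b *: w) w.
have hd b : 0 <= b <= s -> is_derive b 1 h (dh b).
  by move=> hb; apply: is_derive_line; apply: sm_d; exact: sg.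
have [b] : exists2 b, b \in `[0, s] & h s - h 0 = dh b * (s - 0).
  apply: MVT_segment; first exact: ltW.
    by move=> x; rewrite in_itv /= => /andP[x0 xs]; apply: hd; rewrite !ltW.
  apply: derivable_within_continuous => x; rewrite in_itv /= => hx.
  by have [] := hd x hx.
rewrite in_itv /= => hb; rewrite subr0 => E2.
exists a, b; split => //.
have -> : s * (s * dh b) = df a * s.
  by rewrite mulrC [s * dh b]mulrC -E2 /h /df scale0r addr0 [z + _ + _]addrAC.
rewrite -E1 /f !scale0r !addr0 [z + s *: w + _]addrAC; ring.
Qed.

(** Both iterated derivatives are limits of the same second difference divided by
    s^2, because it is symmetric in v and w. *)
Lemma schwarzR E (g : E -> R) z v w : sm g z ->
  'd (fun y => 'd g y v) z w = 'd (fun y => 'd g y w) z v.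
Proof.
move=> sg; apply/eqP; rewrite -subr_eq0 -normr_le0; apply/ler_addgt0Pl => e e0.
rewrite addr0.
pose P y := 'd (fun y => 'd g y v) y w; pose Q y := 'd (fun y => 'd g y w) y v.
have e20 : 0 < e / 2 by rewrite divr_gt0.
have cP : P y @[y --> z] --> P z by apply: sm_cvg; apply: sm_d; exact: sm_d.
have cQ : Q y @[y --> z] --> Q z by apply: sm_cvg; apply: sm_d; exact: sm_d.
have nP : \forall y \near z, `|P z - P y| < e / 2 by move/cvgrPdist_lt : cP; exact.
have nQ : \forall y \near z, `|Q z - Q y| < e / 2 by move/cvgrPdist_lt : cQ; exact.
pose L (p : R * R) := z + p.1 *: v + p.2 *: w.
have sL : sm L 0.
  apply: smD; last by apply: smZ; [apply: sm_snd; exact: sm_id|exact: sm_cst].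
  by apply: smD; [exact: sm_cst|apply: smZ; [apply: sm_fst; exact: sm_id|exact: sm_cst]].
have L0 : L 0 = z by rewrite /L /= !scale0r !addr0.
have nL : \forall p \near (0 : R * R),
    [/\ `|P z - P (L p)| < e / 2, `|Q z - Q (L p)| < e / 2 & sm g (L p)].
  have cL : L p @[p --> (0 : R * R)] --> z by rewrite -L0; exact: sm_cvg.
  apply: (cL [set y | [/\ `|P z - P y| < e / 2, `|Q z - Q y| < e / 2 & sm g y]]).
  by apply: filterS (filterI nP (filterI nQ (sm_near sg))) => y [? [? ?]].
have [r /= r0 hr] : exists2 r : R, 0 < r & forall a b, `|a| < r -> `|b| < r ->
    [/\ `|P z - P (L (a, b))| < e / 2, `|Q z - Q (L (a, b))| < e / 2 & sm g (L (a, b))].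
  move/nbhs_ballP : nL => -[r /= r0 hr]; exists r => // a b ar br; apply: hr.
  by split => /=; rewrite /ball /= sub0r normrN.
pose s := r / 2; have s0 : 0 < s by rewrite divr_gt0.
have sr a : 0 <= a <= s -> `|a| < r.
  move=> /andP[a0 as_]; rewrite ger0_norm // (le_lt_trans as_) // /s.
  by rewrite ltr_pdivrMr // ltr_pMr // ltr1n.
have sg1 a b : 0 <= a <= s -> 0 <= b <= s -> sm g (z + a *: v + b *: w).
  by move=> /sr ha /sr hb; have [_ _] := hr _ _ ha hb.
have sg2 a b : 0 <= a <= s -> 0 <= b <= s -> sm g (z + a *: w + b *: v).
  by move=> ha hb; rewrite addrAC; exact: sg1.
have [a [b [/sr ha /sr hb E1]]] := second_difference s0 sg1.
have [a' [b' [/sr ha' /sr hb' E2]]] := second_difference s0 sg2.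
have : P (L (a, b)) = Q (L (b', a')).
  have : s * (s * P (L (a, b))) = s * (s * Q (L (b', a'))).
    rewrite /P /Q /L /= -E1 [z + b' *: v + _]addrAC -E2 [z + s *: v + _]addrAC.
    ring.
  by move/(mulfI (lt0r_neq0 s0))/(mulfI (lt0r_neq0 s0)).
have [h1 _ _] := hr _ _ ha hb; have [_ h2 _] := hr _ _ hb' ha'.
move=> E3; rewrite -/(P z) -/(Q z) [e]splitr.
rewrite (_ : P z - Q z = (P z - P (L (a, b))) + (Q (L (b', a')) - Q z)).
  by rewrite (le_trans (ler_normD _ _)) // lerD // ltW // distrC.
by rewrite E3 addrA subrK.
Qed.

Lemma schwarz E F (g : E -> F) z v w : fin_dim F -> sm g z ->
  'd (fun y => 'd g y v) z w = 'd (fun y => 'd g y w) z v.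
Proof.
move=> [r [e [c [cc ce]]]] sg.
have dc (y : F) i : differentiable (c i) y by exact: linear_differentiable.
have key a b i : c i ('d (fun y => 'd g y a) z b) = 'd (fun y => 'd (fun x => c i (g x)) y a) z b.
  have E1 : c i ('d (fun y => 'd g y a) z b) = 'd (fun y => c i ('d g y a)) z b.
    rewrite (d_comp (f := fun y => 'd g y a) (g := c i)) ?diff_lin //.
    by apply: sm_differentiable; exact: sm_d.
  rewrite E1; suff -> : 'd (fun y => 'd (fun x => c i (g x)) y a) z =
      'd (fun y => c i ('d g y a)) z :> (E -> R) by [].
  apply: d_ext; last by refine (sm_lin (cc i) (sm_d a sg)).
  have := sm_near sg; apply: filterS => y sy.
  rewrite (d_comp (f := g) (g := c i)) ?diff_lin //.
  exact: sm_differentiable.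
rewrite (ce ('d (fun y => 'd g y v) z w)) [RHS]ce; apply: eq_bigr => i _; congr (_ *: _).
by rewrite !key schwarzR //; refine (sm_lin (cc i) sg).
Qed.

Lemma dir_schwarz E F (g : E -> F) z v w : fin_dim F -> sm g z ->
  dir (fun y => dir g y v) z w = dir (fun y => dir g y w) z v.
Proof. by move=> fF sg; rewrite dir.unlock; exact: schwarz. Qed.

End Schwarz.

(** * A smooth bump function *)

Section Bump.
Context {R : realType}.

(** The functions x^-k exp (-1/x), extended by 0 to x <= 0. Treating all k at once
    closes the family under derivation. *)
Definition flat (k : nat) (x : R) : R :=
  if 0 < x then x^-1 ^+ k * expR (- x^-1) else 0.

Lemma flat_ge0 k x : 0 <= flat k x.
Proof.
rewrite /flat; case: ifP => // x0.
by rewrite mulr_ge0 ?expR_ge0 // exprn_ge0 // invr_ge0 ltW.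
Qed.

(** Taylor bound y^(k+1) <= (k+1)! exp y at y = 1/x; it yields the derivative at 0.
    *)
Lemma flat_le k x : flat k x <= (k.+1)`!%:R * `|x|.
Proof.
rewrite /flat; case: ifP => x0; last by rewrite mulr_ge0.
have y0 : 0 < x^-1 by rewrite invr_gt0.
have := expR_ge1Dxn k (ltW y0); set y := x^-1 in y0 *.
have f0 : 0 < (k.+1)`!%:R :> R by rewrite ltr0n fact_gt0.
move=> h; have h1 : y ^+ k.+1 / (k.+1)`!%:R <= expR y.
  by rewrite (le_trans _ h) // lerDr.
rewrite expRN ler_pdivrMr ?expR_gt0 // gtr0_norm //.
rewrite (_ : y ^+ k = (k.+1)`!%:R * x * (y ^+ k.+1 / (k.+1)`!%:R)); last first.
  rewrite exprS /y; field.
  by rewrite !gt_eqF.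
by rewrite ler_pM2l // mulr_gt0.
Qed.

Lemma is_derive_Rinv (x : R) : x != 0 ->
  is_derive x (1 : R) (fun y : R => y^-1) (- x ^- 2).
Proof.
move=> x0; apply: DeriveDef; first exact: derivableV.
by rewrite (deriveV (f := id)) // derive_id /GRing.scale /= mulr1.
Qed.

Lemma is_derive_flat_pos k (x : R) : 0 < x ->
  is_derive x (1 : R) (fun y : R => y^-1 ^+ k * expR (- y^-1))
    (x^-1 ^+ k.+2 * expR (- x^-1) - k%:R * (x^-1 ^+ k.+1 * expR (- x^-1))).
Proof.
move=> x0; have xn0 : x != 0 by rewrite gt_eqF.
have di := is_derive_Rinv xn0.
have dX : is_derive x (1 : R) (fun y : R => y^-1 ^+ k) ((k%:R * x^-1 ^+ k.-1) *: (- x ^- 2)).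
  rewrite (_ : (fun y => _) = (fun y : R => y^-1) ^+ k); last first.
    by apply/funext => y; rewrite exprfctE.
  exact: (@is_deriveX _ _ (fun y : R => y^-1) k x 1 _ di).
have dN : is_derive x (1 : R) (fun y : R => - y^-1) (x ^- 2).
  by rewrite -[x ^- 2]opprK; exact: (@is_deriveN _ _ _ _ x 1 _ di).
have dE : is_derive x (1 : R) (fun y : R => expR (- y^-1)) (x ^- 2 * expR (- x^-1)).
  rewrite -[fun y => _]/(expR \o (fun y : R => - y^-1)).
  have dexp := is_derive_expR (- x^-1).
  by rewrite mulrC; have h := @is_derive1_comp R expR (fun y : R => - y^-1) x _ _ dexp dN; exact: h.
have := is_deriveM dX dE.
set a := _ + _; set b := _ - _; suff -> : a = b by [].
rewrite /a /b /GRing.scale /= -exprVn; move: (x^-1) (expR _) => y e.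
case: k {dX a b} => [|k] /=; rewrite ?exprS ?expr0; first by ring.
by ring.
Qed.

Lemma flat_is_derive k (x : R) :
  is_derive x (1 : R) (flat k) (flat k.+2 x - k%:R * flat k.+1 x).
Proof.
have [x0|x0|->] := ltgtP x 0.
- have nx : \forall y \near x, cst 0 y = flat k y.
    apply: filterS (lt_nbhsl x0) => y y0.
    by rewrite /flat ltNge (ltW y0).
  rewrite /flat !(ltNge 0 x) (ltW x0) /= mulr0 subr0.
  exact: near_eq_is_derive nx _.
- have nx : \forall y \near x, (fun y : R => y^-1 ^+ k * expR (- y^-1)) y = flat k y.
    by apply: filterS (lt_nbhsr x0) => y y0; rewrite /flat y0.
  rewrite {2 3}/flat x0.
  by apply: near_eq_is_derive nx _; exact: is_derive_flat_pos.
- rewrite {2 3}/flat ltxx mulr0 subr0.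
  have cv : (fun h : R => h^-1 *: (flat k (h *: 1 + 0) - flat k 0)) @ 0^' --> (0 : R).
    apply/cvgr0Pnorm_le => e e0.
    have c0 : 0 < (k.+2)`!%:R :> R by rewrite ltr0n fact_gt0.
    have ec : 0 < e / (k.+2)`!%:R by rewrite divr_gt0.
    near=> h.
    have h0 : h != 0 by near: h; exact: nbhs_dnbhs_neq.
    rewrite addr0 {2}/flat ltxx subr0 /GRing.scale /= mulr1.
    have -> : h^-1 * flat k h = flat k.+1 h.
      by rewrite /flat; case: ifP => hp; rewrite ?mulr0 // exprS mulrA.
    rewrite ger0_norm ?flat_ge0 // (le_trans (flat_le _ _)) //.
    rewrite mulrC -ler_pdivlMr //.
    near: h; apply: nbhs_dnbhs.
    apply/nbhs_ballP; exists (e / (k.+2)`!%:R) => //= y.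
    by rewrite /ball /= sub0r normrN => /ltW.
  apply: DeriveDef; last exact: cvg_lim cv.
  by apply/cvg_ex; exists 0.
Unshelve. all: by end_near. Qed.

Lemma smooth_flat_Ck j k : Ck_on j setT (flat k).
Proof.
have df i x : differentiable (flat i) x.
  by apply/derivable1_diffP; have [] := flat_is_derive i x.
elim: j k => [|j IH] k.
  by move=> x _; exact: differentiable_continuous.
split=> [x _|v]; first exact: df.
have -> : (fun x => 'd (flat k) x v) = fun x => v *: (flat k.+2 x - k%:R * flat k.+1 x).
  apply/funext => x; have hd := flat_is_derive k x.
  rewrite -{1}[v]mulr1 -[v * 1]/(v *: 1) linearZ /= -deriveE //.
  by rewrite (@derive_val _ _ _ _ _ _ _ hd).
apply: Ck_onZ; [exact: openT|exact: Ck_on_cst|].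
apply: Ck_onD; [exact: openT|exact: IH|].
have ck : Ck_on j [set: R] (fun=> - k%:R : R) := Ck_on_cst j _ _.
have := Ck_onZ openT ck (IH k.+1).
by apply: Ck_on_ext openT _ => x _; rewrite /GRing.scale /= mulNr.
Qed.

Lemma sm_flat k x : sm (flat k) x.
Proof. by apply: (sm_on openT) => // j; exact: smooth_flat_Ck. Qed.

Definition bump (a b t : R) : R := flat 0 (t - a) * flat 0 (b - t).

Lemma sm_bump a b t : sm (bump a b) t.
Proof.
apply: smM.
  apply: (sm_comp (f := fun t => t - a) fin_dim_R _ (sm_flat 0 _)).
  by apply: smB; [exact: sm_id|exact: sm_cst].
apply: (sm_comp (f := fun t => b - t) fin_dim_R _ (sm_flat 0 _)).
by apply: smB; [exact: sm_cst|exact: sm_id].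
Qed.

Lemma bump_ge0 a b t : 0 <= bump a b t.
Proof. by rewrite mulr_ge0 // flat_ge0. Qed.

Lemma bump_gt0 a b t : a < t < b -> 0 < bump a b t.
Proof.
move=> /andP[at_ tb]; rewrite /bump /flat !subr_gt0 at_ tb !expr0 !mul1r.
by rewrite mulr_gt0 // expR_gt0.
Qed.

Lemma bump_eq0 a b t : ~~ (a < t < b) -> bump a b t = 0.
Proof.
rewrite negb_and /bump /flat !subr_gt0 => /orP[|] /negPf ->; rewrite ?mul0r ?mulr0 //.
Qed.

End Bump.

(** * Integrals of smooth functions over a segment *)

Section Integrals.
Context {R : realType}.
Local Notation mu := (@lebesgue_measure R).

Lemma sm_within (f : R -> R) (t0 t1 : R) :
  (forall t, t0 <= t <= t1 -> sm f t) -> {within `[t0, t1], continuous f}.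
Proof.
move=> sf; apply: continuous_in_subspaceT => t; rewrite inE /= in_itv /= => ht.
exact: sm_continuous (sf t ht).
Qed.

Lemma sm_integrable (f : R -> R) (t0 t1 : R) :
  (forall t, t0 <= t <= t1 -> sm f t) -> mu.-integrable `[t0, t1] (EFin \o f).
Proof.
move=> sf; apply: continuous_compact_integrable; first exact: segment_compact.
exact: sm_within.
Qed.

Lemma sm_integral_derive (f : R -> R) (t0 t1 : R) : t0 < t1 ->
  (forall t, t0 <= t <= t1 -> sm f t) ->
  \int[mu]_(t in `[t0, t1]) dir f t 1 = f t1 - f t0.
Proof.
move=> t01 sf; rewrite /Rintegral.
rewrite (@continuous_FTC2 _ (fun t => dir f t 1) f) //.
- by apply: sm_within => t ht; exact: sm_dir (sf t ht).
- split.
  + move=> t; rewrite in_itv /= => /andP[a b].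
    have st : sm f t by apply: sf; rewrite !ltW.
    exact: diff_derivable (sm_differentiable st).
  + apply: cvg_at_right_filter; apply: sm_cvg; apply: sf.
    by rewrite lexx ltW.
  + apply: cvg_at_left_filter; apply: sm_cvg; apply: sf.
    by rewrite lexx ltW.
- move=> t; rewrite in_itv /= => /andP[a b].
  by rewrite derive1_dir //; apply: sf; rewrite !ltW.
Qed.

(** A positive value f t would keep f above f t / 2 on a segment starting at t, and
    the integral would be positive. *)
Lemma integral_ge0_eq0 (f : R -> R) (t0 t1 t : R) : t0 < t < t1 ->
  (forall t, t0 <= t <= t1 -> sm f t) -> (forall t, t0 <= t <= t1 -> 0 <= f t) ->
  \int[mu]_(t in `[t0, t1]) f t = 0 -> f t = 0.
Proof.
move=> /andP[t0t tt1] sf f0 If.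
have st : sm f t by apply: sf; rewrite !ltW.
apply/eqP; rewrite eq_le; apply/andP; split; last by apply: f0; rewrite !ltW.
rewrite leNgt; apply/negP => ft0.
have ft20 : 0 < f t / 2 by rewrite divr_gt0.
have nt : \forall y \near t, f t / 2 <= f y.
  have := sm_cvg st => /cvgrPdist_le /(_ _ ft20); apply: filterS => y.
  rewrite ler_norml => /andP[_]; rewrite lerBlDr -lerBlDl => h.
  by apply: le_trans h; rewrite {2}[f t]splitr addrK.
have [e /= e0 he] : exists2 e : R, 0 < e & forall y, `|t - y| < e -> f t / 2 <= f y /\ t0 < y < t1.
  have n2 : \forall y \near t, f t / 2 <= f y /\ t0 < y < t1.
    apply: filterS (filterI nt (filterI (lt_nbhsr t0t) (lt_nbhsl tt1))) => y [? [? ?]].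
    by split => //; apply/andP.
  by move/nbhs_ballP : n2 => [e /= e0 h]; exists e.
pose b := t + e / 2.
have tb : t < b by rewrite ltrDl divr_gt0.
have sub y : t <= y <= b -> f t / 2 <= f y /\ t0 < y < t1.
  move=> /andP[ty yb]; apply: he; rewrite distrC ger0_norm ?subr_ge0 //.
  by rewrite ltrBlDl (le_lt_trans yb) // ltrD2l ltr_pdivrMr // ltr_pMr // ltr1n.
have mf := measurable_int mu (sm_integrable sf).
have I1 : (\int[mu]_(y in `[t, b]) (f y)%:E <= \int[mu]_(y in `[t0, t1]) (f y)%:E)%E.
  apply: ge0_subset_integral => //.
  move=> y /=; rewrite !in_itv /= => /sub [_ /andP[? ?]]; by rewrite !ltW.
have I2 : (\int[mu]_(y in `[t, b]) (cst (f t / 2)%:E) y <= \int[mu]_(y in `[t, b]) (f y)%:E)%E.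
  apply: ge0_le_integral => //.
  - by move=> y _; rewrite lee_fin ltW.
  - apply: measurable_funS mf => // y /=; rewrite !in_itv /= => /sub [_ /andP[? ?]].
    by rewrite !ltW.
  - by move=> y /=; rewrite in_itv /= => /sub [h _]; rewrite lee_fin.
have If' : (\int[mu]_(y in `[t0, t1]) (f y)%:E = 0)%E.
  rewrite -[LHS]fineK; first by rewrite -[fine _]/(\int[mu]_(y in `[t0, t1]) f y) If.
  apply: integrable_fin_num; first exact: measurable_itv.
  exact: sm_integrable.
have mtb : lebesgue_measure (`[t, b]%classic : set R) = (b - t)%:E.
  by rewrite lebesgue_measure_itv /= lte_fin tb.
have := le_trans I2 I1; rewrite If' integral_cst //.
rewrite [X in (_ * X)%E](_ : _ = (b - t)%:E); last exact: mtb.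
by rewrite -EFinM lee_fin leNgt mulr_gt0 // subr_gt0.
Qed.

Lemma near0_norm (P : R -> Prop) : (\forall s \near (0 : R), P s) ->
  exists2 e : R, 0 < e & forall s, `|s| < e -> P s.
Proof.
move=> /nbhs_ballP [e /= e0 h]; exists e => // s hs; apply: h.
by rewrite /ball /= sub0r normrN.
Qed.

(** Tube lemma for the compact segment. *)
Lemma uniform_nbhs (P : R * R -> Prop) (t0 t1 : R) :
  (forall t, t0 <= t <= t1 -> \forall z \near ((t, 0) : R * R), P z) ->
  \forall s \near (0 : R), forall t, t0 <= t <= t1 -> P (t, s).
Proof.
move=> h; have /compact_near_coveringP := @segment_compact R t0 t1.
move=> /(_ R (nbhs (0 : R)) (fun s t => P (t, s)) _) [|e e0 he].
  move=> t /=; rewrite in_itv /= => ht; have [[U V] nUV UV] := h t ht.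
  by exists (U, V) => // -[x i]; exact: UV.
by exists e => // s hs t ht; apply: (he s hs).
Qed.

Lemma locally_bounded (g : R * R -> R) (t0 t1 : R) :
  (forall t, t0 <= t <= t1 -> {for (t, 0), continuous g}) ->
  exists C, 0 <= C /\ \forall s \near (0 : R), forall t, t0 <= t <= t1 -> `|g (t, s)| <= C.
Proof.
move=> cg.
have /compact_near_coveringP := @segment_compact R t0 t1.
move=> /(_ (R * R)%type (filter_prod (nbhs (0 : R)) (pinfty_nbhs R))
  (fun p t => `|g (t, p.1)| <= p.2) _) [].
  move=> t /=; rewrite in_itv /= => /cg ct.
  have n1 : \forall z \near ((t, 0) : R * R), `|g z| <= `|g (t, 0)| + 1.
    have := ct => /cvgrPdist_le /(_ 1 ltr01); apply: filterS => z hz.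
    rewrite -[g z](subrK (g (t, 0))) addrC (le_trans (ler_normD _ _)) // lerD2l.
    by rewrite distrC.
  move: n1 => [[U V] /= [nU nV] UV].
  exists (U, V `*` [set C | `|g (t, 0)| + 1 <= C]) => /=.
    split => //; exists (V, [set C | `|g (t, 0)| + 1 <= C]) => //=; split => //.
    exact: nbhs_pinfty_ge.
  move=> [t' [s C]] /= [Ut' [Vs hC]]; exact: (le_trans (UV (t', s) (conj Ut' Vs))).
move=> [U V] /= [nU nV] UV.
have [C [VC C0]] : exists C, V C /\ 0 <= C.
  have [C [? ?]] := filter_ex (filterI nV (@nbhs_pinfty_ge R 0 (num_real 0))).
  by exists C.
exists C; split => //; apply: filterS nU => s Us t ht.
by apply: (UV (s, C)) => //=; rewrite in_itv.
Qed.

Lemma sm_curve_fst (f : R * R -> R) t s : sm f (t, s) -> sm (fun t => f (t, s)) t.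
Proof.
move=> sf; apply: (sm_comp (f := fun t : R => (t, s)) _ _ sf).
  exact: (fin_dim_prod fin_dim_R fin_dim_R).
by apply: sm_pair; [exact: sm_id|exact: sm_cst].
Qed.

Lemma sm_curve_snd (f : R * R -> R) t s : sm f (t, s) -> sm (fun s => f (t, s)) s.
Proof.
move=> sf; apply: (sm_comp (f := fun s : R => (t, s)) _ _ sf).
  exact: (fin_dim_prod fin_dim_R fin_dim_R).
by apply: sm_pair; [exact: sm_cst|exact: sm_id].
Qed.

(** By compactness f is smooth, with bounded derivative in s, on a strip around the
    segment; the bound is the dominating function that allows differentiation under
    the integral sign. *)
Lemma derive_under_integral (f : R * R -> R) (t0 t1 : R) :
  (forall t, t0 <= t <= t1 -> sm f (t, 0)) ->
  is_derive (0 : R) (1 : R) (fun s => \int[mu]_(t in `[t0, t1]) f (t, s))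
    (\int[mu]_(t in `[t0, t1]) dir f (t, 0) (0, 1)).
Proof.
move=> sf; pose df z := dir f z (0, 1).
have [C [C0 nC]] : exists C, 0 <= C /\ \forall s \near (0 : R),
    forall t, t0 <= t <= t1 -> `|df (t, s)| <= C.
  by apply: locally_bounded => t /sf st; apply: sm_continuous; exact: sm_dir.
have nS : \forall s \near (0 : R), forall t, t0 <= t <= t1 -> sm f (t, s).
  by apply: uniform_nbhs => t /sf /sm_near.
have [e e0 he] := near0_norm (filterI nC nS).
have hI s : `](- e), e[%classic s -> `|s| < e by rewrite /= in_itv /= ltr_norml.
have I0 : `](- e), e[%classic (0 : R) by rewrite /= in_itv /= oppr_lt0 e0.
have mB : measurable (`[t0, t1] : set R) by exact: measurable_itv.
have dE s t : `](- e), e[%classic s -> `[t0, t1]%classic t ->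
    partial1of2 (fun s t => f (t, s)) s t = df (t, s).
  move=> /hI /he [_ h] /=; rewrite in_itv /= => /h st.
  by rewrite /partial1of2 /df (derive1_dir (sm_curve_snd st)) (dir_partial_r _ st).
have i1 s : `](- e), e[%classic s -> mu.-integrable `[t0, t1] (EFin \o (fun t => f (t, s))).
  move=> /hI /he [_ h]; apply: sm_integrable => t /h st.
  exact: (sm_curve_fst st).
have i2 s t : `](- e), e[%classic s -> `[t0, t1]%classic t -> derivable (fun s => f (t, s)) s 1.
  move=> /hI /he [_ h] /=; rewrite in_itv /= => /h st.
  by apply: diff_derivable; exact: (sm_differentiable (sm_curve_snd st)).
have i3 : mu.-integrable `[t0, t1] (EFin \o (fun=> C)).
  by apply: sm_integrable => t _; exact: sm_cst.
have i4 s t : `](- e), e[%classic s -> `[t0, t1]%classic t ->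
    `|partial1of2 (fun s t => f (t, s)) s t| <= C.
  move=> Is It; rewrite dE //; have [h _] := he s (hI s Is).
  by apply: h; move: It; rewrite /= in_itv.
apply: DeriveDef.
  exact (@derivable_under_integral R _ _ mu (fun s t => f (t, s)) `[t0, t1]%classic mB
    0 (- e) e I0 i1 i2 (fun=> C) (fun=> C0) i3 i4).
have D := @differentiation_under_integral R _ _ mu (fun s t => f (t, s)) `[t0, t1]%classic mB
    0 (- e) e I0 i1 i2 (fun=> C) (fun=> C0) i3 i4.
rewrite -derive1E; refine (etrans D _).
by apply: eq_Rintegral => t; rewrite inE => It; rewrite dE.
Qed.

End Integrals.

(** * Linear subspaces of row vectors *)

Definition lin_subspace {R : realType} {d : nat} (V : set 'rV[R]_d) : Prop :=
  V 0 /\ forall c u v, V u -> V v -> V (c *: u + v).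

Section Subspaces.
Context {R : realType} {d : nat}.
Implicit Types (V : set 'rV[R]_d).

Lemma subspaceD V u v : lin_subspace V -> V u -> V v -> V (u + v).
Proof. by move=> [_ h] Vu Vv; rewrite -[u]scale1r; exact: h. Qed.

Lemma subspaceZ V c u : lin_subspace V -> V u -> V (c *: u).
Proof. by move=> [h0 h] Vu; rewrite -[_ *: _]addr0; exact: h. Qed.

Lemma subspaceN V u : lin_subspace V -> V u -> V (- u).
Proof. by move=> sV Vu; rewrite -scaleN1r; exact: subspaceZ. Qed.

Lemma subspaceB V u v : lin_subspace V -> V u -> V v -> V (u - v).
Proof. by move=> sV Vu Vv; apply: subspaceD => //; exact: subspaceN. Qed.

Lemma subspace_sum V (I : Type) (s : seq I) (P : pred I) (f : I -> 'rV[R]_d) :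
  lin_subspace V -> (forall i, P i -> V (f i)) -> V (\sum_(i <- s | P i) f i).
Proof.
move=> sV h; elim/big_ind : _ => //; first by case: sV.
by move=> u v; exact: subspaceD.
Qed.

(** A matrix of maximal rank with rows in V: a vector of V outside its row space
    would raise the rank. *)
Lemma subspace_mx V : lin_subspace V ->
  exists M : 'M[R]_d, forall w : 'rV[R]_d, V w <-> (w <= M)%MS.
Proof.
move=> sV.
pose rows p (M : 'M[R]_(p, d)) := forall i, V (row i M).
have subV p (M : 'M[R]_(p, d)) (w : 'rV[R]_d) : rows p M -> (w <= M)%MS -> V w.
  move=> rM /submxP [D ->]; rewrite mulmx_sum_row; apply: subspace_sum => // i _.
  exact: subspaceZ.
pose P k := `[< exists M : 'M[R]_d, rows d M /\ \rank M = k >].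
have exP : exists k, P k.
  exists 0%N; apply/asboolP; exists 0; split; last exact: mxrank0.
  by move=> i; rewrite row0; case: sV.
have ubP k : P k -> (k <= d)%N by move=> /asboolP [M [_ <-]]; exact: rank_leq_row.
have [k /asboolP [M [rM rk]] kmax] := ex_maxnP exP ubP.
exists M => w; split; last exact: subV.
move=> Vw; apply/negPn/negP => nw.
have : P (\rank (col_mx M w)).
  apply/asboolP; exists <<col_mx M w>>%MS; split; last by rewrite genmxE.
  move=> i; have : (row i <<col_mx M w>> <= col_mx M w)%MS.
    by rewrite (submx_trans (row_sub i _)) // genmxE.
  apply: subV => j; rewrite -[j]splitK; case: (fintype.split j) => j' /=.
    by rewrite rowKu; exact: rM.
  by rewrite rowKd ord1 row_id.
move=> /kmax; rewrite -rk leqNgt => /negP; apply.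
have MC : (M <= col_mx M w)%MS by rewrite -addsmxE addsmxSl.
have : (M < col_mx M w)%MS.
  rewrite ltmxE MC /=; apply: contra nw => CM.
  by rewrite (submx_trans _ CM) // -addsmxE addsmxSr.
by rewrite ltmxErank MC.
Qed.

(** V is the kernel of a matrix, that is, it is defined by finitely many linear
    equations, and these can be differentiated. *)
Lemma subspace_derivative V (f : R -> 'rV[R]_d) t : lin_subspace V -> sm f t ->
  (\forall r \near t, V (f r)) -> V (dir f t 1).
Proof.
move=> /subspace_mx [M VM] sf nV; apply/VM; rewrite submxE; apply/eqP.
apply/rowP => j; rewrite [RHS]mxE mxE; pose K := cokermx M.
have E1 : dir (fun r => \sum_i f r 0 i * K i j) t (1 : R) = \sum_i dir f t 1 0 i * K i j.
  rewrite dir_sum; last by move=> i _; apply: smM; [exact: sm_coord|exact: sm_cst].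
  apply: eq_bigr => i _.
  rewrite dirM; [|exact: sm_coord|exact: sm_cst].
  by rewrite dir_cst mulr0 addr0 dir_coord.
rewrite -E1 -[RHS](dir_cst (0 : R) t (1 : R)); apply: dir_ext; last exact: sm_cst.
apply: filterS nV => r /VM; rewrite submxE => /eqP /rowP /(_ j).
by rewrite mxE [RHS]mxE => ->.
Qed.

(** The coordinates of the projection in a basis of V solve a linear system whose
    matrix, the Gram matrix of the basis, is invertible because the form is
    definite. *)
Lemma orthogonal_projection (ip : 'rV[R]_d -> 'rV[R]_d -> R) V :
  (forall w c u v, ip (c *: u + v) w = c * ip u w + ip v w) ->
  (forall u v, ip u v = ip v u) -> (forall u, u != 0 -> 0 < ip u u) ->
  lin_subspace V -> forall xi, exists zeta, V zeta /\
    forall kappa, V kappa -> ip (xi - zeta) kappa = 0.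
Proof.
move=> ipl ipC ip0 /subspace_mx [M VM] xi.
pose ipL w : 'rV[R]_d -> R := ip^~ w.
have lin w : linear (ipL w : _ -> R^o) by move=> c u v; exact: ipl.
have ipsum (I : finType) (a : I -> R) (u : I -> 'rV[R]_d) w :
    ip (\sum_i a i *: u i) w = \sum_i a i * ip (u i) w.
  pose L : {linear 'rV[R]_d -> R^o} := HB.pack (ipL w) (GRing.isLinear.Build _ _ _ _ _ (lin w)).
  rewrite -[LHS]/(L _) linear_sum; apply: eq_bigr => i _.
  by rewrite linearZ.
pose B := row_base M.
pose P := \matrix_(i, j) ip (row i B) (row j B).
have key (x : 'rV[R]_(\rank M)) j : (x *m P) 0 j = ip (x *m B) (row j B).
  rewrite [x *m B]mulmx_sum_row ipsum mxE; apply: eq_bigr => i _.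
  by rewrite !mxE.
have uP : P \in unitmx.
  rewrite -row_free_unit; apply: inj_row_free => x xP.
  have h : ip (x *m B) (x *m B) = 0.
    rewrite {2}[x *m B]mulmx_sum_row ipC ipsum big1 // => j _.
    by rewrite ipC -key xP mxE mulr0.
  have : x *m B = 0.
    by apply/eqP; apply: contraT => /ip0; rewrite h ltxx.
  have rf : row_free B by exact: row_base_free.
  by move=> /(congr1 (mulmx^~ (pinvmx B))); rewrite mulmxKp // mul0mx.
pose c := (\row_j ip xi (row j B)) *m invmx P.
exists (c *m B); split.
  by apply/VM; rewrite (submx_trans (submxMl _ _)) // eq_row_base.
move=> kappa /VM; rewrite -(eq_row_base M) => /submxP [y ->].
rewrite [y *m _]mulmx_sum_row -/B ipC ipsum big1 // => j _; rewrite ipC.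
rewrite addrC -scaleN1r ipl mulN1r -key /c mulmxKV // mxE addrC subrr mulr0 //.
Qed.

End Subspaces.

(** * Brackets in an orthogonal flag of Lie subalgebras *)


Section StageAlgebra.
(* [stage_b] is convertible to the bracket; sealing the latter keeps rewriting from
   identifying the two. *)
Local Opaque lie_bracket.
Context {R : realType} {d : nat} {G : topGroupType}.
Variables (aG : atlas 'rV[R]_d G) (gG : G -> 'rV[R]_d -> 'rV[R]_d -> R).
Variables (n : nat) (N : nat -> set G).

Local Notation "[< xi , eta >]" := (lie_bracket aG xi eta).
Local Notation ip := (gG 1%g).
Local Notation lie j := (lie_sub aG (N j)).
Local Notation hor := (hor aG gG N).
Local Notation comp := (stage_comp aG gG n N).

Hypothesis ipl : forall w c u v, ip (c *: u + v) w = c * ip u w + ip v w.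
Hypothesis ipC : forall u v, ip u v = ip v u.
Hypothesis ip0 : forall u, u != 0 -> 0 < ip u u.
(* The Lie algebras of the chain enter through these linear properties. *)
Hypothesis lie_subspace : forall j, (j <= n.+1)%N -> lin_subspace (lie j).
Hypothesis lieS : forall j xi, (j <= n)%N -> lie j.+1 xi -> lie j xi.
Hypothesis lie0 : forall xi, lie 0 xi.
Hypothesis lien : forall xi, lie n.+1 xi -> xi = 0.
Hypothesis brl : forall w c u v, [< c *: u + v, w >] = c *: [< u, w >] + [< v, w >].
Hypothesis brC : forall u v, [< u, v >] = - [< v, u >].
Hypothesis lie_br : forall j xi zeta, (j <= n)%N ->
  lie j xi -> lie j zeta -> lie j [< xi, zeta >].
Hypothesis lie_ideal : forall j xi zeta, (j <= n)%N ->
  lie j xi -> lie j.+1 zeta -> lie j.+1 [< xi, zeta >].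

Lemma ord_le (i : 'I_n.+1) : (i <= n)%N.
Proof. by rewrite -ltnS. Qed.

Lemma ipD u v w : ip (u + v) w = ip u w + ip v w.
Proof. by rewrite -[u]scale1r ipl mul1r scale1r. Qed.

Lemma ip0l w : ip 0 w = 0.
Proof. by have := ipD 0 0 w; rewrite addr0 => /(congr1 (fun x => x - ip 0 w)); rewrite subrr addrK. Qed.

Lemma ip_sum (I : Type) (s : seq I) (P : pred I) (f : I -> 'rV[R]_d) w :
  ip (\sum_(i <- s | P i) f i) w = \sum_(i <- s | P i) ip (f i) w.
Proof. by elim/big_rec2 : _ => [|i x y Pi <-]; [exact: ip0l|exact: ipD]. Qed.

Lemma ip_eq0 u : ip u u = 0 -> u = 0.
Proof. by move=> h; apply/eqP; apply: contraT => /ip0; rewrite h ltxx. Qed.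

Lemma lieW j k xi : (j <= k <= n.+1)%N -> lie k xi -> lie j xi.
Proof.
move=> /andP[jk]; elim: k jk => [|k IH] jk kn h.
  by move: jk; rewrite leqn0 => /eqP ->.
move: jk; rewrite leq_eqVlt => /predU1P[-> //|jk].
by apply: IH => //; [exact: ltnW|exact: lieS].
Qed.

Lemma hor_subspace j : (j <= n)%N -> lin_subspace (hor j).
Proof.
move=> jn; have sj := lie_subspace (leqW jn); split; first exact: (conj sj.1 (fun z _ => ip0l z)).
move=> c u v [lu ou] [lv ov]; split; first by apply: subspaceD => //; exact: subspaceZ.
by move=> z lz; rewrite ipl ou // ov // mulr0 addr0.
Qed.

Lemma hor_orth j k u v : (j < k <= n)%N -> hor j u -> hor k v -> ip u v = 0.
Proof.
move=> /andP[jk kn] [_ ou] [lv _]; apply: ou; apply: lieW lv.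
by rewrite jk leqW.
Qed.

Lemma hor_decomp j xi : (j <= n)%N -> lie j xi ->
  exists h, hor j h /\ lie j.+1 (xi - h).
Proof.
move=> jn lxi.
have [z [lz oz]] := orthogonal_projection ipl ipC ip0 (lie_subspace (j := j.+1) jn) xi.
exists (xi - z); split; last by rewrite opprB addrC subrK.
split => //; apply: subspaceB => //; first exact/lie_subspace/leqW.
exact: lieS.
Qed.

(** Descending induction on the level j: the part of xi orthogonal to [lie j.+1] is
    its component in [hor j]. *)
Lemma stage_decomp j xi : (j <= n.+1)%N -> lie j xi ->
  exists c : 'I_n.+1 -> 'rV[R]_d,
    [/\ forall i : 'I_n.+1, hor i (c i), forall i : 'I_n.+1, (i < j)%N -> c i = 0 &
        xi = \sum_(i < n.+1) c i].
Proof.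
move=> jn; have -> : j = (n.+1 - (n.+1 - j))%N by rewrite subKn.
have : (n.+1 - j <= n.+1)%N by exact: leq_subr.
elim: (n.+1 - j)%N xi => [|k IH] xi kn.
  rewrite subn0 => /lien ->; exists (fun=> 0); split => //; last by rewrite big1.
  by move=> i; have [] := hor_subspace (ord_le i).
move=> lxi; set J := (n.+1 - k.+1)%N.
have Jn : (J <= n)%N by rewrite /J subSS leq_subr.
have JS : (n.+1 - k)%N = J.+1 by rewrite /J subSS -subSn.
have [h [hh lh]] := hor_decomp Jn lxi.
have [|c [hc c0 cs]] := IH (xi - h) (ltnW kn); first by rewrite JS.
exists (fun i : 'I_n.+1 => if (i : nat) == J then h else c i); split.
- by move=> i; case: eqP => [->|].
- move=> i iJ; rewrite (ltn_eqF iJ); apply: c0; rewrite JS; exact: ltnW.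
- pose j0 : 'I_n.+1 := Ordinal (n := n.+1) (m := J) Jn.
  rewrite (bigD1 j0) //= eqxx.
  have cj0 : c j0 = 0 by apply: c0; rewrite JS.
  move: cs; rewrite (bigD1 j0) //= cj0 add0r => /eqP; rewrite subr_eq => /eqP ->.
  rewrite addrC; congr (_ + _); apply: eq_bigr => i ij.
  case: eqP => // iJ; case/eqP : ij; exact: val_inj.
Qed.

(** The spaces [hor i] are pairwise orthogonal. *)
Lemma hor_sum_eq0 (c : 'I_n.+1 -> 'rV[R]_d) : (forall i : 'I_n.+1, hor i (c i)) ->
  \sum_(i < n.+1) c i = 0 -> forall i, c i = 0.
Proof.
move=> hc c0 i; apply: ip_eq0.
have := ip0l (c i); rewrite -c0 ip_sum (bigD1 i) //= big1 ?addr0 // => k ki.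
have [ik|ki'|/val_inj ik] := ltngtP i k.
- by rewrite ipC; apply: (@hor_orth i k) => //; rewrite ik ord_le.
- by apply: (@hor_orth k i) => //; rewrite ki' ord_le.
- by rewrite ik eqxx in ki.
Qed.

Lemma hor_sum_inj (c c' : 'I_n.+1 -> 'rV[R]_d) :
  (forall i : 'I_n.+1, hor i (c i)) -> (forall i : 'I_n.+1, hor i (c' i)) ->
  \sum_(i < n.+1) c i = \sum_(i < n.+1) c' i -> c = c'.
Proof.
move=> hc hc' cc; apply/funext => i; apply/eqP; rewrite -subr_eq0; apply/eqP.
apply: (@hor_sum_eq0 (fun i => c i - c' i)) => [k|].
  by apply: subspaceB => //; exact/hor_subspace/ord_le.
by rewrite sumrB cc subrr.
Qed.

Lemma compP xi : (forall i : 'I_n.+1, hor i (comp xi i)) /\ xi = \sum_(i < n.+1) comp xi i.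
Proof.
have [c [hc _ cs]] := stage_decomp (leq0n _) (lie0 xi).
exact: (@getPex _ [set c : 'I_n.+1 -> 'rV[R]_d |
        (forall i : 'I_n.+1, hor i (c i)) /\ xi = \sum_(i < n.+1) c i] (ex_intro _ c (conj hc cs))).
Qed.

Lemma comp_hor xi (i : 'I_n.+1) : hor i (comp xi i).
Proof. by have [h _] := compP xi. Qed.

Lemma comp_sum xi : \sum_(i < n.+1) comp xi i = xi.
Proof. by have [_ h] := compP xi. Qed.

Lemma comp_uniq xi c : (forall i : 'I_n.+1, hor i (c i)) ->
  xi = \sum_(i < n.+1) c i -> comp xi = c.
Proof.
move=> hc E; apply: hor_sum_inj => //; first exact: comp_hor.
by rewrite comp_sum.
Qed.

Lemma comp_linear c u v : comp (c *: u + v) = (fun i => c *: comp u i + comp v i).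
Proof.
apply: comp_uniq => [i|].
  by have [_ h] := hor_subspace (ord_le i); apply: h; exact: comp_hor.
by rewrite big_split /= -scaler_sumr !comp_sum.
Qed.

Lemma compD u v i : comp (u + v) i = comp u i + comp v i.
Proof. by rewrite -[u]scale1r comp_linear !scale1r. Qed.

Lemma compZ c u i : comp (c *: u) i = c *: comp u i.
Proof.
have c0 : comp 0 i = 0.
  have := compD 0 0 i; rewrite addr0 => /(congr1 (fun x => x - comp 0 i)).
  by rewrite subrr addrK.
by rewrite -[_ *: u]addr0 comp_linear c0 !addr0.
Qed.

Lemma compN u i : comp (- u) i = - comp u i.
Proof. by rewrite -scaleN1r compZ scaleN1r. Qed.

Lemma compB u v i : comp (u - v) i = comp u i - comp v i.
Proof. by rewrite compD compN. Qed.

Lemma comp_0 i : comp 0 i = 0.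
Proof. by have := compZ 0 0 i; rewrite !scale0r. Qed.

Lemma comp_bigsum (I : Type) (s : seq I) (P : pred I) (f : I -> 'rV[R]_d) i :
  comp (\sum_(k <- s | P k) f k) i = \sum_(k <- s | P k) comp (f k) i.
Proof. by elim/big_rec2 : _ => [|k x y Pk <-]; [exact: comp_0|exact: compD]. Qed.

(** A vector of [lie j] has a decomposition that starts at level j, and
    decompositions are unique. *)
Lemma comp_lie j xi (i : 'I_n.+1) : (j <= n.+1)%N -> lie j xi -> (i < j)%N -> comp xi i = 0.
Proof.
by move=> jn lxi ij; have [c [hc c0 cs]] := stage_decomp jn lxi; rewrite (comp_uniq hc cs) c0.
Qed.

Lemma comp_of_hor (j : 'I_n.+1) xi (i : 'I_n.+1) : hor j xi -> i != j -> comp xi i = 0.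
Proof.
move=> hxi ij; rewrite (@comp_uniq xi (fun k => if k == j then xi else 0)).
- by rewrite (negPf ij).
- move=> k; case: eqP => [->//|_]; exact: (hor_subspace (ord_le k)).1.
- by rewrite (bigD1 j) //= eqxx big1 ?addr0 // => k /negPf ->.
Qed.

Lemma lie_above (j : 'I_n.+1) xi :
  lie j.+1 (\sum_(k < n.+1 | (j < k)%N) comp xi k).
Proof.
apply: subspace_sum; first exact/lie_subspace/ord_le.
move=> k jk; have [+ _] := comp_hor xi k; apply: lieW.
by rewrite jk leqW // ord_le.
Qed.

(** The vector minus its projection to [lie j.+1] lies in [hor j]. *)
Lemma comp_stage_connection (j i : 'I_n.+1) xi : lie j xi -> (j < i)%N ->
  comp (stage_connection aG gG N j.+1 xi) i = comp xi i.
Proof.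
move=> lxi ji.
have [z hz] := orthogonal_projection ipl ipC ip0 (lie_subspace (j := j.+1) (ltn_ord j)) xi.
have [] := @getPex _ [set zeta | lie j.+1 zeta /\
                  forall kappa, lie j.+1 kappa -> ip (xi - zeta) kappa = 0] (ex_intro _ z hz).
rewrite -/(stage_connection aG gG N j.+1 xi).
set P := stage_connection _ _ _ _ _ => lP oP.
have hP : hor j (xi - P).
  split => //; apply: subspaceB => //; first exact/lie_subspace/leqW/ord_le.
  exact: (lieS (ltn_ord j)).
have : comp (xi - P) i = 0 by apply: comp_of_hor hP _; apply/eqP => ij; rewrite ij ltnn in ji.
by rewrite compB => /eqP; rewrite subr_eq0 => /eqP.
Qed.

(** The component in [hor i] of the bracket represents its class: the components of
    lower level vanish and those of higher level lie in [lie i.+1]. *)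
Lemma comp_quot_bracket (i : 'I_n.+1) xi zeta : hor i xi -> hor i zeta ->
  quot_bracket aG gG N i xi zeta = comp [< xi, zeta >] i.
Proof.
move=> [lxi _] [lz _]; have iN := ord_le i.
have lb := lie_br iN lxi lz; set B := [< xi, zeta >] in lb *.
rewrite /quot_bracket /hor_lift -/B.
have ex : (class_mod aG N i B `&` hor i) (comp B i).
  split; last exact: comp_hor.
  rewrite /class_mod /= -opprB -[X in - (X - _)](comp_sum B) (bigD1 i) //= addrAC subrr add0r.
  apply: subspaceN; first exact: lie_subspace.
  apply: subspace_sum; first exact: lie_subspace.
  move=> k ki; have [ik|ki'|/val_inj ik] := ltngtP i k.
  - have [+ _] := comp_hor B k; apply: lieW; by rewrite ik leqW // ord_le.
  - rewrite (comp_lie _ lb ki') ?leqW //; by have [] := lie_subspace (j := i.+1) iN.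
  - by rewrite ik eqxx in ki.
have [lg hg] := @getPex _ _ (ex_intro _ _ ex).
set Z := get _ in lg hg *.
have [lB hB] := ex.
apply/eqP; rewrite -subr_eq0; apply/eqP/ip_eq0.
have hZ : hor i (Z - comp B i) by apply: subspaceB => //; exact: hor_subspace.
apply: hZ.2.
have aux (x y z : 'rV[R]_d) : x - z = (x - y) - (z - y) by rewrite opprB addrA subrK.
rewrite (aux _ B).
by apply: subspaceB => //; exact: lie_subspace.
Qed.

Lemma brD u v w : [< u + v, w >] = [< u, w >] + [< v, w >].
Proof. by rewrite -[u]scale1r brl !scale1r. Qed.

Lemma brDr u v w : [< w, u + v >] = [< w, u >] + [< w, v >].
Proof. by rewrite brC brD opprD [in RHS]brC [X in _ = _ + X]brC. Qed.

Lemma br0 w : [< 0, w >] = 0.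
Proof.
have := brD 0 0 w; rewrite addr0 => /(congr1 (fun x => x - [< 0, w >])).
by rewrite subrr addrK.
Qed.

Lemma br0r w : [< w, 0 >] = 0.
Proof. by rewrite brC br0 oppr0. Qed.

Lemma br_sum (I : Type) (s : seq I) (P : pred I) (f : I -> 'rV[R]_d) w :
  [< \sum_(k <- s | P k) f k, w >] = \sum_(k <- s | P k) [< f k, w >].
Proof. by elim/big_rec2 : _ => [|k x y Pk <-]; [exact: br0|exact: brD]. Qed.

Lemma br_sumr (I : Type) (s : seq I) (P : pred I) (f : I -> 'rV[R]_d) w :
  [< w, \sum_(k <- s | P k) f k >] = \sum_(k <- s | P k) [< w, f k >].
Proof. by elim/big_rec2 : _ => [|k x y Pk <-]; [exact: br0r|exact: brDr]. Qed.

(** By antisymmetry a pair j < k contributes [x j, y k] - [y j, x k]. *)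
Lemma br_split (x y : 'I_n.+1 -> 'rV[R]_d) :
  [< \sum_i x i, \sum_i y i >] = \sum_(j < n.+1)
    ([< x j, y j >] + [< x j, \sum_(k < n.+1 | (j < k)%N) y k >]
      - [< y j, \sum_(k < n.+1 | (j < k)%N) x k >]).
Proof.
have E1 : [< \sum_i x i, \sum_i y i >] = \sum_(j < n.+1)
    ([< x j, y j >] + (\sum_(k < n.+1 | (j < k)%N) [< x j, y k >]
      + \sum_(k < n.+1 | (k < j)%N) [< x j, y k >])).
  rewrite br_sum; apply: eq_bigr => j _; rewrite br_sumr (bigD1 j) //=; congr (_ + _).
  rewrite (bigID (fun k : 'I_n.+1 => (j < k)%N)) /=; congr (_ + _); apply: eq_bigl => k.
    by rewrite -val_eqE /= neq_ltn; case: ltngtP.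
  by rewrite -val_eqE /= neq_ltn; case: ltngtP.
rewrite E1 [LHS]big_split /= [X in _ + X]big_split /= [RHS]big_split /=.
rewrite [X in _ = X + _]big_split /= -addrA; congr (_ + (_ + _)).
  by apply: eq_bigr => j _; rewrite br_sumr.
rewrite (exchange_big_dep xpredT) //=; apply: eq_bigr => k _.
by rewrite brC opprK br_sum.
Qed.

(** In [br_split], the terms of index j > i lie in [lie j] and have no component of
    level i. For j = i only the bracket of the two components survives, since [hor
    i, lie i.+1] is contained in the ideal [lie i.+1]. For j < i the bracket of the
    two components of level j is minus the value of a, and the two mixed terms are
    values of b. *)
Lemma comp_bracket xi zeta (i : 'I_n.+1) :
  let above (j : 'I_n.+1) (c : 'I_n.+1 -> 'rV[R]_d) := \sum_(k < n.+1 | (j < k)%N) c k in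
  comp [< xi, zeta >] i =
    quot_bracket aG gG N i (comp xi i) (comp zeta i)
    + \sum_(j < n.+1 | (j < i)%N)
        (- comp (stage_a aG gG N j (comp xi j) (comp zeta j)) i
         + comp (stage_b aG j (comp xi j) (above j (comp zeta))) i
         - comp (stage_b aG j (comp zeta j) (above j (comp xi))) i).
Proof.
move=> above; rewrite comp_quot_bracket; [|exact: comp_hor..].
have lc z (j : 'I_n.+1) : lie j (comp z j) by have [] := comp_hor z j.
have jn := ord_le.
have comp3 u v w k : comp (u + v - w) k = comp u k + comp v k - comp w k.
  by rewrite compB compD.
pose p z w := fun j : 'I_n.+1 => comp [< comp z j, comp w j >] i.
pose q z w := fun j : 'I_n.+1 => comp [< comp z j, above j (comp w) >] i.
transitivity (\sum_(j < n.+1) (p xi zeta j + q xi zeta j - q zeta xi j)).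
  rewrite -[in LHS](comp_sum xi) -[in LHS](comp_sum zeta) br_split comp_bigsum.
  by apply: eq_bigr => j _; exact: comp3.
have q0 z w (j : 'I_n.+1) : (i <= j)%N -> q z w j = 0.
  move=> ij; apply: (@comp_lie j.+1) => //.
  by apply: lie_ideal => //; exact: lie_above.
have p0 (j : 'I_n.+1) : (i < j)%N -> p xi zeta j = 0.
  move=> ij; apply: (@comp_lie j) => //; first exact/leqW/jn.
  exact: lie_br.
rewrite (bigD1 i) //; congr (_ + _); first by rewrite (q0 xi zeta i) // (q0 zeta xi i) // addr0 subr0.
rewrite (bigID (fun j : 'I_n.+1 => (j < i)%N)) /= [X in _ + X]big1 ?addr0; last first.
  move=> j /andP[ji]; rewrite -leqNgt => ij.
  have {}ij : (i < j)%N by rewrite ltn_neqAle eq_sym ji.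
  by rewrite (q0 xi zeta j) 1?ltnW // (q0 zeta xi j) 1?ltnW // addr0 subr0 p0 //.
apply: eq_big => [j|j /andP[_ ji]].
  by rewrite andb_idl // => ji; apply/eqP => ji'; rewrite ji' ltnn in ji.
congr (_ + _ - _).
rewrite /stage_a compN opprK comp_stage_connection //.
exact: lie_br.
Qed.

End StageAlgebra.

(** * Smooth maps into a manifold *)

(** The conditions of [is_manifold] on the charts; unlike the global topological
    conditions they pass directly to products. *)
Definition smooth_atlas {R : realType} {E : normedModType R} {T : topologicalType}
    (a : atlas E T) : Prop :=
  (forall p, [/\ chart_dom a p p, open (chart_dom a p),
                    open (chart_image a p setT),
                    forall x, chart_dom a p x ->
                      chart_inv a p (chart a p x) = x &
                    (forall x, chart_dom a p x ->
                      {for x, continuous (chart a p)}) /\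
                    (forall u, chart_image a p setT u ->
                      {for u, continuous (chart_inv a p)})]) /\
      forall p q, smooth_on (chart_image a p (chart_dom a q))
                            (chart a q \o chart_inv a p).

(** Smoothness at z of a map from a normed space to a manifold, read in the chart at
    the image point. *)
Definition msm {R : realType} {E H : normedModType R} {T : topologicalType}
    (a : atlas E T) (f : H -> T) (z : H) : Prop :=
  {for z, continuous f} /\ sm (fun y => chart a (f z) (f y)) z.

(** The image of v under the differential of f at z, with components in the chart at
    f z as for any tangent vector there. *)
Definition tv {R : realType} {E H : normedModType R} {T : topologicalType}
    (a : atlas E T) (f : H -> T) (z v : H) : E :=
  dir (fun y => chart a (f z) (f y)) z v.

Section Charts.
Context {R : realType} {E : normedModType R} {T : topologicalType}.
Variable a : atlas E T.
Hypothesis ha : smooth_atlas a.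
Hypothesis fE : fin_dim E.
Implicit Types H : normedModType R.

Lemma dom_self p : chart_dom a p p.
Proof. by have [/(_ p) []] := ha. Qed.

Lemma dom_open p : open (chart_dom a p).
Proof. by have [/(_ p) []] := ha. Qed.

Lemma img_open p : open (chart_image a p setT).
Proof. by have [/(_ p) []] := ha. Qed.

Lemma chartK p x : chart_dom a p x -> chart_inv a p (chart a p x) = x.
Proof. by have [/(_ p) [_ _ _ h _] _] := ha; exact: h. Qed.

Lemma chart_cont p x : chart_dom a p x -> {for x, continuous (chart a p)}.
Proof. by have [/(_ p) [_ _ _ _ [h _]] _] := ha; exact: h. Qed.

Lemma inv_cont p u : chart_image a p setT u -> {for u, continuous (chart_inv a p)}.
Proof. by have [/(_ p) [_ _ _ _ [_ h]] _] := ha; exact: h. Qed.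

Lemma img_chart p x : chart_dom a p x -> chart_image a p setT (chart a p x).
Proof. by move=> px; exists x. Qed.

Lemma inv_dom p u : chart_image a p setT u -> chart_dom a p (chart_inv a p u).
Proof. by move=> [x [_ px] <-]; rewrite chartK. Qed.

Lemma chart_invK p u : chart_image a p setT u -> chart a p (chart_inv a p u) = u.
Proof. by move=> [x [_ px] <-]; rewrite chartK. Qed.

Lemma nbhs_dom p x : chart_dom a p x -> \forall y \near x, chart_dom a p y.
Proof. by move=> px; apply: open_nbhs_nbhs; split => //; exact: dom_open. Qed.

Lemma nbhs_img p u : chart_image a p setT u -> \forall y \near u, chart_image a p setT y.
Proof. by move=> px; apply: open_nbhs_nbhs; split => //; exact: img_open. Qed.

Lemma chart_image_open p U : open U -> open (chart_image a p U).
Proof.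
move=> oU.
have -> : chart_image a p U = chart_image a p setT `&` (chart_inv a p @^-1` U).
  apply/seteqP; split => [u [x [Ux px] <-]|u [/[dup] iu [x [_ px] xu] Uu]].
    by split; [exists x|rewrite /= chartK].
  by exists x => //; split => //; move: Uu; rewrite /= -xu chartK.
rewrite openE => u [iu Uu]; apply: filterI; first exact: nbhs_img.
by apply: (inv_cont iu); exact: open_nbhs_nbhs.
Qed.

Lemma trans_sm p q x : chart_dom a p x -> chart_dom a q x ->
  sm (fun u => chart a q (chart_inv a p u)) (chart a p x).
Proof.
move=> px qx; have [_ /(_ p q) h] := ha.
apply: sm_on h; first by apply: chart_image_open; exact: dom_open.
by exists x.
Qed.

Lemma near_chartK p H (f : H -> T) z : {for z, continuous f} ->
  chart_dom a p (f z) -> \forall y \near z, chart_dom a p (f y) /\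
    chart_inv a p (chart a p (f y)) = f y.
Proof.
move=> cf pz.
have : \forall y \near z, chart_dom a p (f y) by apply: cf; exact: nbhs_dom.
by apply: filterS => y py; split => //; exact: chartK.
Qed.

Lemma msm_chart p H (f : H -> T) z : msm a f z -> chart_dom a p (f z) ->
  sm (fun y => chart a p (f y)) z.
Proof.
move=> [cf sf] pz.
have st := trans_sm (dom_self (f z)) pz.
have := sm_comp (g := fun u => chart a p (chart_inv a (f z) u)) fE sf st.
by apply: sm_ext; apply: filterS (near_chartK cf (dom_self _)) => y [_ ->].
Qed.

Lemma msm_of_chart p H (f : H -> T) z : {for z, continuous f} ->
  chart_dom a p (f z) -> sm (fun y => chart a p (f y)) z -> msm a f z.
Proof.
move=> cf pz sf; split => //.
have st := trans_sm pz (dom_self (f z)).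
have := sm_comp (g := fun u => chart a (f z) (chart_inv a p u)) fE sf st.
by apply: sm_ext; apply: filterS (near_chartK cf pz) => y [_ ->].
Qed.

Lemma msm_inv p H (f : H -> E) z : sm f z -> chart_image a p setT (f z) ->
  msm a (fun y => chart_inv a p (f y)) z.
Proof.
move=> sf iz.
have cf : {for z, continuous (fun y => chart_inv a p (f y))}.
  apply: (@continuous_comp _ _ _ f (chart_inv a p)); first exact: sm_continuous.
  exact: inv_cont.
apply: (@msm_of_chart p) => //; first exact: inv_dom.
apply: sm_ext (sf).
have : \forall y \near z, chart_image a p setT (f y).
  by apply: (sm_continuous sf); exact: nbhs_img.
by apply: filterS => y /chart_invK ->.
Qed.

Lemma msm_near H (f : H -> T) z : msm a f z -> \forall y \near z, msm a f y.
Proof.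
move=> [cf sf].
have [U [oU Uz UP]] :=
  nbhs_open (filterI (sm_near sf) (near_chartK cf (dom_self (f z)))).
apply: filterS (open_nbhs_nbhs (conj oU Uz)) => y Uy.
have [sy [py _]] := UP _ Uy.
apply: (@msm_of_chart (f z)) => //.
have c1 : {for y, continuous (fun x => chart_inv a (f z) (chart a (f z) (f x)))}.
  apply: (@continuous_comp _ _ _ (fun x => chart a (f z) (f x)) (chart_inv a (f z))).
    exact: sm_continuous.
  by apply: inv_cont; exact: img_chart.
have c2 : (fun x => chart_inv a (f z) (chart a (f z) (f x))) x @[x --> y] --> f y.
  by rewrite -[X in _ --> X](chartK py); exact: c1.
apply: cvg_trans c2; apply: near_eq_cvg.
apply: filterS (open_nbhs_nbhs (conj oU Uy)) => x Ux.
by have [_ [_ ->]] := UP _ Ux.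
Qed.

Lemma msm_ext H (f g : H -> T) z : (\near z, f z = g z) -> msm a f z -> msm a g z.
Proof.
move=> fg [cf sf]; have fgz : f z = g z by exact: nbhs_singleton fg.
split.
  suff : g @ z --> f z by rewrite fgz.
  by apply: cvg_trans cf; exact: near_eq_cvg.
rewrite -fgz; apply: sm_ext (sf).
by apply: filterS fg => y ->.
Qed.

Lemma msm_comp H H' (f : H' -> T) (g : H -> H') z : fin_dim H' ->
  sm g z -> msm a f (g z) -> msm a (fun y => f (g y)) z.
Proof.
move=> fH sg [cf sf]; split.
  by apply: (@continuous_comp _ _ _ g f) => //; exact: sm_continuous.
exact: (sm_comp fH sg sf).
Qed.

Lemma msm_cst H (x : T) (z : H) : msm a (fun=> x) z.
Proof. by split; [exact: cvg_cst|exact: sm_cst]. Qed.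

Lemma smooth_map_on_msm H (W : set H) (f : H -> T) z : open W -> W z ->
  smooth_map_on (model_atlas H) a W f -> msm a f z.
Proof.
move=> oW Wz [cf sf]; have cz := cf z Wz; split => //.
have ei : chart_image (model_atlas H) z (W `&` f @^-1` chart_dom a (f z)) =
    W `&` f @^-1` chart_dom a (f z).
  by rewrite /chart_image /= setIT image_id.
have := sf z (f z); rewrite ei => h.
have nz : \forall y \near z, (W `&` f @^-1` chart_dom a (f z)) y.
  apply: filterI; first exact: open_nbhs_nbhs.
  by apply: cz; apply: nbhs_dom; exact: dom_self.
have [U [oU Uz UP]] := nbhs_open nz.
apply: (sm_on oU Uz) => k.
exact: Ck_on_sub UP (h k).
Qed.

Lemma msm_smooth_map_on H (W : set H) (f : H -> T) : 
  (forall z, W z -> msm a f z) -> smooth_map_on (model_atlas H) a W f.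
Proof.
move=> h; split => [z /h []//|p q].
rewrite /chart_image /= setIT image_id; apply: sm_smooth_on => z [Wz qz].
by apply: msm_chart => //; exact: h.
Qed.

Lemma tv_to_chart p H (f : H -> T) z v : msm a f z -> chart_dom a p (f z) ->
  dir (fun y => chart a p (f y)) z v = to_chart a p (f z) (tv a f z v).
Proof.
move=> [cf sf] pz; have st := trans_sm (dom_self (f z)) pz.
rewrite /to_chart dirE /tv.
rewrite -(dir_comp (f := fun y => chart a (f z) (f y))
  (g := fun u => chart a p (chart_inv a (f z) u)) v
  sf st).
apply: dir_ext.
  by apply: filterS (near_chartK cf (dom_self _)) => y [_ ->].
exact: (sm_comp fE sf st).
Qed.

Lemma tv_of_chart p H (f : H -> T) z v : msm a f z -> chart_dom a p (f z) ->
  tv a f z v = of_chart a p (chart a p (f z)) (dir (fun y => chart a p (f y)) z v).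
Proof.
move=> mf pz; have [cf sf] := mf.
have st := trans_sm pz (dom_self (f z)); have sp := msm_chart mf pz.
rewrite /of_chart dirE /tv chartK //.
rewrite -(dir_comp (f := fun y => chart a p (f y))
  (g := fun u => chart a (f z) (chart_inv a p u)) v
  sp st).
apply: dir_ext.
  by apply: filterS (near_chartK cf pz) => y [_ ->].
exact: (sm_comp fE sp st).
Qed.

Lemma tv_comp H H' (f : H' -> T) (g : H -> H') z v : fin_dim H' ->
  sm g z -> msm a f (g z) -> tv a (fun y => f (g y)) z v = tv a f (g z) (dir g z v).
Proof.
move=> fH sg [cf sf]; rewrite /tv.
exact: (dir_comp (f := g) (g := fun u => chart a (f (g z)) (f u)) v
  sg sf).
Qed.

Lemma tv_ext H (f g : H -> T) z v : (\near z, f z = g z) -> msm a f z ->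
  tv a g z v = tv a f z v.
Proof.
move=> fg [cf sf]; have fgz : f z = g z by exact: nbhs_singleton fg.
rewrite /tv -fgz; apply: dir_ext => //.
by apply: filterS fg => y ->.
Qed.

(** Realizes w as the velocity at 0 of a smooth curve through x. *)
Definition chart_line (x : T) (w : E) (r : R) : T := chart_inv a x (chart a x x + r *: w).

Lemma chart_line0 x w : chart_line x w 0 = x.
Proof. by rewrite /chart_line scale0r addr0 chartK //; exact: dom_self. Qed.

Lemma chart_line_msm x w : msm a (chart_line x w) 0.
Proof.
apply: msm_inv; first exact: sm_line.
by rewrite scale0r addr0; apply: img_chart; exact: dom_self.
Qed.

Lemma chart_line_tv x w : tv a (chart_line x w) 0 1 = w.
Proof.
rewrite /tv chart_line0.
have sl := sm_line (chart a x x) w 0.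
have E0 : chart a x x + (0 : R) *: w = chart a x x by rewrite scale0r addr0.
rewrite -[RHS]scale1r -(dir_line (chart a x x) w 0 1).
apply: dir_ext => //.
have : \forall y \near (0 : R), chart_image a x setT (chart a x x + y *: w).
  apply: (sm_continuous sl); rewrite /= E0; apply: nbhs_img; apply: img_chart.
  exact: dom_self.
by apply: filterS => y iy; rewrite /chart_line chart_invK.
Qed.

Lemma of_chartK p x w : chart_dom a p x -> of_chart a p (chart a p x) (to_chart a p x w) = w.
Proof.
move=> px; have ml := chart_line_msm x w.
rewrite -{2}(chart_line_tv x w) (@tv_of_chart p) ?chart_line0 //.
by rewrite tv_to_chart ?chart_line0 // chart_line_tv.
Qed.

Lemma to_chartK p x w : chart_dom a p x -> to_chart a p x (of_chart a p (chart a p x) w) = w.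
Proof.
move=> px; set u := chart a p x.
have ip : chart_image a p setT u by exact: img_chart.
have sl : sm (fun r : R => u + r *: w) 0 by exact: sm_line.
have E0 : u + (0 : R) *: w = u by rewrite scale0r addr0.
pose c r := chart_inv a p (u + r *: w).
have mc : msm a c 0 by apply: msm_inv => //; rewrite E0.
have c0 : c 0 = x by rewrite /c E0 chartK.
have dc : dir (fun y => chart a p (c y)) 0 (1 : R) = w.
  rewrite -[RHS]scale1r -(dir_line u w 0 1).
  apply: dir_ext => //.
  have : \forall y \near (0 : R), chart_image a p setT (u + y *: w).
    by apply: (sm_continuous sl); rewrite /= E0; exact: nbhs_img.
  by apply: filterS => y iy; rewrite /c chart_invK.
have := @tv_of_chart p _ c 0 1 mc; rewrite c0 => /(_ px); rewrite dc => <-.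
by have := @tv_to_chart p _ c 0 1 mc; rewrite c0 => /(_ px) <-.
Qed.

Lemma of_chart_self x w : of_chart a x (chart a x x) w = w.
Proof.
have ml := chart_line_msm x w.
rewrite -[RHS](chart_line_tv x w) (@tv_of_chart x _ _ 0 _ ml); last first.
  by rewrite chart_line0; exact: dom_self.
rewrite chart_line0; congr of_chart.
by rewrite -[LHS](chart_line_tv x w) /tv chart_line0.
Qed.

Lemma to_chart_self x w : to_chart a x x w = w.
Proof. by rewrite -{1}(of_chart_self x w) to_chartK //; exact: dom_self. Qed.

Lemma of_chart_linear p u c w1 w2 :
  of_chart a p u (c *: w1 + w2) = c *: of_chart a p u w1 + of_chart a p u w2.
Proof. by rewrite /of_chart linearP. Qed.

Lemma to_chart_linear p u c w1 w2 :
  to_chart a p u (c *: w1 + w2) = c *: to_chart a p u w1 + to_chart a p u w2.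
Proof. by rewrite /to_chart linearP. Qed.

Lemma tangent_smooth_sm (F : normedModType R) (f : T -> E -> F) p u w :
  tangent_smooth a f -> chart_image a p setT u ->
  sm (fun z : E * E => f (chart_inv a p z.1) (of_chart a p z.1 z.2)) (u, w).
Proof.
move=> h iu; apply: sm_on (h p) => //.
have -> : [set z : E * E | chart_image a p setT z.1] = fst @^-1` (chart_image a p setT).
  by [].
by apply: open_comp; [move=> z _; exact: cvg_fst|exact: img_open].
Qed.

End Charts.

Lemma velocity_tv {R : realType} {E : normedModType R} {T : topologicalType}
  (a : atlas E T) (q : R -> T) t : velocity a q t = tv a q t 1.
Proof. by rewrite /velocity /tangent_map dirE. Qed.

(** * Products, maps between manifolds, group operations *)

Section ProductAtlas.
Context {R : realType} {E F : normedModType R} {S T : topologicalType}.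
Variables (a : atlas E S) (b : atlas F T).
Hypothesis ha : smooth_atlas a.
Hypothesis hb : smooth_atlas b.
Hypothesis fE : fin_dim E.
Hypothesis fF : fin_dim F.
Implicit Types H : normedModType R.
Local Notation ab := (prod_atlas a b).

Lemma open_prod (X Y : topologicalType) (A : set X) (B : set Y) :
  open A -> open B -> open (A `*` B).
Proof.
move=> oA oB; have -> : A `*` B = (fst @^-1` A) `&` (snd @^-1` B) by [].
by apply: openI; apply: open_comp => // z _; [exact: cvg_fst|exact: cvg_snd].
Qed.

Lemma chart_image_prod p :
  chart_image ab p setT = chart_image a p.1 setT `*` chart_image b p.2 setT.
Proof.
apply/seteqP; split => [_ [[x y] [_ [/= px py]] <-]|].
  by split; [exists x|exists y].
move=> [u v] [/= [x [_ px] <-] [y [_ py] <-]]; by exists (x, y).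
Qed.

Lemma smooth_atlas_prod : smooth_atlas ab.
Proof.
split => [p|p q].
  split.
  - by split; exact: dom_self.
  - by apply: open_prod; exact: dom_open.
  - by rewrite chart_image_prod; apply: open_prod; exact: img_open.
  - by move=> [x y] [/= px py]; rewrite !chartK.
  - split => [[x y] [/= px py]|].
      apply: cvg_pair.
        apply: (@cvg_comp _ _ _ (@fst S T) (chart a p.1) _ (nbhs x)); first exact: cvg_fst.
        exact: chart_cont.
      apply: (@cvg_comp _ _ _ (@snd S T) (chart b p.2) _ (nbhs y)); first exact: cvg_snd.
      exact: chart_cont.
    move=> [u v]; rewrite chart_image_prod => -[/= iu iv].
    apply: cvg_pair.
      apply: (@cvg_comp _ _ _ (@fst E F) (chart_inv a p.1) _ (nbhs u)); first exact: cvg_fst.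
      exact: inv_cont.
    apply: (@cvg_comp _ _ _ (@snd E F) (chart_inv b p.2) _ (nbhs v)); first exact: cvg_snd.
    exact: inv_cont.
apply: sm_smooth_on => _ [[x y] [[/= qx qy] [/= px py]] <-].
apply: sm_pair.
  apply: (sm_comp (f := fun u : E * F => u.1) (g := fun u => chart a q.1 (chart_inv a p.1 u))) => //.
    by apply: sm_fst; exact: sm_id.
  exact: trans_sm.
apply: (sm_comp (f := fun u : E * F => u.2) (g := fun u => chart b q.2 (chart_inv b p.2 u))) => //.
  by apply: sm_snd; exact: sm_id.
exact: trans_sm.
Qed.

Lemma msm_prod H (f : H -> S) (g : H -> T) z : msm a f z -> msm b g z ->
  msm ab (fun y => (f y, g y)) z.
Proof.
move=> [cf sf] [cg sg]; split; first exact: cvg_pair.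
exact: (sm_pair sf sg).
Qed.

Lemma msm_fst H (f : H -> S * T) z : msm ab f z -> msm a (fun y => (f y).1) z.
Proof.
move=> [cf sf]; split.
  by apply: (@continuous_comp _ _ _ f (@fst S T)) => //; exact: cvg_fst.
exact: (sm_fst sf).
Qed.

Lemma msm_snd H (f : H -> S * T) z : msm ab f z -> msm b (fun y => (f y).2) z.
Proof.
move=> [cf sf]; split.
  by apply: (@continuous_comp _ _ _ f (@snd S T)) => //; exact: cvg_snd.
exact: (sm_snd sf).
Qed.

Lemma tv_prod H (f : H -> S * T) z v : msm ab f z ->
  tv ab f z v = (tv a (fun y => (f y).1) z v, tv b (fun y => (f y).2) z v).
Proof.
move=> mf; have [_ s1] := msm_fst mf; have [_ s2] := msm_snd mf.
by rewrite /tv -dir_pair //.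
Qed.

Lemma of_chart_prod p u w : chart_image ab p setT u ->
  of_chart ab p u w = (of_chart a p.1 u.1 w.1, of_chart b p.2 u.2 w.2).
Proof.
rewrite chart_image_prod => -[iu iv].
have s1 : sm (fun y : E => chart a (chart_inv a p.1 u.1) (chart_inv a p.1 y)) u.1.
  rewrite -{2}(chart_invK ha iu); apply: trans_sm => //; first exact: inv_dom.
  exact: dom_self.
have s2 : sm (fun y : F => chart b (chart_inv b p.2 u.2) (chart_inv b p.2 y)) u.2.
  rewrite -{2}(chart_invK hb iv); apply: trans_sm => //; first exact: inv_dom.
  exact: dom_self.
have sf : sm (fun z : E * F => z.1) u by apply: sm_fst; exact: sm_id.
have ss : sm (fun z : E * F => z.2) u by apply: sm_snd; exact: sm_id.
have df : dir (fun z : E * F => z.1) u w = w.1.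
  by rewrite (dir_fst _ (sm_id u)) dir_id.
have ds : dir (fun z : E * F => z.2) u w = w.2.
  by rewrite (dir_snd _ (sm_id u)) dir_id.
rewrite /of_chart !dirE -df -ds.
rewrite -(dir_comp w sf s1).
rewrite -(dir_comp w ss s2).
rewrite -dir_pair //.
  exact: (sm_comp fE sf s1).
exact: (sm_comp fF ss s2).
Qed.

End ProductAtlas.

(** Smoothness at x of a map between manifolds, read in the charts at x and at its
    image. *)
Definition smap {R : realType} {E F : normedModType R} {S T : topologicalType}
    (a : atlas E S) (b : atlas F T) (h : S -> T) (x : S) : Prop :=
  {for x, continuous h} /\
  sm (fun u => chart b (h x) (h (chart_inv a x u))) (chart a x x).

Section ManifoldMaps.
Context {R : realType} {E F : normedModType R} {S T : topologicalType}.
Variables (a : atlas E S) (b : atlas F T).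
Hypothesis ha : smooth_atlas a.
Hypothesis hb : smooth_atlas b.
Hypothesis fE : fin_dim E.
Hypothesis fF : fin_dim F.
Implicit Types H : normedModType R.

Lemma smooth_map_on_smap (h : S -> T) x : smooth_map_on a b setT h -> smap a b h x.
Proof.
move=> [ch sh]; have cx := ch x Logic.I; split => //.
have := sh x (h x); rewrite setTI => hs.
have nx : \forall y \near x, (h @^-1` chart_dom b (h x)) y.
  by apply: cx; apply: nbhs_dom => //; exact: dom_self.
have [U [oU Ux UP]] := nbhs_open nx.
apply: (@sm_on _ _ _ (chart_image a x U)).
- exact: chart_image_open.
- by exists x => //; split => //; exact: dom_self.
- move=> k; apply: Ck_on_sub (hs k) => _ [y [Uy xy] <-].
  by exists y => //; split => //; exact: UP.
Qed.

Lemma smap_msm H (f : H -> S) (h : S -> T) z : msm a f z -> smap a b h (f z) ->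
  msm b (fun y => h (f y)) z.
Proof.
move=> [cf sf] [ch sh]; split.
  by apply: (@continuous_comp _ _ _ f h).
have := sm_comp (f := fun y => chart a (f z) (f y)) fE sf sh.
by apply: sm_ext; apply: filterS (near_chartK ha cf (dom_self ha _)) => y [_ ->].
Qed.

Lemma tangent_map_tv H (f : H -> S) (h : S -> T) z v : msm a f z -> smap a b h (f z) ->
  tangent_map a b h (f z) (tv a f z v) = tv b (fun y => h (f y)) z v.
Proof.
move=> [cf sf] [ch sh]; rewrite /tangent_map dirE /tv.
rewrite -(dir_comp (f := fun y => chart a (f z) (f y)) v sf sh).
apply/esym; apply: dir_ext; last exact: (sm_comp fE sf sh).
by apply: filterS (near_chartK ha cf (dom_self ha _)) => y [_ ->].
Qed.

(** Precomposition with the inverse chart at x turns smoothness of h into smoothness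
    of a map defined on a vector space. *)
Lemma msm_smap (h : S -> T) x :
  msm b (fun u => h (chart_inv a x u)) (chart a x x) -> smap a b h x.
Proof.
have xx := dom_self ha x.
move=> [ch sh]; split; last by move: sh; rewrite chartK.
have c1 : (fun y => h (chart_inv a x (chart a x y))) y @[y --> x] --> h x.
  rewrite -[X in _ --> h X](chartK ha xx).
  apply: (@continuous_comp _ _ _ (chart a x) (fun u => h (chart_inv a x u))) => //.
  exact: chart_cont.
apply: cvg_trans c1; apply: near_eq_cvg.
by apply: filterS (nbhs_dom ha xx) => y xy; rewrite chartK.
Qed.

End ManifoldMaps.

Section GroupMaps.
Context {R : realType} {d : nat} {G : topGroupType}.
Variable aG : atlas 'rV[R]_d G.
Hypothesis hG : lie_group aG.
Implicit Types H : normedModType R.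
Local Open Scope group_scope.

Lemma lie_atlas : smooth_atlas aG.
Proof. by have [[_ _ h1 h2] _ _] := hG. Qed.

Lemma msm_mul H (f g : H -> G) z : msm aG f z -> msm aG g z ->
  msm aG (fun y => f y * g y) z.
Proof.
move=> mf mg; have [_ hm _] := hG; have hA := lie_atlas.
have hAA := smooth_atlas_prod hA hA (fin_dim_rV _) (fin_dim_rV _).
have := smap_msm hAA (fin_dim_prod (fin_dim_rV _) (fin_dim_rV _)) (msm_prod mf mg)
  (smooth_map_on_smap hAA hA _ hm).
exact.
Qed.

Lemma msm_invg H (f : H -> G) z : msm aG f z -> msm aG (fun y => (f y)^-1) z.
Proof.
move=> mf; have [_ _ hi] := hG; have hA := lie_atlas.
have := smap_msm hA (fin_dim_rV _) mf (smooth_map_on_smap hA hA _ hi).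
exact.
Qed.

Lemma smap_mull (h k : G) : smap aG aG (fun z => h * z) k.
Proof.
have hA := lie_atlas; apply: (msm_smap hA).
apply: msm_mul; first exact: msm_cst.
apply: (msm_inv hA (fin_dim_rV _) (sm_id _)).
by apply: img_chart; exact: dom_self.
Qed.

Lemma left_triv_tv H (g : H -> G) z v : msm aG g z ->
  left_triv aG (g z) (tv aG g z v) = tv aG (fun y => (g z)^-1 * g y) z v.
Proof.
move=> mg; have hA := lie_atlas.
by apply: (tangent_map_tv hA (fin_dim_rV _)) => //; exact: smap_mull.
Qed.

End GroupMaps.

(** * Germs of products with a unit *)

(** The product of a Lie group, read in the chart at the unit, is such a map m. *)
Section LocalMultiplication.
Context {R : realType} {E : normedModType R}.
Variables (m : E * E -> E) (u0 : E).
Hypothesis fE : fin_dim E.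
Hypothesis sm_m : sm m (u0, u0).
Hypothesis m1 : \forall u \near u0, m (u, u0) = u.
Hypothesis m1' : \forall u \near u0, m (u0, u) = u.
Implicit Types H : normedModType R.

Let fEE : fin_dim (E * E)%type := fin_dim_prod fE fE.

(** The mixed second derivative of the product at the unit; its antisymmetrization
    is the Lie bracket. *)
Definition hess (xi eta : E) : E := dir (fun z => dir m z (0, eta)) (u0, u0) (xi, 0).

Lemma d_mul_l w : dir m (u0, u0) (w, 0) = w.
Proof.
rewrite dir_partial_l //.
rewrite -[RHS](dir_id u0); apply: dir_ext; last exact: sm_id.
by apply: filterS m1 => y ->.
Qed.

Lemma d_mul_r w : dir m (u0, u0) (0, w) = w.
Proof.
rewrite dir_partial_r //.
rewrite -[RHS](dir_id u0); apply: dir_ext; last exact: sm_id.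
by apply: filterS m1' => y ->.
Qed.

Lemma hessC xi eta : hess xi eta = dir (fun z => dir m z (xi, 0)) (u0, u0) (0, eta).
Proof. exact: dir_schwarz. Qed.

Lemma hess_ll c u v w : hess (c *: u + v) w = c *: hess u w + hess v w.
Proof.
have E1 : (c *: u + v, 0) = c *: (u, 0) + (v, 0) :> E * E.
  by congr (_, _); rewrite /= scaler0 addr0.
by rewrite /hess E1 dirP.
Qed.

Lemma hess_lr c u v w : hess w (c *: u + v) = c *: hess w u + hess w v.
Proof.
have E1 : (0, c *: u + v) = c *: (0, u) + (0, v) :> E * E.
  by congr (_, _); rewrite /= scaler0 addr0.
by rewrite !hessC E1 dirP.
Qed.

Lemma hess_dE xi eta : dir (fun u => dir m (u, u0) (0, eta)) u0 xi = hess xi eta.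
Proof.
have sp : sm (fun u : E => (u, u0)) u0 by apply: sm_pair; [exact: sm_id|exact: sm_cst].
have s1 : sm (fun z => dir m z (0, eta)) (u0, u0) by exact: sm_dir.
rewrite (dir_comp (f := fun u => (u, u0)) (g := fun z => dir m z (0, eta)) _ sp s1).
by rewrite (dir_pair_cstr _ _ (sm_id u0)) dir_id.
Qed.

Lemma sm_mul_partial eta : sm (fun u => dir m (u, u0) (0, eta)) u0.
Proof.
have sp : sm (fun u : E => (u, u0)) u0 by apply: sm_pair; [exact: sm_id|exact: sm_cst].
exact: (sm_comp (g := fun z => dir m z (0, eta)) fEE sp (sm_dir _ sm_m)).
Qed.

(** [sigma a] is the left trivialization of the derivative of K in the direction a.
    Differentiating the relation between K and [sigma] a second time expresses both
    orders of differentiation of K, which agree by symmetry. *)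
Lemma local_maurer_cartan H (K : H -> E) (sigma : H -> H -> E) (z v w : H) :
  sm K z -> K z = u0 -> (forall a, sm (sigma a) z) ->
  (forall a, \forall y \near z, dir K y a = dir m (K y, u0) (0, sigma a y)) ->
  dir (sigma v) z w - dir (sigma w) z v =
  hess (sigma v z) (sigma w z) - hess (sigma w z) (sigma v z).
Proof.
move=> sK Kz ss ns.
have dK a : dir K z a = sigma a z.
  by rewrite (nbhs_singleton (ns a)) Kz d_mul_r.
have sKu : sm (fun y => (K y, u0)) z by apply: sm_pair => //; exact: sm_cst.
have smK : sm m (K z, u0) by rewrite Kz.
have key a b : dir (fun y => dir K y a) z b = hess (sigma b z) (sigma a z) + dir (sigma a) z b.
  have sl : sm (fun y => (0 : E, sigma a y)) z by apply: sm_pair; [exact: sm_cst|exact: ss].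
  have sF : sm (fun y => dir m (K y, u0) (0, sigma a y)) z by exact: (sm_dirdir fEE smK sKu sl).
  have E1 : dir (fun y => dir K y a) z b = dir (fun y => dir m (K y, u0) (0, sigma a y)) z b.
    apply: dir_ext => //; apply: filterS (ns a) => y my.
    by rewrite my.
  rewrite E1 (dir_dir b fEE smK sKu sl) (dir_pair_cstr _ _ sK) (dir_pair_cstl _ _ (ss a)).
  by rewrite Kz d_mul_r dK.
have alg (X A Y B : E) : X + A = Y + B -> A - B = Y - X.
  by move=> h; apply/eqP; rewrite subr_eq addrAC -h [X + A]addrC addrK.
by have := dir_schwarz v w fE sK; rewrite !key => /alg.
Qed.

(** Here F (r, s) stands for the conjugate of c s by h r. The relation F * h = h * c
    is differentiated in s and then in r. *)
Lemma local_adjoint (F : R * R -> E) (h c : R -> E) :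
  sm F (0, 0) -> sm h 0 -> sm c 0 -> h 0 = u0 -> c 0 = u0 ->
  (\forall r \near (0 : R), [/\ F (r, 0) = u0, sm F (r, 0), sm m (h r, u0) & sm m (u0, h r)]) ->
  (forall s : R, F (0, s) = c s) ->
  (\forall p \near ((0, 0) : R * R), m (F p, h p.1) = m (h p.1, c p.2)) ->
  dir (fun r => dir F (r, 0) (0, 1)) (0 : R) 1 =
    hess (dir h 0 1) (dir c 0 1) - hess (dir c 0 1) (dir h 0 1).
Proof.
move=> sF sh sc h0 c0 nF F0 nm.
pose f r := dir F (r, 0) (0, 1).
have sr : sm (fun r : R => (r, 0 : R)) 0 by apply: sm_pair; [exact: sm_id|exact: sm_cst].
have fRR : fin_dim (R * R)%type by exact: fin_dim_prod.
have sf : sm f 0.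
  by apply: (sm_comp (f := fun r : R => (r, 0 : R)) (g := fun z => dir F z (0, 1))) => //; exact: sm_dir.
have f0 : f 0 = dir c 0 1.
  rewrite /f dir_partial_r //; congr (dir _ _ _).
  by apply/funext => s; rewrite F0.
have s1 : sm (fun r => (u0, h r)) 0 by apply: sm_pair => //; exact: sm_cst.
have s2 : sm (fun r => (h r, u0)) 0 by apply: sm_pair => //; exact: sm_cst.
have sf0 : sm (fun r => (f r, 0 : E)) 0 by apply: sm_pair => //; exact: sm_cst.
have sc0 : sm (fun r : R => (0 : E, dir c 0 1)) 0 by exact: sm_cst.
have sm1 : sm m (u0, h 0) by rewrite h0.
have sm2 : sm m (h 0, u0) by rewrite h0.
have nm1 : \forall r \near (0 : R), \forall p \near ((r, 0) : R * R), m (F p, h p.1) = m (h p.1, c p.2).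
  have [U [oU U0 UP]] := nbhs_open nm.
  have : \forall r \near (0 : R), U (r, 0).
    by apply: (sm_continuous sr); exact: open_nbhs_nbhs.
  apply: filterS => r Ur; apply: filterS (open_nbhs_nbhs (conj oU Ur)) => p; exact: UP.
have key : \forall r \near (0 : R), dir m (u0, h r) (f r, 0) = dir m (h r, u0) (0, dir c 0 1).
  apply: filterS (filterI nF (filterI nm1 (sm_near sh))) => r [[Fr sFr smr smr'] [nmr shr]].
  have p2 : sm (fun p : R * R => h p.1) (r, 0).
    by apply: (sm_comp (f := fun p : R * R => p.1) (g := h)) => //; apply: sm_fst; exact: sm_id.
  have e2 : dir (fun p : R * R => h p.1) (r, 0) (0, 1) = 0.
    rewrite (dir_comp (f := fun p : R * R => p.1) (g := h)) //; last by apply: sm_fst; exact: sm_id.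
    by rewrite (dir_fst _ (sm_id _)) dir_id dir0.
  have p3 : sm (fun p : R * R => c p.2) (r, 0).
    by apply: (sm_comp (f := fun p : R * R => p.2) (g := c)) => //; apply: sm_snd; exact: sm_id.
  have e3 : dir (fun p : R * R => c p.2) (r, 0) (0, 1) = dir c 0 1.
    rewrite (dir_comp (f := fun p : R * R => p.2) (g := c)) //; last by apply: sm_snd; exact: sm_id.
    by rewrite (dir_snd _ (sm_id _)) dir_id.
  have pl : sm (fun p : R * R => (F p, h p.1)) (r, 0) by exact: sm_pair.
  have pr : sm (fun p : R * R => (h p.1, c p.2)) (r, 0) by exact: sm_pair.
  have ml : sm m (F (r, 0), h (r, 0 : R).1) by rewrite Fr.
  have mr : sm m (h (r, 0 : R).1, c (r, 0 : R).2) by rewrite /= c0.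
  have El := dir_comp (f := fun p : R * R => (F p, h p.1)) (g := m) (0, 1) pl ml.
  have Er := dir_comp (f := fun p : R * R => (h p.1, c p.2)) (g := m) (0, 1) pr mr.
  rewrite dir_pair // e2 Fr /= in El.
  rewrite dir_pair // e2 e3 /= c0 in Er.
  rewrite /f -El -Er; apply: dir_ext; last exact: (sm_comp fEE pr mr).
  by apply: filterS nmr => p ->.
have sl : sm (fun r => dir m (u0, h r) (f r, 0)) 0 by exact: (sm_dirdir fEE sm1 s1 sf0).
have sR : sm (fun r => dir m (h r, u0) (0, dir c 0 1)) 0 by exact: (sm_dirdir fEE sm2 s2 sc0).
have E1 : dir (fun r => dir m (u0, h r) (f r, 0)) 0 (1 : R) =
    dir (fun r => dir m (h r, u0) (0, dir c 0 1)) 0 (1 : R).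
  by apply: dir_ext => //; apply: filterS key => r ->.
rewrite (dir_dir (1 : R) fEE sm1 s1 sf0) (dir_dir (1 : R) fEE sm2 s2 sc0) in E1.
rewrite (dir_pair_cstl _ _ sh) (dir_pair_cstr _ _ sf) (dir_pair_cstr _ _ sh) dir_cst dir0 addr0 in E1.
rewrite h0 d_mul_l f0 -hessC in E1.
by apply/esym/eqP; rewrite subr_eq addrC; apply/eqP/esym; exact: E1.
Qed.

End LocalMultiplication.

(** * Lie algebras of Lie groups *)

Section LieGroups.
Context {R : realType} {d : nat} {G : topGroupType}.
Variable aG : atlas 'rV[R]_d G.
Hypothesis hG : lie_group aG.
Implicit Types H : normedModType R.
Local Notation E := 'rV[R]_d.

Let hA := lie_atlas hG.
Let fE : fin_dim E := fin_dim_rV d.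
Let fEE : fin_dim (E * E)%type := fin_dim_prod fE fE.

Definition loc_mul (z : E * E) : E :=
  chart aG 1%g (chart_inv aG 1%g z.1 * chart_inv aG 1%g z.2)%g.

Local Notation m := loc_mul.
Local Notation u0 := (chart aG 1%g 1%g).
Local Notation hess := (hess m u0).

Lemma dom1 : chart_dom aG 1%g 1%g. Proof. exact: dom_self. Qed.

Lemma img1 : chart_image aG 1%g setT u0. Proof. exact/img_chart/dom1. Qed.

Lemma inv1 : chart_inv aG 1%g u0 = 1%g. Proof. by rewrite chartK //; exact: dom1. Qed.

Lemma sm_loc_mul u v : chart_image aG 1%g setT u -> chart_image aG 1%g setT v ->
  chart_dom aG 1%g (chart_inv aG 1%g u * chart_inv aG 1%g v)%g -> sm m (u, v).
Proof.
move=> iu iv uv; apply: (msm_chart hA fE) => //=.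
apply: (msm_mul hG).
  by apply: (msm_inv hA fE) => //; apply: sm_fst; exact: sm_id.
by apply: (msm_inv hA fE) => //; apply: sm_snd; exact: sm_id.
Qed.

Lemma sm_loc_mul_l u : chart_image aG 1%g setT u -> sm m (u, u0).
Proof.
move=> iu; apply: sm_loc_mul => //; first exact: img1.
by rewrite inv1 mulg1; exact: inv_dom.
Qed.

Lemma sm_loc_mul_r u : chart_image aG 1%g setT u -> sm m (u0, u).
Proof.
move=> iu; apply: sm_loc_mul => //; first exact: img1.
by rewrite inv1 mul1g; exact: inv_dom.
Qed.

Lemma sm_loc_mul1 : sm m (u0, u0).
Proof. exact/sm_loc_mul_l/img1. Qed.

Lemma loc_mul1 : \forall u \near u0, m (u, u0) = u.
Proof.
apply: filterS (nbhs_img hA img1) => y iy.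
by rewrite /m /= inv1 mulg1 chart_invK.
Qed.

Lemma loc_mul1' : \forall u \near u0, m (u0, u) = u.
Proof.
apply: filterS (nbhs_img hA img1) => y iy.
by rewrite /m /= inv1 mul1g chart_invK.
Qed.

(** Left translation by the element with coordinates u is [m (u, _)] in the chart.
    *)
Lemma left_fieldE xi u : chart_image aG 1%g setT u ->
  left_field aG xi u = dir m (u, u0) (0, xi).
Proof.
move=> iu; set g := chart_inv aG 1%g u.
have dg : chart_dom aG 1%g g by exact: inv_dom.
pose c := chart_line aG 1%g xi.
have mc : msm aG c 0 by exact: chart_line_msm.
have c0 : c 0 = 1%g by exact: chart_line0.
have h1 : tangent_map aG aG (fun z => g * z)%g 1%g xi = tv aG (fun r => g * c r)%g 0 (1 : R).
  have := tangent_map_tv hA fE (h := fun z => (g * z)%g) (1 : R) mc (smap_mull hG g (c 0)).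
  by rewrite (chart_line_tv hA 1%g xi) c0.
have mgc : msm aG (fun r => g * c r)%g 0.
  by apply: msm_mul => //; exact: msm_cst.
have gc0 : (g * c 0)%g = g by rewrite c0 mulg1.
rewrite /left_field -/g h1.
have := @tv_to_chart _ _ _ aG hA fE 1%g _ (fun r => g * c r)%g 0 (1 : R) mgc.
rewrite gc0 => /(_ dg) <-.
have sl : sm (fun r : R => (u, u0 + r *: xi)) 0.
  by apply: sm_pair; [exact: sm_cst|exact: sm_line].
have E0 : (u, u0 + (0 : R) *: xi) = (u, u0) by rewrite scale0r addr0.
have sml : sm m (u, u0 + (0 : R) *: xi) by rewrite E0; exact: sm_loc_mul_l.
have Ed : dir (fun r : R => (u, u0 + r *: xi)) 0 (1 : R) = (0, xi).
  by rewrite (dir_pair_cstl u _ (sm_line u0 xi 0)) dir_line scale1r.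
have Ec := dir_comp (f := fun r : R => (u, u0 + r *: xi)) (g := m) (1 : R) sl sml.
by rewrite Ed E0 in Ec; exact: Ec.
Qed.

Lemma d_left_field xi eta :
  'D_(left_field aG xi u0) (left_field aG eta) u0 = hess xi eta.
Proof.
have lx : left_field aG xi u0 = xi.
  by rewrite left_fieldE ?(d_mul_r sm_loc_mul1 loc_mul1') //; exact: img1.
have s2 := sm_mul_partial fE sm_loc_mul1 eta.
have ne : \forall u \near u0, dir m (u, u0) (0, eta) = left_field aG eta u.
  by apply: filterS (nbhs_img hA img1) => y iy; rewrite left_fieldE.
have s3 : sm (left_field aG eta) u0 by exact: sm_ext ne s2.
by rewrite lx D_dir // (dir_ext _ ne s2) (hess_dE sm_loc_mul1).
Qed.

Lemma lie_bracketE xi eta : lie_bracket aG xi eta = hess xi eta - hess eta xi.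
Proof. by rewrite /lie_bracket !d_left_field. Qed.

Lemma lie_bracket_linear w c u v :
  lie_bracket aG (c *: u + v) w = c *: lie_bracket aG u w + lie_bracket aG v w.
Proof.
rewrite !lie_bracketE hess_ll (hess_lr fE sm_loc_mul1).
by rewrite scalerBr opprD addrACA.
Qed.

Lemma lie_bracketC u v : lie_bracket aG u v = - lie_bracket aG v u.
Proof. by rewrite !lie_bracketE opprB. Qed.

Lemma lie_bracketBl w u v :
  lie_bracket aG (u - v) w = lie_bracket aG u w - lie_bracket aG v w.
Proof. by rewrite addrC -scaleN1r lie_bracket_linear scaleN1r addrC. Qed.

Lemma lie_bracketBr w u v :
  lie_bracket aG w (u - v) = lie_bracket aG w u - lie_bracket aG w v.
Proof.
rewrite lie_bracketC lie_bracketBl opprB.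
by rewrite (lie_bracketC w u) (lie_bracketC w v) opprK addrC.
Qed.

(** Pull-back of the left Maurer-Cartan form by k, evaluated in the direction v. *)
Definition ltv H (k : H -> G) (v y : H) : E := left_triv aG (k y) (tv aG k y v).

Lemma ltvE H (k : H -> G) v y : msm aG k y ->
  ltv k v y = dir (fun y' => chart aG 1%g ((k y)^-1 * k y')%g) y v.
Proof.
move=> mk; rewrite /ltv (left_triv_tv hG v mk).
have e1 : ((k y)^-1 * k y = 1)%g by exact: mulVg.
by rewrite /tv e1.
Qed.

(** The left trivialization of the derivative of k at y is the second partial
    derivative of this map at (y, y), hence depends smoothly on y. *)
Definition loc_div H (k : H -> G) (y : H * H) : E :=
  chart aG 1%g ((k y.1)^-1 * k y.2)%g.

Lemma msm_fst_arg H H' (k : H -> G) (z : H * H') : fin_dim H -> msm aG k z.1 ->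
  msm aG (fun y : H * H' => k y.1) z.
Proof.
move=> fH mk; refine (msm_comp (f := k) (g := fun y : H * H' => y.1) fH _ mk).
by apply: sm_fst; exact: sm_id.
Qed.

Lemma msm_snd_arg H H' (k : H' -> G) (z : H * H') : fin_dim H' -> msm aG k z.2 ->
  msm aG (fun y : H * H' => k y.2) z.
Proof.
move=> fH mk; refine (msm_comp (f := k) (g := fun y : H * H' => y.2) fH _ mk).
by apply: sm_snd; exact: sm_id.
Qed.

Lemma sm_loc_div H (k : H -> G) z : fin_dim H -> msm aG k z -> sm (loc_div k) (z, z).
Proof.
move=> fH mk; apply: (msm_chart hA fE); last by rewrite /= mulVg; exact: dom1.
apply: (msm_mul hG); last exact: msm_snd_arg.
by apply: (msm_invg hG); exact: msm_fst_arg.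
Qed.

Lemma ltv_loc_div H (k : H -> G) v y : fin_dim H -> msm aG k y ->
  ltv k v y = dir (loc_div k) (y, y) (0, v).
Proof.
by move=> fH mk; rewrite (ltvE v mk) (dir_partial_r _ (sm_loc_div fH mk)).
Qed.

Lemma sm_diag H (z : H) : sm (fun y : H => (y, y)) z.
Proof. by apply: sm_pair; exact: sm_id. Qed.

Lemma sm_ltv H (k : H -> G) v z : fin_dim H -> msm aG k z -> sm (ltv k v) z.
Proof.
move=> fH mk.
have s1 : sm (fun y => dir (loc_div k) (y, y) (0, v)) z.
  refine (sm_comp (f := fun y : H => (y, y)) (g := fun p => dir (loc_div k) p (0, v))
    (fin_dim_prod fH fH) (sm_diag z) _).
  by apply: sm_dir; exact: sm_loc_div.
apply: sm_ext s1; apply: filterS (msm_near hA fE mk) => y my.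
by rewrite (ltv_loc_div v fH my).
Qed.

Lemma ltv_mull H (k : H -> G) (h : G) v z : msm aG k z ->
  ltv (fun y => h * k y)%g v z = ltv k v z.
Proof.
move=> mk; have mh : msm aG (fun y => h * k y)%g z.
  exact: (msm_mul hG (msm_cst aG h z) mk).
rewrite (ltvE v mh) (ltvE v mk).
have Ef : (fun y' => chart aG 1%g ((h * k z)^-1 * (h * k y'))%g) =
    (fun y' => chart aG 1%g ((k z)^-1 * k y')%g).
  by apply/funext => y; congr chart; rewrite invgM -mulgA mulKg.
by rewrite Ef.
Qed.

Lemma near_dom1 H (k : H -> G) z : msm aG k z -> k z = 1%g ->
  \forall y \near z, chart_dom aG 1%g (k y).
Proof. by move=> [ck _] k1; apply: ck; apply: (nbhs_dom hA); rewrite k1; exact: dom1. Qed.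

(** Differentiate k = k z * ((k z)^-1 * k) at z in the chart at 1. *)
Lemma d_chart_ltv H (k : H -> G) v z : msm aG k z -> chart_dom aG 1%g (k z) ->
  dir (fun y => chart aG 1%g (k y)) z v = dir m (chart aG 1%g (k z), u0) (0, ltv k v z).
Proof.
move=> mk kz; have iz := img_chart kz.
pose D y := chart aG 1%g ((k z)^-1 * k y)%g.
have m2 : msm aG (fun y => (k z)^-1 * k y)%g z.
  by apply: (msm_mul hG) => //; exact: msm_cst.
have sD : sm D z by apply: (msm_chart hA fE) => //; rewrite mulVg; exact: dom1.
have Dz : D z = u0 by rewrite /D mulVg.
have sp : sm (fun y => (chart aG 1%g (k z), D y)) z by apply: sm_pair => //; exact: sm_cst.
have sm2 : sm m (chart aG 1%g (k z), D z) by rewrite Dz; exact: sm_loc_mul_l.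
have E1 := dir_comp (f := fun y => (chart aG 1%g (k z), D y)) (g := m) v sp sm2.
rewrite (dir_pair_cstl _ _ sD) Dz in E1.
rewrite (ltvE v mk); apply: etrans _ E1; apply: dir_ext; last exact: (sm_comp fEE sp sm2).
have nD : \forall y \near z, chart_dom aG 1%g ((k z)^-1 * k y)%g.
  by apply: (near_dom1 m2); rewrite mulVg.
by apply: filterS nD => y Dy; rewrite /m /D /= !(chartK hA) // mulVKg.
Qed.

(** Left translation by (k z)^-1 brings k z to the unit without changing the left
    trivializations, and the formula for germs of products applies there. *)
Lemma maurer_cartan H (k : H -> G) v w z : fin_dim H -> msm aG k z ->
  dir (ltv k v) z w - dir (ltv k w) z v = lie_bracket aG (ltv k v z) (ltv k w z).
Proof.
move=> fH mk; pose k' y := ((k z)^-1 * k y)%g.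
have mk' : msm aG k' z by apply: (msm_mul hG) => //; exact: msm_cst.
have k1 : k' z = 1%g by exact: mulVg.
have Ez a : ltv k' a z = ltv k a z by exact: ltv_mull.
have En a : \forall y \near z, ltv k a y = ltv k' a y.
  by apply: filterS (msm_near hA fE mk) => y my; rewrite [RHS]ltv_mull.
rewrite -!Ez -(dir_ext w (En v)); last exact: sm_ltv.
rewrite -(dir_ext v (En w)); last exact: sm_ltv.
rewrite lie_bracketE.
apply: (local_maurer_cartan (K := fun y => chart aG 1%g (k' y)) fE sm_loc_mul1 loc_mul1').
- by apply: (msm_chart hA fE) => //; rewrite k1; exact: dom1.
- by rewrite k1.
- by move=> a; exact: sm_ltv.
- move=> a; apply: filterS (filterI (msm_near hA fE mk') (near_dom1 mk' k1)) => y [my dy].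
  exact: d_chart_ltv.
Qed.

(** Only the germ of the curve at 0 matters. *)
Lemma lie_subP (B : set G) xi : lie_sub aG B xi <-> exists c : R -> G,
  [/\ msm aG c 0, \forall t \near (0 : R), B (c t), c 0 = 1%g & tv aG c 0 1 = xi].
Proof.
split => [[U [c [oU U0 sc Bc [c0 vc]]]]|[c [mc Bc c0 vc]]].
  exists c; split => //; first exact: (smooth_map_on_msm hA oU U0 sc).
    by apply: filterS (open_nbhs_nbhs (conj oU U0)).
  by rewrite -vc velocity_tv.
have [U [oU U0 UP]] := nbhs_open (filterI Bc (msm_near hA fE mc)).
exists U, c; split => //.
- by apply: (msm_smooth_map_on hA fE) => z /UP [].
- by move=> t /UP [].
- by split => //; rewrite velocity_tv.
Qed.

Lemma lie_sub_T xi : lie_sub aG setT xi.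
Proof.
apply/lie_subP; exists (chart_line aG 1%g xi); split.
- exact: (chart_line_msm hA fE).
- exact: (@filterE _ (nbhs (0 : R)) _ _ (fun t => I)).
- exact: (chart_line0 hA).
- exact: (chart_line_tv hA).
Qed.

(** A curve in the trivial group is constant. *)
Lemma lie_sub_1 xi : lie_sub aG [set 1%g] xi -> xi = 0.
Proof.
move=> /lie_subP [c [mc Bc c0 <-]]; rewrite /tv.
rewrite -(dir_cst (chart aG (c 0) 1%g) (0 : R) (1 : R)); apply: dir_ext; last exact: sm_cst.
by apply: filterS Bc => r ->.
Qed.

Lemma lie_sub_mono (A B : set G) xi : A `<=` B -> lie_sub aG A xi -> lie_sub aG B xi.
Proof.
move=> AB /lie_subP [c [mc Bc c0 vc]]; apply/lie_subP; exists c; split => //.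
by apply: filterS Bc => t; exact: AB.
Qed.

Lemma tv_mul1 (c e : R -> G) : msm aG c 0 -> msm aG e 0 -> c 0 = 1%g -> e 0 = 1%g ->
  tv aG (fun r => c r * e r)%g 0 1 = tv aG c 0 1 + tv aG e 0 1.
Proof.
move=> mc me c0 e0; rewrite /tv c0 e0 mulg1.
pose C r := chart aG 1%g (c r); pose F r := chart aG 1%g (e r).
have sC : sm C 0 by apply: (msm_chart hA fE) => //; rewrite c0; exact: dom1.
have sF : sm F 0 by apply: (msm_chart hA fE) => //; rewrite e0; exact: dom1.
have sp : sm (fun r => (C r, F r)) 0 by exact: sm_pair.
have sm0 : sm m (C 0, F 0) by rewrite /C /F c0 e0; exact: sm_loc_mul1.
have E1 := dir_comp (f := fun r => (C r, F r)) (g := m) (1 : R) sp sm0.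
have E2 : (dir C 0 1, dir F 0 1) = (dir C 0 1, 0) + (0, dir F 0 1) :> E * E.
  by congr (_, _); rewrite /= ?addr0 ?add0r.
rewrite (dir_pair _ sC sF) E2 dirDv /C /F c0 e0 in E1.
rewrite (d_mul_l sm_loc_mul1 loc_mul1) (d_mul_r sm_loc_mul1 loc_mul1') in E1.
rewrite -E1; apply: dir_ext; last exact: (sm_comp fEE sp sm0).
apply: filterS (filterI (near_dom1 mc c0) (near_dom1 me e0)) => r [dc de].
by rewrite /m /C /F /= !(chartK hA).
Qed.

(** For curves c and e in B with velocities u and v, the curve r |-> c (a r) * e r
    has velocity a u + v. *)
Lemma lie_sub_subspace (B : set G) : B 1%g -> (forall h k, B h -> B k -> B (h * k)%g) ->
  lin_subspace (lie_sub aG B).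
Proof.
move=> B1 BM; split.
  apply/lie_subP; exists (fun=> 1%g); split => //; first exact: msm_cst.
    exact: (@filterE _ (nbhs (0 : R)) _ _ (fun t => B1)).
  by rewrite /tv dir_cst.
move=> a u v /lie_subP [c [mc Bc c0 vc]] /lie_subP [e [me Be e0 ve]].
have sa (r : R) : sm (fun r : R => r * a) r by apply: smM; [exact: sm_id|exact: sm_cst].
have fR : fin_dim R by exact: fin_dim_R.
have sa0 : (0 : R) * a = 0 by rewrite mul0r.
have mca : msm aG (fun r : R => c (r * a)) 0.
  by apply: (msm_comp (f := c) fR (sa 0)); rewrite sa0.
have ca0 : c ((0 : R) * a) = 1%g by rewrite sa0.
apply/lie_subP; exists (fun r : R => c (r * a)%R * e r)%g; split.
- exact: (msm_mul hG).
- have Bca : \forall r \near (0 : R), B (c (r * a)).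
    by have h := sm_cvg (sa 0); rewrite sa0 in h; exact: (h _ Bc).
  by apply: filterS (filterI Bca Be) => r [h1 h2]; exact: BM.
- by rewrite ca0 e0 mulg1.
- rewrite tv_mul1 // ve; congr (_ + _).
  have := tv_comp (a := aG) (f := c) (g := fun r : R => r * a) (1 : R) fR (sa 0).
  rewrite sa0 => /(_ mc) ->.
  rewrite dirM; [|exact: sm_id|exact: sm_cst].
  rewrite dir_id dir_cst mul1r mul0r addr0 -vc /tv -dirZv.
  by congr (dir _ _ _); rewrite /GRing.scale /= mulr1.
Qed.

(** The bracket is the derivative at r = 0 of Ad (h r) zeta, where h is a curve in A
    with velocity xi. Each Ad (h r) zeta is the velocity of a conjugate of a curve
    in B, and the derivative of a curve in the subspace [lie_sub B] stays in this
    subspace. *)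
Lemma lie_sub_ideal (A B : set G) xi zeta :
  B 1%g -> (forall h k, B h -> B k -> B (h * k)%g) ->
  (forall h k, A h -> B k -> B (h * k * h^-1)%g) ->
  lie_sub aG A xi -> lie_sub aG B zeta -> lie_sub aG B (lie_bracket aG xi zeta).
Proof.
move=> B1 BM AB /lie_subP [h [mh Ah h0 vh]] /lie_subP [c [mc Bc c0 vc]].
have fR : fin_dim R by exact: fin_dim_R.
pose P (p : R * R) := (h p.1 * c p.2 * (h p.1)^-1)%g.
have mP (r : R) : msm aG h r -> msm aG P (r, 0).
  move=> mhr; apply: (msm_mul hG).
    by apply: (msm_mul hG); [exact: msm_fst_arg|exact: msm_snd_arg].
  by apply: (msm_invg hG); exact: msm_fst_arg.
have P1 r : P (r, 0) = 1%g by rewrite /P /= c0 mulg1 mulgV.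
pose F p := chart aG 1%g (P p).
have sF (r : R) : msm aG h r -> sm F (r, 0).
  by move=> /mP mPr; apply: (msm_chart hA fE) => //; rewrite P1; exact: dom1.
pose K r := chart aG 1%g (h r); pose C r := chart aG 1%g (c r).
have sK : sm K 0 by apply: (msm_chart hA fE) => //; rewrite h0; exact: dom1.
have sC : sm C 0 by apply: (msm_chart hA fE) => //; rewrite c0; exact: dom1.
have dK : dir K 0 1 = xi by rewrite -vh /tv h0.
have dC : dir C 0 1 = zeta by rewrite -vc /tv c0.
have key : dir (fun r => dir F (r, 0) (0, 1)) (0 : R) 1 = lie_bracket aG xi zeta.
  rewrite lie_bracketE -dK -dC.
  apply: (local_adjoint (F := F) (h := K) (c := C) fE sm_loc_mul1 loc_mul1) => //.
  - exact: sF.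
  - by rewrite /K h0.
  - by rewrite /C c0.
  - apply: filterS (filterI (msm_near hA fE mh) (near_dom1 mh h0)) => r [mhr dhr].
    split; [by rewrite /F P1|exact: sF|exact/sm_loc_mul_l/img_chart|exact/sm_loc_mul_r/img_chart].
  - by move=> s; rewrite /F /P /= h0 mul1g invg1 mulg1.
  - have mP0 := mP 0 mh.
    have nP := near_dom1 mP0 (P1 0).
    have nh : \forall p \near ((0, 0) : R * R), chart_dom aG 1%g (h p.1).
      by apply: (near_dom1 (k := fun p : R * R => h p.1)) => //; exact: msm_fst_arg.
    have nc : \forall p \near ((0, 0) : R * R), chart_dom aG 1%g (c p.2).
      by apply: (near_dom1 (k := fun p : R * R => c p.2)) => //; exact: msm_snd_arg.
    apply: filterS (filterI nP (filterI nh nc)) => p [dP [dh dc]].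
    by rewrite /m /F /K /C /= !(chartK hA) // /P mulgVK.
rewrite -key; pose f r := dir F (r, 0) (0, 1).
have sr : sm (fun r : R => (r, 0 : R)) 0 by apply: sm_pair; [exact: sm_id|exact: sm_cst].
have sf : sm f 0.
  apply: (sm_comp (f := fun r : R => (r, 0 : R)) (g := fun z => dir F z (0, 1))) => //.
    exact: fin_dim_prod.
  by apply: sm_dir; exact: sF.
apply: (subspace_derivative (f := f) (lie_sub_subspace B1 BM) sf).
apply: filterS (filterI (msm_near hA fE mh) Ah) => r [mhr Ahr].
apply/lie_subP; exists (fun s => P (r, s)).
have ss : sm (fun s : R => (r, s)) 0 by apply: sm_pair; [exact: sm_cst|exact: sm_id].
have fRR : fin_dim (R * R)%type by exact: fin_dim_prod.
split.
- exact: (msm_comp (f := P) fRR ss (mP _ mhr)).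
- by apply: filterS Bc => s Bs; exact: AB.
- exact: P1.
- rewrite (tv_comp (f := P) (1 : R) fRR ss (mP _ mhr)).
  by rewrite (dir_pair_cstl _ _ (sm_id _)) dir_id /tv P1.
Qed.

End LieGroups.

(** * The first variation in reduced variables *)

Lemma dir_linear_map {R : realType} {E F : normedModType R} (f : E -> F) x v :
  (forall c u w, f (c *: u + w) = c *: f u + f w) -> sm f x -> dir f x v = f v.
Proof.
move=> fl sf.
have E0 : x + (0 : R) *: v = x by rewrite scale0r addr0.
have sfl : sm f (x + (0 : R) *: v) by rewrite E0.
have := dir_comp (f := fun r : R => x + r *: v) (1 : R) (sm_line x v 0) sfl.
rewrite dir_line scale1r E0 => <-.
have -> : (fun r : R => f (x + r *: v)) = (fun r : R => f x + r *: f v).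
  by apply/funext => r; rewrite addrC fl addrC.
by rewrite dir_line scale1r.
Qed.

Section ReducedVariation.
Context {R : realType} {m d : nat} {X : topologicalType} {G : topGroupType}.
Variables (aX : atlas 'rV[R]_m X) (aG : atlas 'rV[R]_d G).
Local Notation EX := 'rV[R]_m.
Local Notation E := 'rV[R]_d.
Local Notation aQ := (prod_atlas aX aG).
Variables (L : X * G -> EX * E -> R) (A : X * G -> EX * E -> E).
Variable l : X -> EX -> E -> R.
Hypothesis hX : smooth_atlas aX.
Hypothesis hG : lie_group aG.
Hypothesis sL : tangent_smooth aQ L.
Hypothesis sA : tangent_smooth aQ A.
Hypothesis A_lin : forall q c w1 w2, A q (c *: w1 + w2) = c *: A q w1 + A q w2.
Local Notation Aloc x w := (A (x, 1%g) (w, 0)).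
Hypothesis l_def : forall x g dx dg,
  l x dx (Aloc x dx + left_triv aG g dg) = L (x, g) (dx, dg).

Let hA := lie_atlas hG.
Let fX : fin_dim EX := fin_dim_rV m.
Let fE : fin_dim E := fin_dim_rV d.
Let hQ : smooth_atlas aQ := smooth_atlas_prod hX hA fX fE.
Let fXX : fin_dim (EX * EX)%type := fin_dim_prod fX fX.
Let fT : fin_dim (EX * E)%type := fin_dim_prod fX fE.
Let fP : fin_dim (EX * EX * E)%type := fin_dim_prod fXX fE.
Implicit Types H : normedModType R.

Lemma left_triv1 w : left_triv aG 1%g w = w.
Proof.
have ml := chart_line_msm hA fE 1%g w.
have := left_triv_tv hG (1 : R) ml.
rewrite (chart_line0 hA) (chart_line_tv hA) => ->.
rewrite -[RHS](chart_line_tv hA 1%g w); congr (tv _ _ _ _).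
by apply/funext => r; rewrite invg1 mul1g.
Qed.

(** Expresses the reduced Lagrangian by L at the unit of the group; its smoothness
    follows. *)
Lemma l_at1 x w xi : l x w xi = L (x, 1%g) (w, xi - Aloc x w).
Proof. by rewrite -l_def left_triv1 addrC subrK. Qed.

Lemma Aloc_lin x c w1 w2 : Aloc x (c *: w1 + w2) = c *: Aloc x w1 + Aloc x w2.
Proof. by rewrite -A_lin; congr (A _ (_, _)); rewrite /= scaler0 addr0. Qed.

Lemma of_chart_at1 p y w xi : chart_image aX p setT y ->
  of_chart aQ (p, 1%g) (y, chart aG 1%g 1%g) (w, xi) = (of_chart aX p y w, xi).
Proof.
move=> iy; rewrite (of_chart_prod hX hA fX fE); last first.
  by rewrite chart_image_prod; split => //; exact: img1.
by rewrite /= (of_chart_self hA fE).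
Qed.

(** The one-form A(x) in the chart of X at p. *)
Definition Ap p (z : EX * EX) : E := Aloc (chart_inv aX p z.1) (of_chart aX p z.1 z.2).

Lemma near_img_fst H (p : X) (y : EX) (w : H) : chart_image aX p setT y ->
  \forall z \near (y, w), chart_image aX p setT z.1.
Proof.
by move=> iy; exact: (sm_cvg (sm_fst (sm_id (y, w))) (nbhs_img hX iy)).
Qed.

Lemma sm_chart_TQ (F : normedModType R) (f : X * G -> EX * E -> F) p y w xi :
  tangent_smooth aQ f -> chart_image aX p setT y ->
  sm (fun z : EX * (EX * E) => f (chart_inv aX p z.1, 1%g) (of_chart aX p z.1 z.2.1, z.2.2))
    (y, (w, xi)).
Proof.
move=> sf iy; pose u0 := chart aG 1%g 1%g.
have iQ : chart_image aQ (p, 1%g) setT (y, u0).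
  by rewrite chart_image_prod; split => //; exact: img1.
have s1 := tangent_smooth_sm hQ (w, xi) sf iQ.
pose j (z : EX * (EX * E)) := ((z.1, u0), z.2).
have sj : sm j (y, (w, xi)).
  apply: sm_pair; last by apply: sm_snd; exact: sm_id.
  by apply: sm_pair; [apply: sm_fst; exact: sm_id|exact: sm_cst].
have := sm_comp (fin_dim_prod fT fT) sj s1.
apply: sm_ext; apply: filterS (near_img_fst (w, xi) iy) => -[y' [w' xi']] iy'.
by rewrite /j /= of_chart_at1 // (inv1 hG).
Qed.

Lemma sm_Ap p y w : chart_image aX p setT y -> sm (Ap p) (y, w).
Proof.
move=> iy; pose j (z : EX * EX) : EX * (EX * E) := (z.1, (z.2, 0)).
have sj : sm j (y, w).
  apply: sm_pair; first by apply: sm_fst; exact: sm_id.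
  by apply: sm_pair; [apply: sm_snd; exact: sm_id|exact: sm_cst].
exact: (sm_comp (fin_dim_prod fX fT) sj (sm_chart_TQ w 0 sA iy)).
Qed.

(** The reduced Lagrangian in the chart of X at p. *)
Definition ell p (z : EX * EX * E) : R :=
  l (chart_inv aX p z.1.1) (of_chart aX p z.1.1 z.1.2) z.2.

Lemma sm_ell p y w xi : chart_image aX p setT y -> sm (ell p) ((y, w), xi).
Proof.
move=> iy.
pose j (z : EX * EX * E) : EX * (EX * E) := (z.1.1, (z.1.2, z.2 - Ap p z.1)).
have s1 : sm (fun z : EX * EX * E => z.1) ((y, w), xi) by apply: sm_fst; exact: sm_id.
have s2 : sm (fun z : EX * EX * E => z.2) ((y, w), xi) by apply: sm_snd; exact: sm_id.
have sj : sm j ((y, w), xi).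
  apply: sm_pair; first exact: sm_fst.
  apply: sm_pair; first exact: sm_snd.
  apply: smB => //; exact: (sm_comp fXX s1 (sm_Ap w iy)).
have := sm_comp (fin_dim_prod fX fT) sj (sm_chart_TQ w (xi - Ap p (y, w)) sL iy).
suff -> : ell p = fun z => L (chart_inv aX p (j z).1, 1%g)
    (of_chart aX p (j z).1 (j z).2.1, (j z).2.2) by [].
by apply/funext => z; rewrite /j /= /ell l_at1.
Qed.

(** The vertical part A(x) dx + g^-1 dg of the derivative of Q in the direction v.
    *)
Definition vert H (Q : H -> X * G) (v z : H) : E :=
  Aloc (Q z).1 (tv aX (fun y => (Q y).1) z v) + ltv aG (fun y => (Q y).2) v z.

Section AlongMap.
Context {H : normedModType R}.
Hypothesis fH : fin_dim H.
Variables (Q : H -> X * G) (z : H).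
Hypothesis mQ : msm aQ Q z.
Local Notation x := (fun y => (Q y).1).
Local Notation k := (fun y => (Q y).2).

Let mx : msm aX x z := msm_fst mQ.
Let mk : msm aG k z := msm_snd mQ.

Lemma near_msm_x p : chart_dom aX p (x z) ->
  \forall y \near z, msm aX x y /\ chart_dom aX p (x y).
Proof.
move=> pz; apply: filterS (filterI (msm_near hX fX mx) (near_chartK hX mx.1 pz)) => y.
by move=> [? []].
Qed.

Lemma near_Ap p v : chart_dom aX p (x z) ->
  \forall y \near z, Ap p (chart aX p (x y), dir (fun y => chart aX p (x y)) y v) =
    Aloc (x y) (tv aX x y v).
Proof.
move=> pz; apply: filterS (near_msm_x pz) => y [my py].
by rewrite /Ap /= (chartK hX py) -(tv_of_chart hX fX).
Qed.

Lemma sm_chart_tv p v : chart_dom aX p (x z) ->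
  sm (fun y => (chart aX p (x y), dir (fun y => chart aX p (x y)) y v)) z.
Proof.
move=> pz; have sX := msm_chart hX fX mx pz.
by apply: sm_pair => //; exact: sm_dir.
Qed.

Lemma sm_Aloc v : sm (fun y => Aloc (x y) (tv aX x y v)) z.
Proof.
have pz := dom_self hX (x z).
have := sm_comp fXX (sm_chart_tv v pz) (sm_Ap _ (img_chart pz)).
by apply: sm_ext; exact: near_Ap.
Qed.

Lemma sm_vert v : sm (vert Q v) z.
Proof. by apply: smD; [exact: sm_Aloc|exact: sm_ltv]. Qed.

(** In the chart at x z, the second derivatives of the map cancel by symmetry and
    the derivatives of the coefficients of the one-form remain. *)
Lemma Aloc_ext_deriv v w :
  dir (fun y => Aloc (x y) (tv aX x y v)) z w - dir (fun y => Aloc (x y) (tv aX x y w)) z v =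
  ext_deriv aX (fun x w => Aloc x w) (x z) (tv aX x z w) (tv aX x z v).
Proof.
set p := x z; have pz : chart_dom aX p (x z) by exact: dom_self.
pose Xc y := chart aX p (x y).
have sX : sm Xc z := msm_chart hX fX mx pz.
have iz : chart_image aX p setT (Xc z) by exact: img_chart.
have half a b : dir (fun y => Aloc (x y) (tv aX x y a)) z b =
    dir (fun y => Ap p (y, dir Xc z a)) (Xc z) (dir Xc z b) +
    Ap p (Xc z, dir (fun y => dir Xc y a) z b).
  have sp := sm_chart_tv a pz; have sAp := sm_Ap (dir Xc z a) iz.
  have E1 : dir (fun y => Aloc (x y) (tv aX x y a)) z b =
      dir (fun y => Ap p (Xc y, dir Xc y a)) z b.
    by apply: dir_ext (near_Ap a pz) _; exact: (sm_comp fXX sp sAp).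
  rewrite E1 (dir_comp b sp sAp) (dir_pair _ sX (sm_dir a sX)) (dir_partial _ _ sAp).
  congr (_ + _); apply: dir_linear_map.
    by move=> c u u'; rewrite /Ap /= of_chart_linear Aloc_lin.
  apply: (sm_comp (f := fun w : EX => (Xc z, w)) fXX _ sAp).
  by apply: sm_pair; [exact: sm_cst|exact: sm_id].
have sh (a : EX) : sm (fun y => Ap p (y, a)) (Xc z).
  apply: (sm_comp (f := fun y : EX => (y, a)) fXX _ (sm_Ap a iz)).
  by apply: sm_pair; [exact: sm_id|exact: sm_cst].
rewrite !half (dir_schwarz v w fX sX) opprD addrACA subrr addr0.
rewrite /ext_deriv.
rewrite -/p -[tv aX x z w]/(dir Xc z w) -[tv aX x z v]/(dir Xc z v).
by rewrite -[chart aX p p]/(Xc z) !D_dir //; exact: sh.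
Qed.

(** The first summand of the vertical part contributes the exterior derivative of A,
    the second one the Maurer-Cartan equation. *)
Lemma vert_commutator v w :
  let Av := Aloc (x z) (tv aX x z v) in let Aw := Aloc (x z) (tv aX x z w) in
  dir (vert Q v) z w - dir (vert Q w) z v =
  ext_deriv aX (fun x w => Aloc x w) (x z) (tv aX x z w) (tv aX x z v) +
  lie_bracket aG (vert Q v z - Av) (vert Q w z - Aw).
Proof.
move=> Av Aw.
rewrite /vert !dirD; [|exact: sm_Aloc|exact: sm_ltv|exact: sm_Aloc|exact: sm_ltv].
rewrite opprD addrACA Aloc_ext_deriv (maurer_cartan hG _ _ fH mk).
by rewrite -/Av -/Aw ![_ + ltv _ _ _ _]addrC !addrK.
Qed.

(** The arguments (x, dx, v) of the reduced Lagrangian along the direction v, in the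
    chart of X at p. *)
Definition phase p v (y : H) : EX * EX * E :=
  ((chart aX p (x y), dir (fun y => chart aX p (x y)) y v), vert Q v y).

Definition lag v (y : H) : R := L (Q y) (tv aQ Q y v).

(** The derivative of the reduced Lagrangian with respect to its last two arguments,
    paired with the derivative of Q in the direction w: the boundary term of the
    integration by parts. *)
Definition momentum v w (y : H) : R :=
  dir (fun u => l (x y) u (vert Q v y)) (tv aX x y v) (tv aX x y w) +
  dir (fun xi => l (x y) (tv aX x y v) xi) (vert Q v y) (vert Q w y).

Lemma sm_phase p v : chart_dom aX p (x z) -> sm (phase p v) z.
Proof. by move=> pz; apply: sm_pair; [exact: sm_chart_tv|exact: sm_vert]. Qed.

Lemma sm_ell_phase p v : chart_dom aX p (x z) -> sm (ell p) (phase p v z).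
Proof. by move=> pz; apply: sm_ell; exact: img_chart. Qed.

Lemma lag_ell p v : chart_dom aX p (x z) -> lag v z = ell p (phase p v z).
Proof.
move=> pz; rewrite /lag /ell /phase /= (chartK hX pz) -(tv_of_chart hX fX v mx pz).
rewrite (tv_prod _ mQ) /vert /ltv.
have -> : Q z = ((Q z).1, (Q z).2) by case: (Q z).
by rewrite /= l_def.
Qed.

Lemma momentum_ell p v w : chart_dom aX p (x z) ->
  momentum v w z = dir (ell p) (phase p v z)
    ((0, dir (fun y => chart aX p (x y)) z w), vert Q w z).
Proof.
move=> pz; set b := dir _ z w.
pose Xc y := chart aX p (x y).
have E1 : ((0, b), vert Q w z) = ((0, b), 0) + ((0, 0), vert Q w z) :> EX * EX * E.
  by congr ((_, _), _); rewrite /= ?addr0 ?add0r.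
have se := sm_ell_phase v pz.
have st : sm (fun u : EX => of_chart aX p (Xc z) u) (dir Xc z v).
  have sx : sm (fun y => chart aX (chart_inv aX p (Xc z)) (chart_inv aX p y)) (Xc z).
    rewrite /Xc (chartK hX pz); apply: (trans_sm hX pz); exact: dom_self.
  have := sm_dirdir (u := fun=> Xc z) (w := fun u => u) fX sx (sm_cst (Xc z) (dir Xc z v))
    (sm_id (dir Xc z v)).
  by rewrite dir.unlock.
have dt u u' : sm (fun u : EX => of_chart aX p (Xc z) u) u ->
    dir (fun u : EX => of_chart aX p (Xc z) u) u u' = of_chart aX p (Xc z) u'.
  by apply: dir_linear_map => c u1 u2; exact: of_chart_linear.
have zz := dom_self hX (x z).
have sl : sm (fun u => l (x z) u (vert Q v z)) (tv aX x z v).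
  have s0 := sm_ell (tv aX x z v) (vert Q v z) (img_chart zz).
  pose j (u : EX) := ((chart aX (x z) (x z), u), vert Q v z).
  have sj : sm j (tv aX x z v).
    by apply: sm_pair; [apply: sm_pair; [exact: sm_cst|exact: sm_id]|exact: sm_cst].
  have := sm_comp fP sj s0; suff -> : (fun u => l (x z) u (vert Q v z)) = fun u => ell (x z) (j u) by [].
  by apply/funext => u; rewrite /ell /j /= (chartK hX zz) (of_chart_self hX fX).
have ev : of_chart aX p (Xc z) (dir Xc z v) = tv aX x z v.
  by rewrite (tv_of_chart hX fX v mx pz).
have ew : of_chart aX p (Xc z) b = tv aX x z w.
  by rewrite (tv_of_chart hX fX w mx pz).
rewrite E1 dirDv /momentum; congr (_ + _).
  rewrite (dir_partial_l _ se) /=.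
  have sp : sm (fun u : EX * EX => ell p (u, vert Q v z)) (Xc z, dir Xc z v).
    have sj : sm (fun u : EX * EX => (u, vert Q v z)) (Xc z, dir Xc z v).
      by apply: sm_pair; [exact: sm_id|exact: sm_cst].
    exact: (sm_comp fP sj se).
  rewrite (dir_partial_r _ sp) /ell /= (chartK hX pz) -/(Xc z) -ev -ew.
  rewrite -ev in sl.
  by rewrite (dir_comp _ st sl) (dt _ _ st).
rewrite (dir_partial_r _ se) /ell /=.
by rewrite (chartK hX pz) -/(Xc z) ev.
Qed.

End AlongMap.

Section FirstVariation.
Context {H : normedModType R}.
Hypothesis fH : fin_dim H.
Variables (Q : H -> X * G) (z : H).
Hypothesis mQ : msm aQ Q z.
Local Notation x := (fun y => (Q y).1).
Local Notation k := (fun y => (Q y).2).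

Let mx : msm aX x z := msm_fst mQ.

Lemma near_msmQ p : chart_dom aX p (x z) ->
  \forall y \near z, msm aQ Q y /\ chart_dom aX p (x y).
Proof.
move=> pz; apply: filterS (filterI (msm_near hQ fT mQ) (near_chartK hX mx.1 pz)) => y.
by move=> [? []].
Qed.

Lemma sm_lag v : sm (lag Q v) z.
Proof.
have pz := dom_self hX (x z).
have := sm_comp fP (sm_phase fH mQ v pz) (sm_ell_phase (Q := Q) v pz).
apply: sm_ext; apply: filterS (near_msmQ pz) => y [my py].
by rewrite (lag_ell my v py).
Qed.

Lemma sm_variation_vector p w : chart_dom aX p (x z) ->
  sm (fun y => ((0 : EX, dir (fun y => chart aX p (x y)) y w), vert Q w y)) z.
Proof.
move=> pz; apply: sm_pair; last exact: sm_vert.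
by apply: sm_pair; [exact: sm_cst|exact: sm_dir (msm_chart hX fX mx pz)].
Qed.

Lemma sm_momentum v w : sm (momentum Q v w) z.
Proof.
have pz := dom_self hX (x z).
have := sm_dirdir fP (sm_ell_phase (Q := Q) v pz) (sm_phase fH mQ v pz) (sm_variation_vector w pz).
apply: sm_ext; apply: filterS (near_msmQ pz) => y [my py].
by rewrite (momentum_ell my v w py).
Qed.

(** The chain rule for the Lagrangian in the direction w and the product rule for
    the momentum in the direction v share the terms with a derivative of dx. Their
    difference leaves the variation of x, the commutator of the vertical parts, and
    the derivative of the momenta against frozen variations. *)
Lemma first_variation p v w : chart_dom aX p (x z) ->
  let Xc y := chart aX p (x y) in
  dir (lag Q v) z w - dir (momentum Q v w) z v =
  dir (ell p) (phase Q p v z) ((dir Xc z w, 0), dir (vert Q v) z w - dir (vert Q w) z v)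
  - dir (fun y => dir (ell p) (phase Q p v y) ((0, dir Xc z w), vert Q w z)) z v.
Proof.
move=> pz Xc.
have sX : sm Xc z := msm_chart hX fX mx pz.
have se := sm_ell_phase (Q := Q) v pz; have sp := sm_phase fH mQ v pz.
have sc := sm_variation_vector w pz.
have s1 := sm_comp fP sp se.
have s2 := sm_dirdir fP se sp sc.
rewrite (dir_ext (f := fun y => ell p (phase Q p v y)) w _ s1); last first.
  by apply: filterS (near_msmQ pz) => y [my py]; rewrite (lag_ell my v py).
rewrite (dir_ext v _ s2); last first.
  by apply: filterS (near_msmQ pz) => y [my py]; rewrite (momentum_ell my v w py).
rewrite (dir_comp w sp se) (dir_dir v fP se sp sc).
rewrite (dir_comp (g := fun u => dir (ell p) u ((0, dir Xc z w), vert Q w z)) v sp (sm_dir _ se)).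
rewrite opprD addrA addrAC; congr (_ - _).
have sv u : sm (vert Q u) z by exact: sm_vert.
have sXv u : sm (fun y => dir Xc y u) z by exact: sm_dir.
rewrite (dir_pair _ (sm_pair sX (sXv v)) (sv v)) (dir_pair _ sX (sXv v)).
rewrite (dir_pair _ (sm_pair (sm_cst (0 : EX) z) (sXv w)) (sv w)) (dir_pair _ (sm_cst _ _) (sXv w)) dir_cst.
rewrite -dirBv; congr (dir _ _ _).
rewrite (dir_schwarz w v fX sX).
by congr ((_, _), _); rewrite /= ?subr0 ?subrr.
Qed.

End FirstVariation.

Definition fiber_derivative H (Q : H -> X * G) v z (kappa : E) : R :=
  dir (fun xi => l (Q z).1 (tv aX (fun y => (Q y).1) z v) xi) (vert Q v z) kappa.

Lemma fiber_derivative_ell H (Q : H -> X * G) v z p kappa : msm aQ Q z ->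
  chart_dom aX p (Q z).1 ->
  fiber_derivative Q v z kappa = dir (ell p) (phase Q p v z) ((0, 0), kappa).
Proof.
move=> mQ pz; have se := sm_ell_phase (Q := Q) v pz.
rewrite (dir_partial_r _ se) /ell /fiber_derivative /= (chartK hX pz).
by rewrite -(tv_of_chart hX fX v (msm_fst mQ) pz).
Qed.

Lemma near_ext_fst H (Q Q' : H -> X * G) (z : H) : (\forall y \near z, Q y = Q' y) ->
  \forall y \near z, (Q y).1 = (Q' y).1.
Proof. by apply: filterS => y ->. Qed.

Lemma vert_ext H (Q Q' : H -> X * G) (v z : H) : (\forall y \near z, Q y = Q' y) -> msm aQ Q z ->
  vert Q' v z = vert Q v z.
Proof.
move=> QQ' mQ; rewrite /vert /ltv -(nbhs_singleton QQ').
rewrite (tv_ext (f := fun y => (Q y).1) _ _ (msm_fst mQ)); last by apply: filterS QQ' => y ->.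
by rewrite (tv_ext (f := fun y => (Q y).2) _ _ (msm_snd mQ)) //; apply: filterS QQ' => y ->.
Qed.

Lemma vert_comp H H' (Q : H' -> X * G) (g : H -> H') v z : fin_dim H' ->
  sm g z -> msm aQ Q (g z) -> vert (fun y => Q (g y)) v z = vert Q (dir g z v) (g z).
Proof.
move=> fH' sg mQ; rewrite /vert /ltv.
rewrite (tv_comp (a := aX) (f := fun y => (Q y).1) v fH' sg (msm_fst mQ)).
by rewrite (tv_comp (a := aG) (f := fun y => (Q y).2) v fH' sg (msm_snd mQ)).
Qed.

Definition curvature x w1 w2 : E :=
  ext_deriv aX (fun x w => Aloc x w) x w1 w2 - lie_bracket aG (Aloc x w1) (Aloc x w2).

Section AlongCurve.
Variable q : R -> X * G.
Local Notation x := (fun r => (q r).1).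
Local Notation Xc p := (fun r => chart aX p (x r)).
Local Notation dXc p r := (dir (Xc p) r 1).
Local Notation dx r := (tv aX x r 1).
Local Notation v r := (vert q 1 r).
Local Notation M r := (fiber_derivative q 1 r).

Definition dl_dx p r a : R := dir (fun y => ell p ((y, dXc p r), v r)) (Xc p r) a.
Definition dl_ddx p r a : R := dir (fun y => ell p ((Xc p r, y), v r)) (dXc p r) a.

(** The reduced equations are the vanishing of [vertical_eq t nu] for nu in S_x and
    of [horizontal_eq p t delta] for all delta. *)
Definition vertical_eq t nu : R :=
  M t (lie_bracket aG (v t) nu - lie_bracket aG (Aloc (x t) (dx t)) nu)
  - dir (fun r => M r nu) t 1.

Definition horizontal_eq p t delta : R :=
  let a := to_chart aX p (x t) delta in
  dl_dx p t a - dir (fun r => dl_ddx p r a) t 1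
  - M t (curvature (x t) (dx t) delta - lie_bracket aG (Aloc (x t) delta) (v t)).

Lemma dl_dx_ell p t a : chart_dom aX p (x t) ->
  dl_dx p t a = dir (ell p) (phase q p 1 t) ((a, 0), 0).
Proof.
move=> pt; have se := sm_ell_phase (Q := q) (1 : R) pt.
have sp : sm (fun u : EX * EX => ell p (u, v t)) (Xc p t, dXc p t).
  apply: (sm_comp (f := fun u : EX * EX => (u, v t)) fP _ se).
  by apply: sm_pair; [exact: sm_id|exact: sm_cst].
by rewrite (dir_partial_l _ se) (dir_partial_l _ sp).
Qed.

Lemma dl_ddx_ell p t a : chart_dom aX p (x t) ->
  dl_ddx p t a = dir (ell p) (phase q p 1 t) ((0, a), 0).
Proof.
move=> pt; have se := sm_ell_phase (Q := q) (1 : R) pt.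
have sp : sm (fun u : EX * EX => ell p (u, v t)) (Xc p t, dXc p t).
  apply: (sm_comp (f := fun u : EX * EX => (u, v t)) fP _ se).
  by apply: sm_pair; [exact: sm_id|exact: sm_cst].
by rewrite (dir_partial_l _ se) (dir_partial_r _ sp).
Qed.

Let fR : fin_dim R := fin_dim_R.

Lemma sm_ell_phase_curve p t c : msm aQ q t -> chart_dom aX p (x t) ->
  sm (fun r => dir (ell p) (phase q p 1 r) c) t.
Proof.
move=> mq pt.
exact: (sm_comp fP (sm_phase fR mq (1 : R) pt) (sm_dir c (sm_ell_phase (Q := q) (1 : R) pt))).
Qed.

Lemma sm_fiber_derivative t nu : msm aQ q t -> sm (fun r => M r nu) t.
Proof.
move=> mq; have pt := dom_self hX (x t).
apply: sm_ext (sm_ell_phase_curve ((0, 0), nu) mq pt).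
by apply: filterS (near_msmQ mq pt) => r [mr pr]; rewrite (fiber_derivative_ell _ _ mr pr).
Qed.

Lemma sm_dl_ddx p t a : msm aQ q t -> chart_dom aX p (x t) -> sm (fun r => dl_ddx p r a) t.
Proof.
move=> mq pt.
apply: sm_ext (sm_ell_phase_curve ((0, a), 0) mq pt).
by apply: filterS (near_msmQ mq pt) => r [mr pr]; rewrite dl_ddx_ell.
Qed.

(** The commutator of the vertical parts in [first_variation] is replaced by the
    value given by [vert_commutator]. Its terms, linear in the variation of x and in
    the vertical variation, are then sorted accordingly. *)
Lemma curve_variation (Q : R * R -> X * G) p t :
  msm aQ Q (t, 0) -> (\forall r \near t, Q (r, 0) = q r) -> chart_dom aX p (x t) ->
  dir (lag Q (1, 0)) (t, 0) (0, 1) - dir (momentum Q (1, 0) (0, 1)) (t, 0) (1, 0) =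
  horizontal_eq p t (tv aX (fun y => (Q y).1) (t, 0) (0, 1)) +
  vertical_eq t (vert Q (0, 1) (t, 0)).
Proof.
move=> mQ Qq pt.
have fRR : fin_dim (R * R)%type by exact: fin_dim_prod.
pose j (r : R) : R * R := (r, 0).
have sj r : sm j r by apply: sm_pair; [exact: sm_id|exact: sm_cst].
have dj r : dir j r 1 = (1, 0) by rewrite (dir_pair_cstr _ _ (sm_id _)) dir_id.
have mQj : msm aQ (fun r => Q (j r)) t by exact: (msm_comp fRR (sj t) mQ).
have mq : msm aQ q t by exact: msm_ext Qq mQj.
have qt : q t = Q (t, 0) by rewrite (nbhs_singleton Qq).
have pQ : chart_dom aX p (Q (t, 0)).1 by rewrite -qt.
have tv_eq (r : R) : (\forall r' \near r, Q (r', 0) = q r') -> msm aQ Q (r, 0) ->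
    [/\ tv aX (fun y => (Q y).1) (r, 0) (1, 0) = dx r & vert Q (1, 0) (r, 0) = v r].
  move=> nr mr; have mjr : msm aQ (fun r => Q (j r)) r by exact: (msm_comp fRR (sj r) mr).
  split; last by rewrite (vert_ext (1 : R) nr mjr) (vert_comp (1 : R) fRR (sj r) mr) dj.
  rewrite (tv_ext (a := aX) (f := fun y => (Q (j y)).1) _ (near_ext_fst nr) (msm_fst mjr)).
  by rewrite (tv_comp (a := aX) (f := fun y => (Q y).1) (1 : R) fRR (sj r) (msm_fst mr)) dj.
have nn : \forall r \near t, (\forall r' \near r, Q (r', 0) = q r') /\ msm aQ Q (r, 0).
  have [U [oU Ut UP]] := nbhs_open Qq.
  have nm : \forall r \near t, msm aQ Q (j r).
    exact: (sm_cvg (sj t) (msm_near hQ fT mQ)).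
  apply: filterS (filterI (open_nbhs_nbhs (conj oU Ut)) nm) => r [Ur mr]; split => //.
  by apply: filterS (open_nbhs_nbhs (conj oU Ur)) => y; exact: UP.
have phase_eq (r : R) : (\forall r' \near r, Q (r', 0) = q r') -> msm aQ Q (r, 0) ->
    chart_dom aX p (q r).1 -> phase Q p (1, 0) (r, 0) = phase q p 1 r.
  move=> nr mr pr; have [e1 e2] := tv_eq _ nr mr.
  have mjr : msm aQ (fun r => Q (j r)) r by exact: (msm_comp fRR (sj r) mr).
  have qr : q r = Q (r, 0) by rewrite (nbhs_singleton nr).
  have pr' : chart_dom aX p (Q (r, 0)).1 by rewrite -qr.
  rewrite /phase e2 -qr; congr ((_, _), _).
  rewrite (tv_to_chart hX fX ((1, 0) : R * R) (msm_fst mr) pr').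
  by rewrite (tv_to_chart hX fX (1 : R) (msm_fst (msm_ext nr mjr)) pr) e1 qr.
have [nt mt] := nbhs_singleton nn; have [tvt vt] := tv_eq _ nt mt.
have pht := phase_eq _ nt mt pt.
have := first_variation fRR mQ ((1, 0) : R * R) ((0, 1) : R * R) pQ; rewrite /= => ->.
set a := dir (fun y => chart aX p (Q y).1) (t, 0) (0, 1); set nu := vert Q (0, 1) (t, 0).
set delta := tv aX (fun y => (Q y).1) (t, 0) (0, 1).
have ae : a = to_chart aX p (x t) delta.
  by rewrite /a (tv_to_chart hX fX ((0, 1) : R * R) (msm_fst mQ) pQ) qt.
have sQ : sm (fun y => dir (ell p) (phase Q p (1, 0) y) ((0, a), nu)) (t, 0).
  exact: (sm_comp fP (sm_phase fRR mQ _ pQ) (sm_dir _ (sm_ell_phase (Q := Q) _ pQ))).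
have -> : dir (fun y => dir (ell p) (phase Q p (1, 0) y) ((0, a), nu)) (t, 0) (1, 0) =
    dir (fun r => dl_ddx p r a + M r nu) t 1.
  have E2 := dir_comp (f := j) (1 : R) (sj t) sQ.
  rewrite dj in E2; rewrite -[LHS]E2.
  apply: dir_ext; last by apply: smD; [exact: sm_dl_ddx|exact: sm_fiber_derivative].
  apply: filterS (filterI nn (near_msmQ mq pt)) => r [[nr mr] [mqr pr]].
  rewrite /j (phase_eq _ nr mr pr) dl_ddx_ell // (fiber_derivative_ell _ _ mqr pr) -dirDv.
  by congr (dir _ _ _); congr ((_, _), _); rewrite /= ?addr0 ?add0r.
rewrite (dirD (1 : R) (sm_dl_ddx a mq pt) (sm_fiber_derivative nu mq)).
rewrite (vert_commutator fRR mQ) pht vt tvt -/nu -/delta -qt.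
set Ax := Aloc (x t) (dx t); set Ad := Aloc (x t) delta.
have alg1 (e b1 b2 b3 b4 : E) : - e + (b1 - - b2 - (b3 - b4)) = (b1 - b3) - (e - b4 - b2).
  by apply/rowP => i; rewrite !mxE; ring.
have alg2 (x1 x2 x3 x4 x5 : R) : x1 + (x2 - x3) - (x4 + x5) = x1 - x4 - x3 + (x2 - x5).
  by ring.
have E1 (kappa : E) : ((a, 0), kappa) = ((a, 0), 0) + ((0, 0), kappa) :> EX * EX * E.
  by congr ((_, _), _); rewrite /= ?addr0 ?add0r.
rewrite E1 dirDv -dl_dx_ell // -(fiber_derivative_ell _ _ mq pt).
rewrite /horizontal_eq /vertical_eq -ae -/Ax -/Ad.
rewrite (lie_bracketBl hG) !(lie_bracketBr hG) (lie_bracketC hG _ Ad).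
have -> : ext_deriv aX (fun x w => Aloc x w) (x t) delta (dx t) =
    - ext_deriv aX (fun x w => Aloc x w) (x t) (dx t) delta by rewrite opprB.
rewrite /curvature -/Ax -/Ad.
set e := ext_deriv _ _ _ _ _; set b1 := lie_bracket aG _ nu.
set b2 := lie_bracket aG Ad _; set b3 := lie_bracket aG Ax nu; set b4 := lie_bracket aG Ax Ad.
have MB k1 k2 : M t (k1 - k2) = M t k1 - M t k2.
  by rewrite /fiber_derivative dirBv.
by rewrite alg1 MB alg2.
Qed.

End AlongCurve.
End ReducedVariation.

(** * The distribution at the unit of the group *)

Section Action.
Context {R : realType} {m d : nat} {X : topologicalType} {G : topGroupType}.
Variables (aX : atlas 'rV[R]_m X) (aG : atlas 'rV[R]_d G).
Local Notation EX := 'rV[R]_m.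
Local Notation E := 'rV[R]_d.
Local Notation aQ := (prod_atlas aX aG).
Variables (A : X * G -> EX * E -> E) (D : X * G -> set (EX * E)).
Hypothesis hX : smooth_atlas aX.
Hypothesis hG : lie_group aG.
Hypothesis sD : smooth_distribution aQ D.
Hypothesis iD : invariant_distribution aX aG D.
Hypothesis A_lin : forall q c w1 w2, A q (c *: w1 + w2) = c *: A q w1 + A q w2.
Hypothesis A_gen : forall xi q, A q (generator aX aG xi q) = xi.
Hypothesis A_ker : forall q w, A q w = 0 -> D q w.
Local Notation Aloc x w := (A (x, 1%g) (w, 0)).

Let hA := lie_atlas hG.
Let fX : fin_dim EX := fin_dim_rV m.
Let fE : fin_dim E := fin_dim_rV d.
Let fT : fin_dim (EX * E)%type := fin_dim_prod fX fE.
Let hQ : smooth_atlas aQ := smooth_atlas_prod hX hA fX fE.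

Lemma dist_linear q c w1 w2 : D q w1 -> D q w2 -> D q (c *: w1 + w2).
Proof.
have [U [r [Y [oU Uq _ /(_ q Uq) [_ ->]]]]] := sD q.
move=> [c1 ->] [c2 ->]; exists (fun i => c * c1 i + c2 i).
by rewrite scaler_sumr -big_split /=; apply: eq_bigr => i _; rewrite scalerDl scalerA.
Qed.

Lemma dist0 q : D q 0.
Proof.
have [U [r [Y [oU Uq _ /(_ q Uq) [_ ->]]]]] := sD q.
by exists (fun=> 0); rewrite big1 // => i _; rewrite scale0r.
Qed.

Lemma smap_act h q : smap aQ aQ (act h) q.
Proof.
apply: (msm_smap hQ).
have iq : chart_image aQ q setT (chart aQ q q) by apply: img_chart; exact: (dom_self hQ).
have mi := msm_inv hQ fT (sm_id (chart aQ q q)) iq.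
apply: msm_prod; first exact: (msm_fst mi).
by apply: (msm_mul hG); [exact: msm_cst|exact: (msm_snd mi)].
Qed.

Lemma act_tangentE h x g w1 w2 :
  act_tangent aX aG h (x, g) (w1, w2) =
  (w1, tangent_map aG aG (fun z => h * z)%g g w2).
Proof.
pose c (r : R) := (chart_line aX x w1 r, chart_line aG g w2 r).
have mx := chart_line_msm hX fX x w1; have mg := chart_line_msm hA fE g w2.
have mc : msm aQ c 0 by exact: msm_prod.
have c0 : c 0 = (x, g) by rewrite /c (chart_line0 hX) (chart_line0 hA).
have tc : tv aQ c 0 1 = (w1, w2).
  by rewrite (tv_prod _ mc) (chart_line_tv hX) (chart_line_tv hA).
have T1 := tangent_map_tv hQ fT (h := act h) (1 : R) mc (smap_act h (c 0)).
rewrite c0 tc in T1; rewrite /act_tangent T1.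
have mac : msm aQ (fun r => act h (c r)) 0 by exact: (smap_msm hQ fT mc (smap_act h (c 0))).
rewrite (tv_prod _ mac) /=.
have T2 := tangent_map_tv hA fE (h := fun z => (h * z)%g) (1 : R) mg
  (smap_mull hG h (chart_line aG g w2 0)).
rewrite (chart_line_tv hA) (chart_line0 hA) in T2.
by rewrite (chart_line_tv hX) T2.
Qed.

Lemma generatorE xi x : generator aX aG xi (x, 1%g) = (0, xi).
Proof.
have mg := chart_line_msm hA fE 1%g xi.
have sg : smap aG aQ (fun h => act h (x, 1%g)) 1%g.
  apply: (msm_smap hA); apply: msm_prod; first exact: msm_cst.
  apply: (msm_mul hG); last exact: msm_cst.
  by apply: (msm_inv hA fE (sm_id _)); exact: img1.
have g0 := chart_line0 hA 1%g xi.
have sg' : smap aG aQ (fun h => act h (x, 1%g)) (chart_line aG 1%g xi 0) by rewrite g0.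
have T1 := tangent_map_tv hA fE (1 : R) mg sg'.
rewrite (chart_line_tv hA) g0 in T1; rewrite /generator T1.
have mac := smap_msm hA fE mg sg'.
rewrite (tv_prod _ mac) /=; congr (_, _).
  by rewrite /tv dir_cst.
rewrite -[RHS](chart_line_tv hA 1%g xi); congr (tv _ _ _ _).
by apply/funext => r; rewrite mulg1.
Qed.

(** A tangent vector (0, xi) at (x, 1) is the value there of the generator of xi. *)
Lemma A_vertical x xi : A (x, 1%g) (0, xi) = xi.
Proof. by rewrite -{1}(generatorE xi x) A_gen. Qed.

(** Translation by g^-1 maps D at (x, g) onto D at (x, 1). *)
Lemma dist_at1 x g w1 w2 : D (x, g) (w1, w2) <-> D (x, 1%g) (w1, left_triv aG g w2).
Proof.
have := iD g^-1%g (x, g) (w1, w2); rewrite act_tangentE /act /= mulVg.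
by move=> h; split => /h.
Qed.

(** After translation to (x, 1), a vector differs from the vertical vector with the
    same value of A by a vector in the kernel of A, and D contains this kernel. *)
Lemma dist_vert x g w1 w2 :
  D (x, g) (w1, w2) <-> D (x, 1%g) (0, Aloc x w1 + left_triv aG g w2).
Proof.
rewrite dist_at1; set tau := left_triv _ _ _.
have hD : D (x, 1%g) (w1, - Aloc x w1).
  apply: A_ker.
  have -> : (w1, - Aloc x w1) = 1 *: (w1, 0) + (0, - Aloc x w1) :> EX * E.
    by congr (_, _); rewrite /= ?scale1r ?addr0 ?add0r // scaler0 add0r.
  by rewrite A_lin scale1r A_vertical subrr.
have E1 : (w1, tau) = 1 *: (0, Aloc x w1 + tau) + (w1, - Aloc x w1) :> EX * E.
  by congr (_, _); rewrite /= ?scale1r ?scaler0 ?add0r // addrAC subrr add0r.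
have E2 : (0, Aloc x w1 + tau) = (-1) *: (w1, - Aloc x w1) + (w1, tau) :> EX * E.
  by congr (_, _); rewrite /= !scaleN1r ?addNr // opprK.
by split => h; [rewrite E2|rewrite E1]; exact: dist_linear.
Qed.

Lemma left_triv_surj g zeta : exists gamma, left_triv aG g gamma = zeta.
Proof.
pose c (r : R) := (g * chart_line aG 1%g zeta r)%g.
have ml := chart_line_msm hA fE 1%g zeta.
have mc : msm aG c 0 by apply: (msm_mul hG) => //; exact: msm_cst.
have c0 : c 0 = g by rewrite /c (chart_line0 hA) mulg1.
exists (tv aG c 0 1).
have := left_triv_tv hG (1 : R) mc; rewrite c0 => ->.
rewrite -[RHS](chart_line_tv hA 1%g zeta); congr (tv _ _ _ _).
by apply/funext => r; rewrite /c mulKg.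
Qed.

Lemma left_triv0 g : left_triv aG g 0 = 0.
Proof. by rewrite /left_triv /tangent_map dirE dir0. Qed.

End Action.

(** * The variational principle and the reduced equations *)

(** Every point of the closed interval is a limit of points of the open one. *)
Lemma zero_closed_interval {R : realType} (g : R -> R) (t0 t1 t : R) : t0 < t1 ->
  t0 <= t <= t1 -> {for t, continuous g} ->
  (\forall r \near t, t0 < r < t1 -> g r = 0) -> g t = 0.
Proof.
move=> t01 /andP[a b] cg g0; apply/eqP/negPn/negP => gt0.
have ne : \forall r \near t, g r != 0.
  by apply: (cg [set y | y != 0]); apply: open_nbhs_nbhs; split => //; exact: open_neq.
have [e e0 He] : exists2 e : R, 0 < e & forall r, `|t - r| < e -> ~ (t0 < r < t1).
  have /nbhs_ballP[e e0 He] : nbhs t [set r | ~ (t0 < r < t1)].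
    by apply: filterS2 ne g0 => r /eqP h1 h2 h3; exact: h1 (h2 h3).
  by exists e => // r hr; exact: He.
have [tl|tl] := ltP t t1.
  pose h := Num.min e (t1 - t) / 2.
  have h0 : 0 < h by rewrite divr_gt0 // lt_min e0 subr_gt0.
  have [he ht] : h < e /\ h < t1 - t.
    have hm : h < Num.min e (t1 - t) by rewrite ltr_pdivrMr // ltr_pMr ?ltr1n // lt_min e0 subr_gt0.
    by split; apply: (lt_le_trans hm); rewrite ge_min lexx ?orbT.
  apply: (He (t + h)); first by rewrite opprD addrA subrr add0r normrN gtr0_norm.
  by apply/andP; split; lra.
pose h := Num.min e (t1 - t0) / 2.
have h0 : 0 < h by rewrite divr_gt0 // lt_min e0 subr_gt0.
have [he ht] : h < e /\ h < t1 - t0.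
  have hm : h < Num.min e (t1 - t0) by rewrite ltr_pdivrMr // ltr_pMr ?ltr1n // lt_min e0 subr_gt0.
  by split; apply: (lt_le_trans hm); rewrite ge_min lexx ?orbT.
apply: (He (t - h)); first by rewrite opprB addrC subrK gtr0_norm.
by apply/andP; split; lra.
Qed.

Section Principle.
Context {R : realType} {m d : nat} {X : topologicalType} {G : topGroupType}.
Variables (aX : atlas 'rV[R]_m X) (aG : atlas 'rV[R]_d G).
Local Notation EX := 'rV[R]_m.
Local Notation E := 'rV[R]_d.
Local Notation aQ := (prod_atlas aX aG).
Variables (L : X * G -> EX * E -> R) (A : X * G -> EX * E -> E) (D : X * G -> set (EX * E)).
Variable l : X -> EX -> E -> R.
Hypothesis hX : smooth_atlas aX.
Hypothesis hG : lie_group aG.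
Hypothesis sL : tangent_smooth aQ L.
Hypothesis sA : tangent_smooth aQ A.
Hypothesis sD : smooth_distribution aQ D.
Hypothesis iD : invariant_distribution aX aG D.
Hypothesis A_lin : forall q c w1 w2, A q (c *: w1 + w2) = c *: A q w1 + A q w2.
Hypothesis A_gen : forall xi q, A q (generator aX aG xi q) = xi.
Hypothesis A_ker : forall q w, A q w = 0 -> D q w.
Local Notation Aloc x w := (A (x, 1%g) (w, 0)).
Hypothesis l_def : forall x g dx dg,
  l x dx (Aloc x dx + left_triv aG g dg) = L (x, g) (dx, dg).
Variables (t0 t1 : R) (q : R -> X * G).
Hypothesis t01 : t0 < t1.
Hypothesis mq : forall t, t0 <= t <= t1 -> msm aQ q t.

Let hA := lie_atlas hG.
Let fX : fin_dim EX := fin_dim_rV m.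
Let fE : fin_dim E := fin_dim_rV d.
Let fT : fin_dim (EX * E)%type := fin_dim_prod fX fE.
Let hQ : smooth_atlas aQ := smooth_atlas_prod hX hA fX fE.
Let fRR : fin_dim (R * R)%type := fin_dim_prod fin_dim_R fin_dim_R.

Local Notation e1 := ((1, 0) : R * R).
Local Notation e2 := ((0, 1) : R * R).
Local Notation EV := (vertical_eq aX aG A l q).
Local Notation EH := (horizontal_eq aX aG A l q).
Local Notation lagr Q := (lag aX aG L Q e1).
Local Notation mom Q := (momentum aX aG A l Q e1 e2).
Local Notation vrt := (vert aX aG A).

(** The integrand of the first variation of the action after integration by parts.
    *)
Definition first_var (Q : R * R -> X * G) (t : R) : R :=
  dir (lagr Q) (t, 0) e2 - dir (mom Q) (t, 0) e1.

Lemma sm_axis (t : R) : sm (fun r : R => (r, 0 : R)) t.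
Proof. by apply: sm_pair; [exact: sm_id|exact: sm_cst]. Qed.

Lemma dir_axis (t : R) : dir (fun r : R => (r, 0 : R)) t 1 = e1.
Proof. by rewrite (dir_pair_cstr _ _ (sm_id _)) dir_id. Qed.

Lemma sm_first_var Q t : msm aQ Q (t, 0) -> sm (first_var Q) t.
Proof.
move=> mQ; apply: smB.
  apply: (sm_comp (g := fun z => dir (lagr Q) z e2) fRR (sm_axis t)).
  by apply: sm_dir; exact: (sm_lag hX hG sL sA l_def fRR mQ).
apply: (sm_comp (g := fun z => dir (mom Q) z e1) fRR (sm_axis t)).
by apply: sm_dir; exact: (sm_momentum hX hG sL sA l_def fRR mQ).
Qed.

Lemma first_varE Q p t :
  msm aQ Q (t, 0) -> (\forall r \near t, Q (r, 0) = q r) -> chart_dom aX p (q t).1 ->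
  first_var Q t = EH p t (tv aQ Q (t, 0) e2).1 +
    EV t (Aloc (q t).1 (tv aQ Q (t, 0) e2).1 + left_triv aG (q t).2 (tv aQ Q (t, 0) e2).2).
Proof.
move=> mQ Qq pt.
rewrite /first_var (curve_variation hX hG sL sA A_lin l_def mQ Qq pt).
by rewrite (tv_prod _ mQ) /= /vert /ltv (nbhs_singleton Qq).
Qed.

Definition action_of (Q : R * R -> X * G) (s : R) : R :=
  \int[lebesgue_measure]_(t in `[t0, t1]) L (Q (t, s)) (velocity aQ (fun r => Q (r, s)) t).

Lemma action_derive Q :
  (forall t, t0 <= t <= t1 -> msm aQ Q (t, 0)) ->
  is_derive (0 : R) (1 : R) (action_of Q)
    (\int[lebesgue_measure]_(t in `[t0, t1]) dir (lagr Q) (t, 0) e2).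
Proof.
move=> mQ.
have sf t : t0 <= t <= t1 -> sm (lagr Q) (t, 0).
  by move=> /mQ mQt; exact: (sm_lag hX hG sL sA l_def fRR mQt).
apply: near_eq_is_derive (derive_under_integral sf).
have : \forall s \near (0 : R), forall t, t0 <= t <= t1 -> msm aQ Q (t, s).
  by apply: uniform_nbhs => t /mQ /(msm_near hQ fT).
apply: filterS => s ms; apply: eq_Rintegral => t; rewrite inE /= in_itv /= => /ms mts.
rewrite /lag velocity_tv; congr (L _ _).
have sc : sm (fun r : R => (r, s)) t by apply: sm_pair; [exact: sm_id|exact: sm_cst].
rewrite (tv_comp (f := Q) (g := fun r : R => (r, s)) (1 : R) fRR sc mts).
by rewrite (dir_pair_cstr _ _ (sm_id _)) dir_id.
Qed.

Lemma mom_eq0 Q t : msm aQ Q (t, 0) -> tv aQ Q (t, 0) e2 = 0 -> mom Q (t, 0) = 0.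
Proof.
move=> mQ; rewrite (tv_prod _ mQ) => -[h1 h2].
rewrite /momentum h1 dir0 add0r.
have -> : vrt Q e2 (t, 0) = 0; last by rewrite dir0.
rewrite /vert /ltv h1 h2 left_triv0 addr0.
have := A_lin ((Q (t, 0)).1, 1%g) (-1) 0 0.
by rewrite scaler0 addr0 scaleN1r addNr.
Qed.

(** The total derivative of the momentum integrates to its values at the ends, which
    vanish with the variation. *)
Lemma action_first_var Q :
  (forall t, t0 <= t <= t1 -> msm aQ Q (t, 0)) ->
  tv aQ Q (t0, 0) e2 = 0 -> tv aQ Q (t1, 0) e2 = 0 ->
  \int[lebesgue_measure]_(t in `[t0, t1]) dir (lagr Q) (t, 0) e2 =
  \int[lebesgue_measure]_(t in `[t0, t1]) first_var Q t.
Proof.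
move=> mQ d0 d1.
pose th t := mom Q (t, 0).
have sth t : t0 <= t <= t1 -> sm th t.
  move=> /mQ mQt; apply: (sm_comp (g := mom Q) fRR (sm_axis t)).
  exact: (sm_momentum hX hG sL sA l_def fRR mQt).
have dth t : t0 <= t <= t1 -> dir th t 1 = dir (mom Q) (t, 0) e1.
  move=> /mQ mQt; rewrite (dir_comp (g := mom Q) (1 : R) (sm_axis t)) ?dir_axis //.
  exact: (sm_momentum hX hG sL sA l_def fRR mQt).
have h01 : t0 <= t0 <= t1 by rewrite lexx ltW.
have h11 : t0 <= t1 <= t1 by rewrite lexx ltW.
have I0 : \int[lebesgue_measure]_(t in `[t0, t1]) dir th t 1 = 0.
  by rewrite (sm_integral_derive t01 sth) /th (mom_eq0 (mQ _ h01) d0) (mom_eq0 (mQ _ h11) d1) subrr.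
have sv t : t0 <= t <= t1 -> sm (first_var Q) t by move=> /mQ; exact: sm_first_var.
have i1 := sm_integrable sv.
have i2 : lebesgue_measure.-integrable `[t0, t1] (EFin \o (fun t => dir th t 1)).
  by apply: sm_integrable => t ht; exact: sm_dir (sth t ht).
rewrite -[RHS]addr0 -[X in _ = _ + X]I0 -RintegralD //.
apply: eq_Rintegral => t; rewrite inE /= in_itv /= => ht.
by rewrite /first_var dth // subrK.
Qed.

Definition reduced_equations : Prop := forall t, t0 <= t <= t1 ->
  (forall zeta, D ((q t).1, 1%g) (0, zeta) -> EV t zeta = 0) /\
  (forall p, chart_dom aX p (q t).1 -> forall delta, EH p t delta = 0).

(** The vertical part of an admissible variation lies in S_x by [dist_vert], so that
    both forms in the integrand vanish. *)
Lemma reduced_principle : reduced_equations -> lagrange_dalembert aQ L D t0 t1 q.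
Proof.
move=> red W Q oW Wt sQ Qq dq dq0 dq1 Ddq.
have mQ t : t0 <= t <= t1 -> msm aQ Q (t, 0).
  by move=> ht; exact: (smooth_map_on_msm hQ oW (Wt t ht) sQ).
have dqE t : t0 <= t <= t1 -> dq t = tv aQ Q (t, 0) e2.
  move=> /mQ mQt; rewrite /dq velocity_tv.
  have sc : sm (fun s : R => (t, s)) 0 by apply: sm_pair; [exact: sm_cst|exact: sm_id].
  rewrite (tv_comp (f := Q) (g := fun s : R => (t, s)) (1 : R) fRR sc mQt).
  by rewrite (dir_pair_cstl _ _ (sm_id _)) dir_id.
have h01 : t0 <= t0 <= t1 by rewrite lexx ltW.
have h11 : t0 <= t1 <= t1 by rewrite lexx ltW.
suff I0 : \int[lebesgue_measure]_(t in `[t0, t1]) dir (lagr Q) (t, 0) e2 = 0.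
  by have := action_derive mQ; rewrite I0.
rewrite action_first_var // -?dqE //.
have v0 t' : t0 <= t' <= t1 -> first_var Q t' = 0.
  move=> ht'; apply: (zero_closed_interval t01 ht').
    exact: sm_continuous (sm_first_var (mQ _ ht')).
  apply: (@filterE _ (nbhs t')) => t /andP[a b]; have ht : t0 <= t <= t1 by rewrite !ltW.
  have nq : \forall r \near t, Q (r, 0) = q r.
    apply: filterS (filterI (lt_nbhsr a) (lt_nbhsl b)) => r [ra rb].
    by apply: Qq; rewrite !ltW.
  have [rV rH] := red t ht.
  rewrite (first_varE (mQ t ht) nq (dom_self hX _)) rH ?add0r; last exact: dom_self.
  apply: rV; have := Ddq t ht; rewrite dqE //.
  case: (q t) (tv aQ Q (t, 0) e2) => x g [w1 w2] /=.
  by move/(dist_vert hX hG sD iD A_lin A_gen A_ker).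
transitivity (\int[lebesgue_measure]_(t in `[t0, t1]) (fun=> 0 : R) t).
  by apply: eq_Rintegral => t; rewrite inE /= in_itv /= => /v0.
by rewrite Rintegral_cst ?mul0r //; exact: measurable_itv.
Qed.

(** The integrand of the first variation as a linear form in the variation w of q.
    *)
Definition variational_form p t (w : EX * E) : R :=
  EH p t w.1 + EV t (Aloc (q t).1 w.1 + left_triv aG (q t).2 w.2).

Lemma dir_scale (H F : normedModType R) (f : H -> F) c x v : sm f x ->
  dir (fun y => c *: f y) x v = c *: dir f x v.
Proof.
by move=> sf; rewrite (dirZ _ (sm_cst c x) sf) dir_cst scale0r add0r.
Qed.

Lemma A0 p : A p 0 = 0.
Proof. by have := A_lin p (-1) 0 0; rewrite scaler0 addr0 scaleN1r addNr. Qed.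

Lemma Aloc_scale x c w : Aloc x (c *: w) = c *: Aloc x w.
Proof.
have := A_lin (x, 1%g) c (w, 0) 0; rewrite A0 !addr0 => <-.
by congr (A _ (_, _)); rewrite /= ?addr0 ?scaler0.
Qed.

Lemma lie_bracket_scale c u w :
  lie_bracket aG (c *: u) w = c *: lie_bracket aG u w /\
  lie_bracket aG w (c *: u) = c *: lie_bracket aG w u.
Proof.
have hl y : lie_bracket aG (c *: u) y = c *: lie_bracket aG u y.
  have := lie_bracket_linear hG y c u 0.
  by have := lie_bracketBl hG y 0 0; rewrite !subrr => ->; rewrite !addr0.
by split => //; rewrite !(lie_bracketC hG w) hl scalerN.
Qed.

Lemma Ap_scale p z c w : Ap aX A p (z, c *: w) = c *: Ap aX A p (z, w).
Proof.
rewrite /Ap -Aloc_scale /=; congr (A _ (_, _)).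
have := of_chart_linear aX p z c w 0.
by rewrite addr0 => ->; rewrite /of_chart linear0 addr0.
Qed.

(** The exterior derivative is homogeneous because the one-form is linear on each
    tangent space. *)
Lemma curvature_scale p w1 c w2 :
  curvature aX aG A p w1 (c *: w2) = c *: curvature aX aG A p w1 w2.
Proof.
have ip : chart_image aX p setT (chart aX p p) by exact: (img_chart (dom_self hX p)).
have sA1 w : sm (fun u => Ap aX A p (u, w)) (chart aX p p).
  apply: (sm_comp (g := Ap aX A p) (fin_dim_prod fX fX)).
    by apply: sm_pair; [exact: sm_id|exact: sm_cst].
  exact: (sm_Ap hX hG sA w ip).
rewrite /curvature /ext_deriv.
rewrite !(D_dir _ (sA1 _)) dirZv.
have -> : dir (fun u => Ap aX A p (u, c *: w2)) (chart aX p p) w1 =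
    c *: dir (fun u => Ap aX A p (u, w2)) (chart aX p p) w1.
  have -> : (fun u => Ap aX A p (u, c *: w2)) = (fun u => c *: Ap aX A p (u, w2)).
    by apply/funext => u; rewrite Ap_scale.
  exact: (dir_scale _ _ (sA1 w2)).
by rewrite Aloc_scale (lie_bracket_scale _ _ _).2 !scalerBr.
Qed.

Lemma vertical_eq_scale t c nu : msm aQ q t -> EV t (c *: nu) = c * EV t nu.
Proof.
move=> mqt; rewrite /vertical_eq !(lie_bracket_scale _ _ _).2 -scalerBr.
rewrite /fiber_derivative !dirZv mulrBr; congr (_ - _).
have -> : (fun r => fiber_derivative aX aG A l q 1 r (c *: nu)) =
    (fun r => c *: (fiber_derivative aX aG A l q 1 r nu : R^o)).
  by apply/funext => r; rewrite /fiber_derivative dirZv.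
exact: (dir_scale _ _ (sm_fiber_derivative hX hG sL sA l_def nu mqt)).
Qed.

Lemma horizontal_eq_scale p t c delta : msm aQ q t -> chart_dom aX p (q t).1 ->
  EH p t (c *: delta) = c * EH p t delta.
Proof.
move=> mqt dp; rewrite /horizontal_eq.
have -> : to_chart aX p (q t).1 (c *: delta) = c *: to_chart aX p (q t).1 delta.
  have := to_chart_linear aX p (q t).1 c delta 0.
  by rewrite addr0 => ->; rewrite /to_chart linear0 addr0.
rewrite curvature_scale Aloc_scale (lie_bracket_scale _ _ _).1 -scalerBr.
rewrite /fiber_derivative /dl_dx !dirZv !mulrBr; congr (_ - _ - _).
set a := to_chart _ _ _ _.
have -> : (fun r => dl_ddx aX aG A l q p r (c *: a)) =
    (fun r => c *: (dl_ddx aX aG A l q p r a : R^o)).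
  by apply/funext => r; rewrite /dl_ddx dirZv.
exact: (dir_scale _ _ (sm_dl_ddx hX hG sL sA l_def a mqt dp)).
Qed.

Lemma variational_form_scale p t c w : msm aQ q t -> chart_dom aX p (q t).1 ->
  variational_form p t (c *: w) = c * variational_form p t w.
Proof.
move=> mqt dp; rewrite /variational_form /= (horizontal_eq_scale _ _ mqt dp) Aloc_scale.
have -> : left_triv aG (q t).2 (c *: w.2) = c *: left_triv aG (q t).2 w.2.
  by rewrite /left_triv /tangent_map !dirE; exact: dirZv.
by rewrite -scalerDr (vertical_eq_scale _ _ mqt); exact/esym/mulrDr.
Qed.

Lemma horizontal_eq0 p t : msm aQ q t -> chart_dom aX p (q t).1 -> EH p t 0 = 0.
Proof. by move=> h1 h2; rewrite -[X in EH p t X](scale0r (0 : EX)) (horizontal_eq_scale _ _ h1 h2) mul0r. Qed.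

Lemma vertical_eq0 t : msm aQ q t -> EV t 0 = 0.
Proof. by move=> h1; rewrite -[X in EV t X](scale0r (0 : E)) (vertical_eq_scale _ _ h1) mul0r. Qed.

Lemma of_chart_sum P u (I : finType) (c : I -> R) (w : I -> EX * E) :
  of_chart aQ P u (\sum_i c i *: w i) = \sum_i c i *: of_chart aQ P u (w i).
Proof.
rewrite /of_chart; under [RHS]eq_bigr do rewrite dirE.
by rewrite dirE dir_sumv; apply: eq_bigr => i _; exact: dirZv.
Qed.

(** A combination with constant coefficients of a local smooth frame of D, written
    in the chart at q t. *)
Lemma distribution_section t w0 : t0 <= t <= t1 -> D (q t) w0 ->
  exists w : R -> EX * E, [/\ sm w t, w t = w0 & \forall r \near t,
    D (q r) (of_chart aQ (q t) (chart aQ (q t) (q r)) (w r))].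
Proof.
move=> ht Dw0; have mqt := mq ht; set P := q t.
have [U [k [Y [oU Uq sY DU]]]] := sD P.
have [_ DP] := DU P Uq.
have [c cE] : exists c : 'I_k -> R, w0 = \sum_i c i *: Y i P.
  by have := Dw0; rewrite -/P DP.
have dP := dom_self hQ P.
have sq : sm (fun r => chart aQ P (q r)) t := msm_chart hQ fT mqt dP.
have UI : chart_image aQ P U (chart aQ P P) by exists P.
have oUI := chart_image_open hQ P oU.
pose y i (u : EX * E) := to_chart aQ P (chart_inv aQ P u) (Y i (chart_inv aQ P u)).
have sy i : sm (fun r => y i (chart aQ P (q r))) t.
  exact: (sm_comp fT sq (sm_on oUI UI (sY i P))).
have near1 := near_chartK hQ mqt.1 dP.
have nearU : \forall r \near t, U (q r).
  by apply: mqt.1; apply: open_nbhs_nbhs.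
exists (fun r => \sum_i c i *: y i (chart aQ P (q r))); split.
- by apply: sm_sum => i _; apply: smZ; [exact: sm_cst|exact: sy].
- rewrite cE; apply: eq_bigr => i _; rewrite /y -/P (chartK hQ dP).
  by rewrite (to_chart_self hQ fT).
apply: filterS2 near1 nearU => r [dr kr] Ur.
have [_ ->] := DU _ Ur; exists c; rewrite of_chart_sum; apply: eq_bigr => i _.
by rewrite /y kr (of_chartK hQ fT _ dr).
Qed.

(** A deformation of q whose variation is the field w, both written in the chart at
    P. *)
Definition deform P (w : R -> EX * E) (z : R * R) : X * G :=
  chart_inv aQ P (chart aQ P (q z.1) + z.2 *: w z.1).

Section Deform.
Variables (P : X * G) (w : R -> EX * E) (t : R).
Hypothesis mqt : msm aQ q t.
Hypothesis dP : chart_dom aQ P (q t).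
Hypothesis sw : sm w t.

Lemma deform0 r : chart_dom aQ P (q r) -> deform P w (r, 0) = q r.
Proof. 
move=> dr; have -> : deform P w (r, 0) =
  chart_inv aQ P (chart aQ P (q r) + (0 : R) *: w r) by [].
by rewrite scale0r addr0 (chartK hQ dr). Qed.

Let sF : sm (fun z : R * R => chart aQ P (q z.1) + z.2 *: w z.1) (t, 0).
Proof.
have s1 : sm (fun z : R * R => z.1) (t, 0 : R) by exact: sm_fst (sm_id _).
apply: smD.
  exact: (sm_comp (g := fun r => chart aQ P (q r)) fin_dim_R s1 (msm_chart hQ fT mqt dP)).
apply: smZ; first exact: sm_snd (sm_id _).
exact: (sm_comp (g := w) fin_dim_R s1 sw).
Qed.

Let iF : chart_image aQ P setT (chart aQ P (q t) + (0 : R) *: w t).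
Proof. by rewrite scale0r addr0; exact: (img_chart dP). Qed.

Lemma msm_deform : msm aQ (deform P w) (t, 0).
Proof. exact: (msm_inv hQ fT sF iF). Qed.

Lemma tv_deform : tv aQ (deform P w) (t, 0) e2 = of_chart aQ P (chart aQ P (q t)) (w t).
Proof.
have d0 : chart_dom aQ P (deform P w (t, 0)) by rewrite deform0.
rewrite (tv_of_chart hQ fT _ msm_deform d0) deform0 //; congr (of_chart _ _ _ _).
have nF : \forall z \near ((t, 0) : R * R),
    chart aQ P (q z.1) + z.2 *: w z.1 = chart aQ P (deform P w z).
  have : \forall z \near ((t, 0) : R * R),
      chart_image aQ P setT (chart aQ P (q z.1) + z.2 *: w z.1).
    by apply: (sm_cvg sF); exact: (nbhs_img hQ iF).
  by apply: filterS => z iz; rewrite /deform (chart_invK hQ iz).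
have -> := dir_ext e2 nF sF; rewrite (dir_partial_r (1 : R) sF).
exact: (etrans (dir_line (chart aQ P (q t)) (w t) 0 (1 : R)) (scale1r _)).
Qed.

Lemma near_dom : \forall r \near t, chart_dom aQ P (q r).
Proof. by apply: filterS (near_chartK hQ mqt.1 dP) => r []. Qed.

End Deform.

Lemma deform_form p P w t : msm aQ q t -> chart_dom aQ P (q t) -> sm w t ->
  chart_dom aX p (q t).1 ->
  first_var (deform P w) t =
  variational_form p t (of_chart aQ P (chart aQ P (q t)) (w t)).
Proof.
move=> mqt dP sw dp.
have nq : \forall r \near t, deform P w (r, 0) = q r.
  by apply: filterS (near_dom mqt dP) => r /deform0.
by rewrite (first_varE (msm_deform mqt dP sw) nq dp) (tv_deform mqt dP sw).
Qed.

Lemma of_chart_scale P u c w : of_chart aQ P u (c *: w) = c *: of_chart aQ P u w.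
Proof. by rewrite /of_chart !dirE; exact: dirZv. Qed.

(** If the form is positive on w0, extend w0 to a smooth section of D along q on
    which the form stays positive near t, and multiply it by a bump function
    supported there. The deformation of q along this field is admissible, and its
    first variation is the integral of a nonnegative function that is positive at t.
    *)
Lemma variational_le0 p t w0 : lagrange_dalembert aQ L D t0 t1 q ->
  t0 < t < t1 -> chart_dom aX p (q t).1 -> D (q t) w0 -> variational_form p t w0 <= 0.
Proof.
move=> LdA /[dup] hi /andP[a b] dp Dw0; rewrite leNgt; apply/negP => pos.
have ht : t0 <= t <= t1 by rewrite !ltW.
have mqt := mq ht.
have [w [sw wt Dw]] := distribution_section ht Dw0.
set P := q t in sw wt Dw; have dP : chart_dom aQ P (q t) := dom_self hQ P.
pose om r := of_chart aQ P (chart aQ P (q r)) (w r).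
pose e r := first_var (deform P w) r.
have et : e t = variational_form p t w0.
  by rewrite /e (deform_form mqt dP sw dp) wt (of_chart_self hQ fT).
have se : sm e t := sm_first_var (msm_deform mqt dP sw).
have [eps e0 good] : exists2 eps : R, 0 < eps & forall r, `|t - r| < eps ->
    [/\ t0 < r < t1, sm w r /\ chart_dom aQ P (q r), chart_dom aX p (q r).1,
        D (q r) (om r) & 0 < e r].
  have n1 : \forall r \near t, t0 < r < t1.
    by apply: filterS (filterI (lt_nbhsr a) (lt_nbhsl b)) => r [-> ->].
  have n2 : \forall r \near t, sm w r /\ chart_dom aQ P (q r).
    exact: filterI (sm_near sw) (near_dom mqt dP).
  have n3 : \forall r \near t, chart_dom aX p (q r).1.
    by apply: filterS (near_chartK hX (msm_fst mqt).1 dp) => r [].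
  have n5 : \forall r \near t, 0 < e r.
    by apply: (cvgr_gt (e t) (sm_cvg se)); rewrite et.
  have [eps /= e0 He] := (nbhs_ballP _ _).1 (filterI (filterI n1 n2) (filterI (filterI n3 Dw) n5)).
  by exists eps => // r hr; have [[h1 h2] [[h3 h4] h5]] := He r hr.
(* the bump is supported in half of the interval, so that the two definitions
   of H overlap *)
pose be := bump (t - eps / 2) (t + eps / 2).
have e20 : 0 < eps / 2 by rewrite divr_gt0.
have be0 r : eps / 2 <= `|t - r| -> be r = 0.
  move=> h; apply: bump_eq0; apply/negP => /andP[h1 h2]; move: h.
  by apply/negP; rewrite -ltNge ltr_norml; apply/andP; split; lra.
have sbe r : sm be r by exact: sm_bump.
pose bw r := be r *: w r.
pose H (z : R * R) := if `|t - z.1| < eps then deform P bw z else q z.1.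
have dist_cont (z : R * R) : `|t - y.1| @[y --> z] --> `|t - z.1|.
  by apply: cvg_norm; apply: cvgB; [exact: cvg_cst|exact: cvg_fst].
(* on the whole line H is a deformation of q *)
have H0 r : H (r, 0) = q r.
  rewrite /H /=; case: ifPn => // /good[_ [_ dr] _ _ _]; exact: deform0.
(* near t the variation is the cut-off section *)
have H1 r : `|t - r| < eps -> msm aQ H (r, 0) /\ tv aQ H (r, 0) e2 = be r *: om r.
  move=> hr; have [/andP[r0 r1] [swr dr] _ _ _] := good r hr.
  have mqr : msm aQ q r by apply: mq; rewrite !ltW.
  have sbw : sm bw r by exact: smZ (sbe r) swr.
  have nH : \forall z \near ((r, 0) : R * R), deform P bw z = H z.
    have : \forall z \near ((r, 0) : R * R), `|t - z.1| < eps.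
      exact: (cvgr_lt _ (dist_cont (r, 0)) eps hr).
    by apply: filterS => z hz; rewrite /H hz.
  split; first exact: (msm_ext nH (msm_deform mqr dr sbw)).
  rewrite (tv_ext _ nH (msm_deform mqr dr sbw)) (tv_deform mqr dr sbw).
  exact: of_chart_scale.
(* away from t the bump function vanishes and H is constant in s *)
have H2 r : t0 <= r <= t1 -> eps <= `|t - r| ->
    msm aQ H (r, 0) /\ tv aQ H (r, 0) e2 = 0.
  move=> hr he; have mqr := mq hr.
  have he2 : eps / 2 < `|t - r| by apply: lt_le_trans he; lra.
  have nH : \forall z \near ((r, 0) : R * R), q z.1 = H z.
    have : \forall z \near ((r, 0) : R * R), eps / 2 < `|t - z.1|.
      exact: (cvgr_gt _ (dist_cont (r, 0)) (eps / 2) he2).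
    apply: filterS => z hz; rewrite /H; case: ifPn => // /good[_ [_ dz] _ _ _].
    by rewrite /deform /bw be0 ?ltW // scale0r scaler0 addr0 (chartK hQ dz).
  have s1 : sm (fun z : R * R => z.1) (r, 0 : R) by exact: sm_fst (sm_id _).
  have mq1 : msm aQ (fun z : R * R => q z.1) (r, 0) by exact: (msm_comp fin_dim_R s1 mqr).
  split; first exact: (msm_ext nH mq1).
  rewrite (tv_ext _ nH mq1) (tv_comp (g := fun z : R * R => z.1) e2 fin_dim_R s1 mqr).
  by rewrite dir_fst ?dir_id; [exact: dir0|exact: sm_id].
have mH r : t0 <= r <= t1 -> msm aQ H (r, 0).
  by move=> hr; have [/H1[]|/(H2 r hr)[]] := ltP `|t - r| eps.
have nq (r : R) : \forall r' \near r, H (r', 0) = q r' by apply: (@filterE R (nbhs r) (nbhs_filter r)) => r'; exact: H0.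
have fv1 r : `|t - r| < eps -> first_var H r = be r * e r.
  move=> hr; have [/andP[r0 r1] [swr dr] dpr _ _] := good r hr.
  have mqr : msm aQ q r by apply: mq; rewrite !ltW.
  have [mHr tvr] := H1 r hr.
  rewrite (first_varE mHr (nq r) dpr) -/(variational_form p r _) tvr.
  by rewrite (variational_form_scale _ _ mqr dpr) /e (deform_form mqr dr swr dpr).
have fv2 r : t0 <= r <= t1 -> eps <= `|t - r| -> first_var H r = 0.
  move=> hr he; have mqr := mq hr; have [mHr tvr] := H2 r hr he.
  have dpr := dom_self hX (q r).1.
  rewrite (first_varE mHr (nq r) dpr) -/(variational_form (q r).1 r _) tvr.
  by rewrite -[X in variational_form _ _ X](scale0r (0 : EX * E))
    (variational_form_scale _ _ mqr dpr) mul0r.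
have fv0 r : t0 <= r <= t1 -> 0 <= first_var H r.
  move=> hr; have [h|h] := ltP `|t - r| eps; last by rewrite fv2.
  have [_ _ _ _ h5] := good r h.
  by rewrite fv1 // mulr_ge0 ?bump_ge0 // ltW.
have tvD r : t0 <= r <= t1 -> D (q r) (tv aQ H (r, 0) e2).
  move=> hr; have [h|h] := ltP `|t - r| eps; last first.
    by rewrite (H2 r hr h).2; exact: (dist0 sD).
  have [_ _ _ h4 _] := good r h.
  rewrite (H1 r h).2 -[X in D _ X]addr0.
  by apply: (dist_linear sD) => //; exact: (dist0 sD).
have end0 r : t0 <= r <= t1 -> ~~ (t0 < r < t1) -> tv aQ H (r, 0) e2 = 0.
  move=> hr hn; have [h|h] := ltP `|t - r| eps; last exact: (H2 r hr h).2.
  by have [h1 _ _ _ _] := good r h; rewrite h1 in hn.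
have dqE r : t0 <= r <= t1 -> velocity aQ (fun s => H (r, s)) 0 = tv aQ H (r, 0) e2.
  move=> /mH mHr; rewrite velocity_tv.
  have sc : sm (fun s : R => (r, s)) 0 by apply: sm_pair; [exact: sm_cst|exact: sm_id].
  rewrite (tv_comp (f := H) (g := fun s : R => (r, s)) (1 : R) fRR sc mHr).
  by rewrite (dir_pair_cstl _ _ (sm_id _)) dir_id.
have h01 : t0 <= t0 <= t1 by rewrite lexx ltW.
have h11 : t0 <= t1 <= t1 by rewrite lexx ltW.
have tv0 : tv aQ H (t0, 0) e2 = 0 by apply: end0; rewrite ?ltxx.
have tv1 : tv aQ H (t1, 0) e2 = 0 by apply: end0; rewrite ?ltxx ?andbF.
(* two values of the same derivative of the action *)
have I0 : \int[lebesgue_measure]_(r in `[t0, t1]) first_var H r = 0.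
  have oW : open [set z | msm aQ H z].
    by rewrite openE => z mz; exact: (msm_near hQ fT mz).
  have dA := LdA [set z | msm aQ H z] H oW mH (msm_smooth_map_on hQ fT (fun z h => h))
    (fun r _ => H0 r) (etrans (dqE _ h01) tv0) (etrans (dqE _ h11) tv1)
    (fun r hr => eq_ind_r (D (q r)) (tvD r hr) (dqE r hr)).
  rewrite -(action_first_var mH tv0 tv1).
  by rewrite -(@derive_val _ _ _ _ _ _ _ (action_derive mH)) (@derive_val _ _ _ _ _ _ _ dA).
have := integral_ge0_eq0 hi (fun r hr => sm_first_var (mH r hr)) fv0 I0.
have tt : `|t - t| < eps by rewrite subrr normr0.
have [_ _ _ _ h5] := good t tt.
rewrite fv1 //; apply/eqP; rewrite mulf_neq0 // gt_eqF //.
by apply: bump_gt0; apply/andP; split; lra.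
Qed.

(** At interior times [variational_le0] applies to w0 and to - w0; the end points
    follow by continuity along a section of D. *)
Lemma variational_eq0 p t w0 : lagrange_dalembert aQ L D t0 t1 q ->
  t0 <= t <= t1 -> chart_dom aX p (q t).1 -> D (q t) w0 -> variational_form p t w0 = 0.
Proof.
move=> LdA ht dp Dw0; have mqt := mq ht.
have int0 r v : t0 < r < t1 -> chart_dom aX p (q r).1 -> D (q r) v ->
    variational_form p r v = 0.
  move=> hr dr Dv; apply: le_anti; rewrite (variational_le0 LdA hr dr Dv) /=.
  have mqr : msm aQ q r by case/andP: hr => h1 h2; apply: mq; rewrite !ltW.
  rewrite -oppr_le0 -mulN1r -(variational_form_scale _ _ mqr dr).
  apply: (variational_le0 LdA hr dr); rewrite -[X in D _ X]addr0.
  by apply: (dist_linear sD) => //; exact: (dist0 sD).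
have [w [sw wt Dw]] := distribution_section ht Dw0.
have dP : chart_dom aQ (q t) (q t) := dom_self hQ (q t).
have et := deform_form mqt dP sw dp.
rewrite wt (of_chart_self hQ fT) in et; rewrite -et.
apply: (zero_closed_interval t01 ht).
  exact: sm_continuous (sm_first_var (msm_deform mqt dP sw)).
have n3 := near_chartK hX (msm_fst mqt).1 dp.
have n4 := near_dom mqt dP.
apply: filterS (filterI (filterI n3 n4) (filterI Dw (sm_near sw))).
move=> r [[[dr _] dPr] [Dr swr]] /[dup] hr /andP[h1 h2].
have mqr : msm aQ q r by apply: mq; rewrite !ltW.
by rewrite (deform_form mqr dPr swr dr) int0.
Qed.

(** A vertical vector of D isolates the vertical equation. A vector with prescribed
    projection delta and zero vertical part lies in D and isolates the horizontal
    one. *)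
Lemma principle_reduced : lagrange_dalembert aQ L D t0 t1 q -> reduced_equations.
Proof.
move=> LdA t ht; have mqt := mq ht.
have Aloc0 x : Aloc x 0 = 0 by exact: A0.
split=> [zeta Dz|p dp delta].
  have [gam gamE] := left_triv_surj hG (q t).2 zeta.
  have dp := dom_self hX (q t).1.
  have Dw : D (q t) (0, gam).
    have := (dist_at1 hX hG iD (q t).1 (q t).2 0 gam).2; rewrite gamE -surjective_pairing.
    exact.
  have := variational_eq0 LdA ht dp Dw.
  rewrite /variational_form (horizontal_eq0 mqt dp) Aloc0 add0r gamE.
  by rewrite add0r.
have [gam gamE] := left_triv_surj hG (q t).2 (- Aloc (q t).1 delta).
have Dw : D (q t) (delta, gam).
  have := (dist_vert hX hG sD iD A_lin A_gen A_ker (q t).1 (q t).2 delta gam).2.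
  rewrite gamE subrr -surjective_pairing; apply; exact: (dist0 sD).
have := variational_eq0 LdA ht dp Dw.
by rewrite /variational_form [X in left_triv _ _ X]/= gamE subrr (vertical_eq0 mqt) addr0.
Qed.

Lemma principleP : lagrange_dalembert aQ L D t0 t1 q <-> reduced_equations.
Proof. by split; [exact: principle_reduced|exact: reduced_principle]. Qed.

End Principle.

(** * Partial derivatives of the reduced Lagrangian *)

Section StageForm.
Context {R : realType} {m d : nat} {X : topologicalType} {G : topGroupType}.
Variables (aX : atlas 'rV[R]_m X) (aG : atlas 'rV[R]_d G).
Local Notation EX := 'rV[R]_m.
Local Notation E := 'rV[R]_d.
Local Notation aQ := (prod_atlas aX aG).
Variables (L : X * G -> EX * E -> R) (A : X * G -> EX * E -> E).
Variable l : X -> EX -> E -> R.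
Hypothesis hX : smooth_atlas aX.
Hypothesis hG : lie_group aG.
Hypothesis sL : tangent_smooth aQ L.
Hypothesis sA : tangent_smooth aQ A.
Local Notation Aloc x w := (A (x, 1%g) (w, 0)).
Hypothesis l_def : forall x g dx dg,
  l x dx (Aloc x dx + left_triv aG g dg) = L (x, g) (dx, dg).
Variables (q : R -> X * G).
Let fX : fin_dim EX := fin_dim_rV m.
Let fE : fin_dim E := fin_dim_rV d.
Let hA := lie_atlas hG.
Let hQ : smooth_atlas aQ := smooth_atlas_prod hX hA fX fE.
Let fT : fin_dim (EX * E)%type := fin_dim_prod fX fE.

Lemma sm_reduced_lagrangian x w xi : sm (l x w) xi.
Proof.
have i1 : chart_image aX x setT (chart aX x x) by exact: (img_chart (dom_self hX x)).
have s1 : sm (fun xi => ((chart aX x x, w), xi)) xi.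
  by apply: sm_pair; [exact: sm_cst|exact: sm_id].
have s2 := sm_ell hX hG sL sA l_def w xi i1.
have := sm_comp (g := ell aX l x) (fin_dim_prod (fin_dim_prod fX fX) fE) s1 s2.
apply: sm_ext; apply: (@filterE _ (nbhs xi)) => y.
by rewrite /ell /= (chartK hX (dom_self hX x)) (of_chart_self hX fX).
Qed.

(** Changing one component of v and fixing the others is a translation, so the
    partial derivative is a directional derivative of l at v. *)
Lemma partial_fiber_derivative x w c xi zeta :
  'D_zeta (fun kappa => l x w (c + kappa)) xi = dir (l x w) (c + xi) zeta.
Proof.
have s1 : sm (fun kappa : E => c + kappa) xi by apply: smD; [exact: sm_cst|exact: sm_id].
have s2 := sm_reduced_lagrangian x w (c + xi).
rewrite (D_dir _ (sm_comp fE s1 s2)) (dir_comp (g := l x w) _ s1 s2).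
by rewrite (dirD _ (sm_cst _ _) (sm_id _)) dir_cst dir_id add0r.
Qed.

Lemma coordinate_dl_dx p t u : msm aQ q t -> chart_dom aX p (q t).1 ->
  'D_u (fun y => l (chart_inv aX p y)
      (of_chart aX p y (derive1 (fun r => chart aX p (q r).1) t)) (vert aX aG A q 1 t))
    (chart aX p (q t).1) = dl_dx aX aG A l q p t u.
Proof.
move=> mqt dp.
have sx := msm_chart hX fX (msm_fst mqt) dp.
rewrite (derive1_dir sx) /dl_dx; apply: D_dir.
apply: (sm_comp (f := fun y => ((y, dir (fun r => chart aX p (q r).1) t 1), vert aX aG A q 1 t))
  (g := ell aX l p) (fin_dim_prod (fin_dim_prod fX fX) fE)).
  apply: sm_pair; last exact: sm_cst.
  by apply: sm_pair; [exact: sm_id|exact: sm_cst].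
exact: (sm_ell hX hG sL sA l_def _ _ (img_chart dp)).
Qed.

Lemma coordinate_dl_ddx p t u : msm aQ q t -> chart_dom aX p (q t).1 ->
  'D_u (fun y => l (chart_inv aX p (chart aX p (q t).1))
      (of_chart aX p (chart aX p (q t).1) y) (vert aX aG A q 1 t))
    (derive1 (fun r => chart aX p (q r).1) t) = dl_ddx aX aG A l q p t u.
Proof.
move=> mqt dp.
have sx := msm_chart hX fX (msm_fst mqt) dp.
rewrite (derive1_dir sx) /dl_ddx; apply: D_dir.
apply: (sm_comp (f := fun y => ((chart aX p (q t).1, y), vert aX aG A q 1 t))
  (g := ell aX l p) (fin_dim_prod (fin_dim_prod fX fX) fE)).
  apply: sm_pair; last exact: sm_cst.
  by apply: sm_pair; [exact: sm_cst|exact: sm_id].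
exact: (sm_ell hX hG sL sA l_def _ _ (img_chart dp)).
Qed.

Lemma coordinate_dl_ddx_derive p t u : msm aQ q t -> chart_dom aX p (q t).1 ->
  derive1 (fun r => 'D_u (fun y => l (chart_inv aX p (chart aX p (q r).1))
      (of_chart aX p (chart aX p (q r).1) y) (vert aX aG A q 1 r))
    (derive1 (fun r => chart aX p (q r).1) r)) t =
  dir (fun r => dl_ddx aX aG A l q p r u) t 1.
Proof.
move=> mqt dp; set F := (F in derive1 F).
have sF := sm_dl_ddx hX hG sL sA l_def u mqt dp.
have nF : \forall r \near t, dl_ddx aX aG A l q p r u = F r.
  apply: filterS (filterI (msm_near hQ fT mqt) (near_chartK hX (msm_fst mqt).1 dp)).
  by move=> r [mqr [dr _]]; rewrite /F (coordinate_dl_ddx _ mqr dr).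
by rewrite (derive1_dir (sm_ext nF sF)) (dir_ext _ nF sF).
Qed.

End StageForm.

(** * Brackets in the stage decomposition *)

Section ChainOfSubgroups.
Context {R : realType} {d : nat} {G : topGroupType}.
Variables (aG : atlas 'rV[R]_d G) (gG : G -> 'rV[R]_d -> 'rV[R]_d -> R).
Variables (n : nat) (N : nat -> set G).
Hypothesis hG : lie_group aG.
Hypothesis rG : riemannian_metric aG gG.
Hypothesis hN : normal_chain n N.
Local Notation "[< xi , eta >]" := (lie_bracket aG xi eta).
Local Notation lie j := (lie_sub aG (N j)).
Local Notation comp := (stage_comp aG gG n N).
Local Notation br := (quot_bracket aG gG N).
Local Notation a i j xi zeta := (comp (stage_a aG gG N j xi zeta) i).
Local Notation b i j xi zeta := (comp (stage_b aG j xi zeta) i).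
Local Notation above j c := (\sum_(k < n.+1 | (j < k)%N) c k).

Let ipl w c u v : gG 1%g (c *: u + v) w = c * gG 1%g u w + gG 1%g v w.
Proof. by have [h _ _ _] := rG; exact: h. Qed.
Let ipC u v : gG 1%g u v = gG 1%g v u.
Proof. by have [_ h _ _] := rG; exact: h. Qed.
Let ip0 u : u != 0 -> 0 < gG 1%g u u.
Proof. by have [_ _ h _] := rG; exact: h. Qed.
Let lie_subspace j : (j <= n.+1)%N -> lin_subspace (lie j).
Proof.
have [_ _ hc _] := hN => /hc[_ h1 hM _]; exact: (lie_sub_subspace hG h1 hM).
Qed.
Let lieS j xi : (j <= n)%N -> lie j.+1 xi -> lie j xi.
Proof. by have [_ _ _ hn] := hN => /hn[hs _]; exact: (lie_sub_mono hG hs). Qed.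
Let lie0 xi : lie 0 xi.
Proof. by have [-> _ _ _] := hN; exact: (lie_sub_T hG). Qed.
Let lien xi : lie n.+1 xi -> xi = 0.
Proof. by have [_ -> _ _] := hN; exact: (lie_sub_1 hG). Qed.
Let brl w c u v : [< c *: u + v, w >] = c *: [< u, w >] + [< v, w >].
Proof. exact: (lie_bracket_linear hG). Qed.
Let brC u v : [< u, v >] = - [< v, u >].
Proof. exact: (lie_bracketC hG). Qed.
Let lie_br j xi zeta : (j <= n)%N -> lie j xi -> lie j zeta -> lie j [< xi, zeta >].
Proof.
have [_ _ hc _] := hN => jn; have [_ h1 hM hV] := hc j (leqW jn).
have hc2 h k : N j h -> N j k -> N j (h * k * h^-1)%g.
  by move=> Nh Nk; apply: (hM); [exact: hM|exact: hV].
exact: (lie_sub_ideal hG h1 hM hc2).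
Qed.
Let lie_ideal j xi zeta : (j <= n)%N ->
  lie j xi -> lie j.+1 zeta -> lie j.+1 [< xi, zeta >].
Proof.
have [_ _ hc hn] := hN => jn; have [_ h1 hM _] := hc j.+1 jn.
have [_ hconj] := hn j jn.
exact: (lie_sub_ideal hG h1 hM hconj).
Qed.

Lemma stage_sum xi : \sum_(i < n.+1) comp xi i = xi.
Proof. exact: (comp_sum ipl ipC ip0 lie_subspace lieS lie0 lien). Qed.

Lemma stageB u v i : comp (u - v) i = comp u i - comp v i.
Proof. exact: (compB ipl ipC ip0 lie_subspace lieS lie0 lien). Qed.

Lemma stage_bracket xi zeta i : comp [< xi, zeta >] i =
  br i (comp xi i) (comp zeta i) + \sum_(j < n.+1 | (j < i)%N)
    (- a i j (comp xi j) (comp zeta j) + b i j (comp xi j) (above j (comp zeta))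
     - b i j (comp zeta j) (above j (comp xi))).
Proof.
exact: (comp_bracket ipl ipC ip0 lie_subspace lieS lie0 lien brl brC lie_br lie_ideal).
Qed.

Lemma stage_vertical v Ax nu i : comp ([< v, nu >] - [< Ax, nu >]) i =
  br i (comp v i) (comp nu i) - br i (comp Ax i) (comp nu i)
  + \sum_(j < n.+1 | (j < i)%N)
     (- a i j (comp v j) (comp nu j) + b i j (comp v j) (above j (comp nu))
      - b i j (comp nu j) (above j (comp v)) + a i j (comp Ax j) (comp nu j)
      - b i j (comp Ax j) (above j (comp nu)) + b i j (comp nu j) (above j (comp Ax))).
Proof.
have subr_shuffle (x y s t u : 'rV[R]_d) : s - t = u -> x + s - (y + t) = x - y + u.
  by move=> <-; rewrite opprD addrACA.
have subr_expand (x y z t u w : 'rV[R]_d) : x + y - z - (- t + u - w) = x + y - z + t - u + w.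
  by rewrite opprB opprD opprK [w + _]addrC !addrA.
apply: (etrans (stageB _ _ _)).
apply: (etrans (congr2 (fun x y => x - y) (stage_bracket v nu i) (stage_bracket Ax nu i))).
apply: subr_shuffle; rewrite -sumrB; apply: eq_bigr => j _.
exact: subr_expand.
Qed.

Lemma stage_horizontal B Adx v i : comp (B - [< Adx, v >]) i =
  comp B i - br i (comp Adx i) (comp v i)
  - \sum_(j < n.+1 | (j < i)%N)
     (- a i j (comp Adx j) (comp v j) + b i j (comp Adx j) (above j (comp v))
      - b i j (comp v j) (above j (comp Adx))).
Proof.
apply: (etrans (stageB _ _ _)); apply: (etrans (congr2 (fun x y => x - y) erefl (stage_bracket Adx v i))).
have subr_shuffle (x y z : 'rV[R]_d) : x - (y + z) = x - y - z by rewrite opprD addrA.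
exact: subr_shuffle.
Qed.

End ChainOfSubgroups.

(** * The equations by stages *)

Theorem mainTheorem2 (R : realType) (m d n : nat)
    (X : topologicalType) (aX : atlas 'rV[R]_m X)
    (G : topGroupType) (aG : atlas 'rV[R]_d G)
    (N : nat -> set G)
    (gG : G -> 'rV[R]_d -> 'rV[R]_d -> R)
    (L : X * G -> 'rV[R]_m * 'rV[R]_d -> R)
    (D : X * G -> set ('rV[R]_m * 'rV[R]_d))
    (kQ : X * G -> 'rV[R]_m * 'rV[R]_d -> 'rV[R]_m * 'rV[R]_d -> R)
    (A : X * G -> 'rV[R]_m * 'rV[R]_d -> 'rV[R]_d)
    (l : X -> 'rV[R]_m -> 'rV[R]_d -> R)
    (t0 t1 : R) (q : R -> X * G) :
  let aQ := prod_atlas aX aG in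
  is_manifold aX -> lie_group aG -> normal_chain n N ->
  riemannian_metric aG gG -> left_invariant aG gG ->
  tangent_smooth aQ L -> invariant_function aX aG L ->
  smooth_distribution aQ D -> invariant_distribution aX aG D ->
  (forall p w, exists w1 w2, [/\ D p w1, vertical aX aG p w2 & w = w1 + w2]) ->
  riemannian_metric aQ kQ -> invariant_metric aX aG kQ ->
  nonholonomic_connection aX aG D kQ A ->
  let Aloc x w := A (x, 1%g) (w, 0) in
  (forall x g dx dg, l x dx (Aloc x dx + left_triv aG g dg) = L (x, g) (dx, dg)) ->
  t0 < t1 -> smooth_curve aQ t0 t1 q ->
  (forall t, t0 <= t <= t1 -> D (q t) (velocity aQ q t)) ->
  let Sx x : set 'rV[R]_d := [set nu | D (x, 1%g) (0, nu)] in
  let x t := (q t).1 in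
  let g t := (q t).2 in
  let dx := velocity aX x in
  let v t := Aloc (x t) (dx t) + left_triv aG (g t) (velocity aG g t) in
  let comp := stage_comp aG gG n N in
  let br := quot_bracket aG gG N in
  let a i j xi zeta := comp (stage_a aG gG N j xi zeta) i in
  let b i j xi zeta := comp (stage_b aG j xi zeta) i in
  let eta t := comp (v t) in
  (* mu t i is the partial derivative of l in the i-th component of v t *)
  let mu t (i : 'I_n.+1) (zeta : 'rV[R]_d) : R :=
    'D_zeta (fun kappa => l (x t) (dx t) ((\sum_(k < n.+1 | k != i) eta t k) + kappa))
            (eta t i) in
  let B x w1 w2 := ext_deriv aX Aloc x w1 w2 - lie_bracket aG (Aloc x w1) (Aloc x w2) in
  (* above j c is the sum of the components c k with j < k *)
  let above (j : 'I_n.+1) (c : 'I_n.+1 -> 'rV[R]_d) := \sum_(k < n.+1 | (j < k)%N) c k in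
  (* l and its partial derivatives along the curve in the chart at p *)
  let lp p u w := l (chart_inv aX p u) (of_chart aX p u w) in
  let xp p t := chart aX p (x t) in
  let dxp p t := derive1 (xp p) t in
  let dl_dx p t u := 'D_u (fun y => lp p y (dxp p t) (v t)) (xp p t) in
  let dl_ddx p t u := 'D_u (fun y => lp p (xp p t) y (v t)) (dxp p t) in
  lagrange_dalembert aQ L D t0 t1 q <->
  forall t, t0 <= t <= t1 ->
    (forall zeta, Sx (x t) zeta ->
      let nu := comp zeta in
      let Ax := comp (Aloc (x t) (dx t)) in
      \sum_(j < n.+1) derive1 (fun r => mu r j (nu j)) t =
      \sum_(i < n.+1) mu t i
        (br i (eta t i) (nu i) - br i (Ax i) (nu i)
         + \sum_(j < n.+1 | (j < i)%N)
             (- a i j (eta t j) (nu j)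
              + b i j (eta t j) (above j nu)
              - b i j (nu j) (above j (eta t))
              + a i j (Ax j) (nu j)
              - b i j (Ax j) (above j nu)
              + b i j (nu j) (above j Ax))))
    /\
    (forall p, chart_dom aX p (x t) -> forall delta,
      let u := to_chart aX p (x t) delta in
      let Adx := comp (Aloc (x t) delta) in
      let phi := comp (B (x t) (dx t) delta) in
      dl_dx p t u - derive1 (fun r => dl_ddx p r u) t =
      \sum_(i < n.+1) mu t i
        (phi i - br i (Adx i) (eta t i)
         - \sum_(j < n.+1 | (j < i)%N)
             (- a i j (Adx j) (eta t j)
              + b i j (Adx j) (above j (eta t))
              - b i j (eta t j) (above j Adx)))).
Proof.
move=> aQ mX hG hN rG _ sL _ sD iD _ _ _ [[sA A_lin A_gen _] A_ker'] Aloc l_def t01.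
move=> [U [oU tU sq]] _ Sx x g dx v comp br a b eta mu B above lp xp dxp dl_dx' dl_ddx'.
have hX : smooth_atlas aX by have [_ _ h1 h2] := mX; split.
have fX : fin_dim 'rV[R]_m := fin_dim_rV m.
have fE : fin_dim 'rV[R]_d := fin_dim_rV d.
have hQ : smooth_atlas aQ := smooth_atlas_prod hX (lie_atlas hG) fX fE.
have A_ker p w : A p w = 0 -> D p w by move=> /A_ker'[].
have mq t : t0 <= t <= t1 -> msm aQ q t.
  by move=> ht; apply: (smooth_map_on_msm hQ oU _ sq); apply: tU; rewrite /= in_itv.
apply: iff_trans (principleP hX hG sL sA sD iD A_lin A_gen A_ker l_def t01 mq) _.
pose M r := fiber_derivative aX aG A l q 1 r.
have dxE r : dx r = tv aX (fun r => (q r).1) r 1 := velocity_tv _ _ _.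
have vE r : v r = vert aX aG A q 1 r.
  by rewrite /v dxE /g velocity_tv.
have M_sum r (c : 'I_n.+1 -> 'rV[R]_d) : \sum_i M r (c i) = M r (\sum_i c i).
  by rewrite /M /fiber_derivative dir_sumv.
have muE r i zeta : mu r i zeta = M r zeta.
  rewrite /mu (partial_fiber_derivative hX hG sL sA l_def).
  have -> : \sum_(k < n.+1 | k != i) eta r k + eta r i = v r.
    rewrite addrC -[RHS](stage_sum hG rG hN (v r)) [RHS](bigD1 i) //.
  by rewrite vE dxE.
(* the components of a vector are paired with the same linear form M t *)
have pairing_sum t (c : 'I_n.+1 -> 'rV[R]_d) W :
    (forall i, comp W i = c i) -> \sum_(i < n.+1) mu t i (c i) = M t W.
  move=> cE; rewrite -[X in M t X](stage_sum hG rG hN W) -M_sum.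
  by apply: eq_bigr => i _; rewrite muE -cE.
have vertE t zeta : t0 <= t <= t1 ->
  \sum_(j < n.+1) derive1 (fun r => mu r j (comp zeta j)) t = dir (fun r => M r zeta) t 1.
  move=> /mq mqt.
  have sM nu := sm_fiber_derivative hX hG sL sA l_def nu mqt.
  transitivity (\sum_(j < n.+1) dir (fun r => M r (comp zeta j)) t 1).
    apply: eq_bigr => j _.
    have -> : (fun r => mu r j (comp zeta j)) = (fun r => M r (comp zeta j)).
      by apply/funext => r; exact: muE.
    exact: derive1_dir (sM _).
  have sM' j : true -> sm (fun r => M r (comp zeta j)) t by move=> _; exact: sM.
  rewrite -(dir_sum (index_enum 'I_n.+1) (1 : R) sM').
  congr (dir _ t 1); apply/funext => r.
  by rewrite M_sum; congr (M r _); exact: (stage_sum hG rG hN zeta).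
have vert_form t zeta : t0 <= t <= t1 ->
    M t (lie_bracket aG (v t) zeta - lie_bracket aG (Aloc (x t) (dx t)) zeta)
    - \sum_(j < n.+1) derive1 (fun r => mu r j (comp zeta j)) t =
    vertical_eq aX aG A l q t zeta.
  by move=> ht; rewrite (vertE _ _ ht) vE dxE.
have hor_form p t delta : t0 <= t <= t1 -> chart_dom aX p (x t) ->
    let u := to_chart aX p (x t) delta in
    dl_dx' p t u - derive1 (fun r => dl_ddx' p r u) t
    - M t (B (x t) (dx t) delta - lie_bracket aG (Aloc (x t) delta) (v t)) =
    horizontal_eq aX aG A l q p t delta.
  move=> /mq mqt dp u; rewrite /horizontal_eq -/u.
  rewrite -(coordinate_dl_dx hX hG sL sA l_def u mqt dp).
  rewrite -(coordinate_dl_ddx_derive hX hG sL sA l_def u mqt dp).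
  have -> : derive1 (fun r => dl_ddx' p r u) t =
      derive1 (fun r => 'D_u (fun y => l (chart_inv aX p (chart aX p (q r).1))
      (of_chart aX p (chart aX p (q r).1) y) (vert aX aG A q 1 r))
      (derive1 (fun r => chart aX p (q r).1) r)) t.
    by congr (derive1 _ t); apply/funext => r; rewrite /dl_ddx' vE.
  by rewrite /dl_dx' vE dxE.
have subr_eq0' (y z : R) : (y = z) <-> (z - y = 0).
  by split=> [->|/eqP]; rewrite ?subrr // subr_eq0 => /eqP.
have subr_eq0'' (y z : R) : (y = z) <-> (y - z = 0).
  by split=> [->|/eqP]; rewrite ?subrr // subr_eq0 => /eqP.
have vert_sum t zeta := pairing_sum t _ _
  (stage_vertical hG rG hN (v t) (Aloc (x t) (dx t)) zeta).
have hor_sum t delta := pairing_sum t _ _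
  (stage_horizontal hG rG hN (B (x t) (dx t) delta) (Aloc (x t) delta) (v t)).
split=> h t ht; have [hV hH] := h t ht; split=> [zeta Dz|p dp delta].
- apply: (etrans _ (esym (vert_sum t zeta))).
  by apply/subr_eq0'; apply: (etrans (vert_form t zeta ht)); exact: hV.
- apply: (etrans _ (esym (hor_sum t delta))).
  by apply/subr_eq0''; apply: (etrans (hor_form p t delta ht dp)); exact: hH.
- apply: (etrans (esym (vert_form t zeta ht))); apply: (subr_eq0' _ _).1.
  exact: (etrans (hV zeta Dz) (vert_sum t zeta)).
apply: (etrans (esym (hor_form p t delta ht dp))); apply: (subr_eq0'' _ _).1.
exact: (etrans (hH p dp delta) (hor_sum t delta)).
Qed.
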